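(* Let $k\in(0,1)$, and for $m,n\in\mathbb{N}_0$ let $$H^{(q')}_{m,n}=(2m+1)(2n+1)\binom{2m}{m}\binom{2n}{n}\left(\frac k4\right)^{m+n}\frac{1+(1-k^2)(m+n+1)}{(m+n+1)(m+n+2)},$$ $$H^{(s')}_{m,n}=\binom{2m}{m}\binom{2n}{n}\left(\frac k4\right)^{m+n}\frac{(2m+1)(2n+1)}{(m+n+1)(m+n+2)}.$$ The matrices $H^{(q')}$ and $H^{(s')}$ both represent positive trace class operators on $\ell^2(\mathbb{N}_0)$ with simple eigenvalues. Moreover: (i) The eigenvalues of $H^{(q')}$ enumerated in descending order are $$\nu_m^{(q')}=\frac{2\pi}{kK}\,\frac{(2m+1)q^{m+1/2}}{1-q^{2m+1}},\quad m\ge0,$$ and for an eigenvector corresponding to $\nu_m^{(q')}$ one can choose the vector $\Psi_m^{(q)}$ with entries $$(\Psi_m^{(q)})_n=\frac{(-1)^n}{k^n(2n+1)!}\,q_n\!\left(\frac{\pi^2(2m+1)^2}{4K^2}\right),\quad n\in\mathbb{N}_0.$$ (ii) The eigenvalues of $H^{(s')}$ enumerated in descending order are $$\nu_m^{(s')}=\frac{4\pi}{k^2K}\,\frac{mq^m}{1-q^{2m}},\quad m\ge1,$$ and for an eigenvector corresponding to $\nu_m^{(s')}$ one can choose the vector $\Psi_m^{(s)}$ with entries $$(\Psi_m^{(s)})_n=\frac{(-1)^n}{k^n(2n+1)!}\,s_n\!\left(\frac{\pi^2m^2}{K^2}\right),\quad n\in\mathbb{N}_0.$$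
   Context: $\mathbb{N}_0=\{0,1,2,\dots\}$. For $k\in(0,1)$: $K=K(k)=\int_0^{\pi/2}\frac{d\theta}{\sqrt{1-k^2\sin^2\theta}}$, $K'(k)=K(\sqrt{1-k^2})$, and $q=\exp(-\pi K'(k)/K(k))\in(0,1)$ is the elliptic nome (the number $q$ is not to be confused with the polynomials $q_n$). The monic Stieltjes-Carlitz polynomials $q_n,s_n$ (depending on $k$) are defined for $n\ge0$ by $$q_{n+1}(x)=\big(x-(2n+1)^2-k^2(2n+2)^2\big)q_n(x)-k^2(2n+1)^2(2n)^2q_{n-1}(x),$$ $$s_{n+1}(x)=\big(x-k^2(2n+1)^2-(2n+2)^2\big)s_n(x)-k^2(2n+1)^2(2n)^2s_{n-1}(x),$$ with $q_{-1}=s_{-1}=0$ and $q_0=s_0=1$ (as polynomials). The enumerated eigenvalues are all the eigenvalues of the respective operator; ''simple'' means multiplicity one. *)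

(* Defs.v *)
(* Stdlib world: the classical real numbers, with Coquelicot for complex
   numbers, series and Riemann integrals.  The name C denotes the complex
   numbers; the binomial coefficient is Binomial.C. *)
From Stdlib Require Import Reals.
From Coquelicot Require Import Coquelicot.
Open Scope R_scope.

(** * The complex Hilbert space of square summable sequences *)

Definition ell2 (x : nat -> C) : Prop :=
  ex_series (fun n => Cmod (x n) ^ 2).

Definition ell2_norm (x : nat -> C) : R :=
  sqrt (Series (fun n => Cmod (x n) ^ 2)).

Definition Cseries (u : nat -> C) : C :=
  (Series (fun n => Re (u n)), Series (fun n => Im (u n))).

(* [Series] is total; here it is only meaningful for x and y in ell2, where
   the series converges absolutely. *)
Definition inner (x y : nat -> C) : C :=
  Cseries (fun n => (Cconj (x n) * y n)%C).

Definition std_basis (i : nat) : nat -> C :=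
  fun n => if Nat.eqb i n then RtoC 1 else RtoC 0.

Definition orthonormal_basis (e : nat -> nat -> C) : Prop :=
  (forall i, ell2 (e i)) /\
  (forall i j, inner (e i) (e j) = if Nat.eqb i j then RtoC 1 else RtoC 0) /\
  (forall x, ell2 x -> (forall i, inner (e i) x = RtoC 0) ->
     forall n, x n = RtoC 0).

(** * Operators *)

(* An operator on ell2 is encoded by a map on all sequences, of which only the
   values on ell2 matter. *)
Definition bounded_operator (T : (nat -> C) -> nat -> C) : Prop :=
  (forall x, ell2 x -> ell2 (T x)) /\
  (forall (a : C) (x y : nat -> C), ell2 x -> ell2 y ->
     forall n, T (fun j => (a * x j + y j)%C) n = (a * T x n + T y n)%C) /\
  (exists M : R, forall x, ell2 x -> ell2_norm (T x) <= M * ell2_norm x).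

(* The matrix H represents T with respect to the standard basis.  A bounded
   operator is uniquely determined on ell2 by its matrix. *)
Definition represents (H : nat -> nat -> R) (T : (nat -> C) -> nat -> C)
  : Prop :=
  bounded_operator T /\
  (forall m n, inner (std_basis m) (T (std_basis n)) = RtoC (H m n)).

Definition positive_operator (T : (nat -> C) -> nat -> C) : Prop :=
  bounded_operator T /\
  (forall x, ell2 x ->
     Im (inner x (T x)) = 0 /\ 0 <= Re (inner x (T x))).

Definition is_adjoint (T S : (nat -> C) -> nat -> C) : Prop :=
  bounded_operator S /\
  (forall x y, ell2 x -> ell2 y -> inner (T x) y = inner x (S y)).

(* A = |T| is the positive square root of T^* T. *)
Definition is_absolute_value (T A : (nat -> C) -> nat -> C) : Prop :=
  positive_operator A /\
  (exists S, is_adjoint T S /\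
     forall x, ell2 x -> forall n, A (A x) n = S (T x) n).

(* T is trace class when the trace of |T| is finite.  The terms of the series
   are the nonnegative real numbers <e_n, |T| e_n>. *)
Definition trace_class (T : (nat -> C) -> nat -> C) : Prop :=
  bounded_operator T /\
  (exists A, is_absolute_value T A /\
     forall e, orthonormal_basis e ->
       ex_series (fun n => Re (inner (e n) (A (e n))))).

Definition is_eigenvector (T : (nat -> C) -> nat -> C) (l : C) (v : nat -> C)
  : Prop :=
  ell2 v /\ (exists n, v n <> RtoC 0) /\ (forall n, T v n = (l * v n)%C).

Definition is_eigenvalue (T : (nat -> C) -> nat -> C) (l : C) : Prop :=
  exists v, is_eigenvector T l v.

(* The eigenspace is one-dimensional; for the self-adjoint operators considered
   here the geometric and the algebraic multiplicity agree. *)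
Definition is_simple_eigenvalue (T : (nat -> C) -> nat -> C) (l : C) : Prop :=
  exists v, is_eigenvector T l v /\
    forall u, is_eigenvector T l u -> exists c : C, forall n, u n = (c * v n)%C.

(** * Elliptic integrals and the nome *)

Definition ellK (k : R) : R :=
  RInt (fun t => / sqrt (1 - k ^ 2 * sin t ^ 2)) 0 (PI / 2).

Definition ellK' (k : R) : R := ellK (sqrt (1 - k ^ 2)).

Definition nome (k : R) : R := exp (- PI * ellK' k / ellK k).

(** * Stieltjes-Carlitz polynomials *)

(* Both families are given by their values at a real point x.  The inner match
   returns the value of the polynomial of index n - 1, which is zero for
   n = 0. *)
Fixpoint SC_q (k : R) (n : nat) (x : R) : R :=
  match n with
  | O => 1
  | S n' =>
      (x - (2 * INR n' + 1) ^ 2 - k ^ 2 * (2 * INR n' + 2) ^ 2) * SC_q k n' x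
      - k ^ 2 * (2 * INR n' + 1) ^ 2 * (2 * INR n') ^ 2 *
        match n' with
        | O => 0
        | S n'' => SC_q k n'' x
        end
  end.

Fixpoint SC_s (k : R) (n : nat) (x : R) : R :=
  match n with
  | O => 1
  | S n' =>
      (x - k ^ 2 * (2 * INR n' + 1) ^ 2 - (2 * INR n' + 2) ^ 2) * SC_s k n' x
      - k ^ 2 * (2 * INR n' + 1) ^ 2 * (2 * INR n') ^ 2 *
        match n' with
        | O => 0
        | S n'' => SC_s k n'' x
        end
  end.

(** * The two matrices, their eigenvalues and eigenvectors *)

Definition central_binom (n : nat) : R := Binomial.C (2 * n) n.

Definition Hq' (k : R) (m n : nat) : R :=
  (2 * INR m + 1) * (2 * INR n + 1) * central_binom m * central_binom n *
  (k / 4) ^ (m + n) *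
  ((1 + (1 - k ^ 2) * (INR m + INR n + 1)) /
   ((INR m + INR n + 1) * (INR m + INR n + 2))).

Definition Hs' (k : R) (m n : nat) : R :=
  central_binom m * central_binom n * (k / 4) ^ (m + n) *
  ((2 * INR m + 1) * (2 * INR n + 1) /
   ((INR m + INR n + 1) * (INR m + INR n + 2))).

Definition nu_q' (k : R) (m : nat) : R :=
  2 * PI / (k * ellK k) *
  ((2 * INR m + 1) * Rpower (nome k) (INR m + 1 / 2) /
   (1 - nome k ^ (2 * m + 1))).

(* Only used for m >= 1. *)
Definition nu_s' (k : R) (m : nat) : R :=
  4 * PI / (k ^ 2 * ellK k) *
  (INR m * nome k ^ m / (1 - nome k ^ (2 * m))).

Definition Psi_q (k : R) (m n : nat) : R :=
  (-1) ^ n / (k ^ n * INR (Factorial.fact (2 * n + 1))) *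
  SC_q k n (PI ^ 2 * (2 * INR m + 1) ^ 2 / (4 * ellK k ^ 2)).

Definition Psi_s (k : R) (m n : nat) : R :=
  (-1) ^ n / (k ^ n * INR (Factorial.fact (2 * n + 1))) *
  SC_s k n (PI ^ 2 * INR m ^ 2 / ellK k ^ 2).

(* Main.v *)
(** Both matrices are d_m d_n int_0^1 s^(m+n) (1 - alpha s) ds with
    d_n = (2n+1) C(2n,n) (k/4)^n, where alpha = k^2 for H^(q') and alpha = 1 for
    H^(s').  Hence the operators are positive, and Bessel's inequality applied at
    each s gives the trace class property.  Each matrix commutes with the Jacobi
    matrix of its orthogonal polynomials.

    Write t = sn u and let a(u) = dn u, b(u) = cn u for q_n, and a(u) = cn u,
    b(u) = dn u for s_n.  For the stated frequencies r, integration by parts shows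
    that the moments int_0^K t^(2n+1) a(u) sin(r u) du, multiplied by k^n, solve
    the recurrence of the polynomials.  So the formal eigenvectors decay like k^n,
    they are eigenvectors of the matrix by commutation, and they are complete
    because the functions sin(r u) are complete on [0, K]; this reduces to the
    Weierstrass theorem.  No other eigenvalues can occur.

    For the eigenvalue itself, the integral of a(u) t sin(r u) against
    1 / (1 + c t^2) is up to an elementary factor a solution of y'' = r^2 y in w,
    where i tan s = sn(i w) and c = k^2 tan^2 s; hence it is a multiple of
    sinh(r w).  The eigenvalue equation writes it as an integral over [0, 1] of
    (1 + c s)^(-3/2) times a continuous density.  Letting c tend to infinity, that
    is w to K', gives the eigenvalue as a constant multiple of r / sinh(r K'). *)

Require Import Defs.
From Stdlib Require Import Reals Lra Lia Psatz Classical FunctionalExtensionality.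
From Coquelicot Require Import Coquelicot.
Open Scope R_scope.

(** Commutation turns a solution of the recurrence into another one only if a double sum may be
    rearranged, and at a general point x the polynomials give no decay that would allow it. This is
    why the eigenvectors are rewritten as moments. Since the recurrence leaves only the value at
    index 0 free, the image under the matrix must then be a multiple of the vector, but the multiple
    stays unknown. To find it, the eigenvalue equation is read as a list of moments: they are those
    of the sine integral, multiplied by k^n / d_n. Now d_n / k^n is the coefficient of x^n in (1 -
    x)^(-3/2); this is the origin of the exponent -3/2. The passage from monomials to (1 + c
    s)^(-3/2) must cover large c, where the power series diverges, so it rests on Weierstrass
    approximation and not on termwise summation. Elliptic functions are written in the amplitude th
    with u = [ellF k th], and the imaginary argument in a second real amplitude s for the
    complementary modulus, so that all identities are between elementary functions. Both families
    share one argument because alpha beta = k^2 and one of alpha, beta is 1. *)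

Lemma cont_plus (f g : R -> R) (x : R) :
  continuous f x -> continuous g x -> continuous (fun y => f y + g y) x.
Proof. apply (continuous_plus f g). Qed.

Lemma cont_minus (f g : R -> R) (x : R) :
  continuous f x -> continuous g x -> continuous (fun y => f y - g y) x.
Proof. apply (continuous_minus f g). Qed.

Lemma cont_opp (f : R -> R) (x : R) :
  continuous f x -> continuous (fun y => - f y) x.
Proof. apply (continuous_opp f). Qed.

Lemma cont_mult (f g : R -> R) (x : R) :
  continuous f x -> continuous g x -> continuous (fun y => f y * g y) x.
Proof. apply (continuous_mult (K := R_AbsRing) f g). Qed.

Lemma cont_const (c x : R) : continuous (fun _ : R => c) x.
Proof. apply continuous_const. Qed.

Lemma cont_id (x : R) : continuous (fun y : R => y) x.
Proof. apply continuous_id. Qed.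

Lemma cont_comp (f g : R -> R) (x : R) :
  continuous f x -> continuous g (f x) -> continuous (fun y => g (f y)) x.
Proof. apply (continuous_comp f g). Qed.

Lemma cont_pow (f : R -> R) (n : nat) (x : R) :
  continuous f x -> continuous (fun y => f y ^ n) x.
Proof.
  intros H; apply (cont_comp f (fun y => y ^ n)); [easy|].
  apply (ex_derive_continuous (fun y => y ^ n)). auto_derive; easy.
Qed.

Lemma cont_inv (f : R -> R) (x : R) :
  continuous f x -> f x <> 0 -> continuous (fun y => / f y) x.
Proof.
  intros H H0; apply (cont_comp f Rinv); [easy|].
  apply (ex_derive_continuous Rinv). auto_derive; easy.
Qed.

Lemma cont_sqrt (f : R -> R) (x : R) :
  continuous f x -> continuous (fun y => sqrt (f y)) x.
Proof. intros H; apply (cont_comp f sqrt); [easy|apply continuous_sqrt]. Qed.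

Lemma cont_abs (f : R -> R) (x : R) :
  continuous f x -> continuous (fun y => Rabs (f y)) x.
Proof. intros H; apply (cont_comp f Rabs); [easy|apply continuous_Rabs]. Qed.

Lemma cont_sin (f : R -> R) (x : R) :
  continuous f x -> continuous (fun y => sin (f y)) x.
Proof. intros H; apply (cont_comp f sin); [easy|apply continuous_sin]. Qed.

Lemma cont_cos (f : R -> R) (x : R) :
  continuous f x -> continuous (fun y => cos (f y)) x.
Proof. intros H; apply (cont_comp f cos); [easy|apply continuous_cos]. Qed.

(* Coquelicot lemmas produce equations at carriers that are only convertible to
   [R], which [ring] does not recognize. *)
Ltac req := match goal with |- ?a = ?b => change (@eq R a b) end.

Ltac cont := repeat match goal with
  | H : continuous ?f ?x |- continuous ?f ?x => exact H
  | H : forall _, continuous ?f _ |- continuous ?f _ => apply H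
  | |- continuous (fun _ => ?c) ?x => exact (cont_const c x)
  | |- continuous (fun y => y) ?x => exact (cont_id x)
  | |- continuous (fun y => @?f y + @?g y) ?x => apply (cont_plus f g x)
  | |- continuous (fun y => @?f y - @?g y) ?x => apply (cont_minus f g x)
  | |- continuous (fun y => - @?f y) ?x => apply (cont_opp f x)
  | |- continuous (fun y => @?f y * @?g y) ?x => apply (cont_mult f g x)
  | |- continuous (fun y => @?f y / @?g y) ?x => apply (cont_mult f (fun z => / g z) x)
  | |- continuous (fun y => @?f y ^ ?n) ?x => apply (cont_pow f n x)
  | |- continuous (fun y => / @?f y) ?x => apply (cont_inv f x)
  | |- continuous (fun y => sqrt (@?f y)) ?x => apply (cont_sqrt f x)
  | |- continuous (fun y => Rabs (@?f y)) ?x => apply (cont_abs f x)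
  | |- continuous (fun y => sin (@?f y)) ?x => apply (cont_sin f x)
  | |- continuous (fun y => cos (@?f y)) ?x => apply (cont_cos f x)
  | |- continuous (fun y => ?f y) ?x => change (continuous f x)
  end.

(** * Polynomial approximation *)

(** The mean of f(N) for the number N of successes in n independent trials of probability x, by
    conditioning on one trial. In this form linearity, monotonicity and the second moment are plain
    inductions. The nodes are not scaled by n. *)
Fixpoint bernstein (n : nat) (x : R) (f : nat -> R) : R :=
  match n with
  | O => f O
  | S n' => x * bernstein n' x (fun j => f (S j)) + (1 - x) * bernstein n' x f
  end.

Lemma bernstein_ext n : forall x f g, (forall j, f j = g j) ->
  bernstein n x f = bernstein n x g.
Proof.
  induction n as [|n IH]; intros x f g H; simpl; [apply H|].
  rewrite (IH x f g H), (IH x (fun j => f (S j)) (fun j => g (S j))); auto.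
Qed.

Lemma bernstein_lin n : forall x c f g,
  bernstein n x (fun j => c * f j + g j) = c * bernstein n x f + bernstein n x g.
Proof.
  induction n as [|n IH]; intros x c f g; simpl; [ring|].
  rewrite (IH x c f g), (IH x c (fun j => f (S j)) (fun j => g (S j))). ring.
Qed.

Lemma bernstein_const n : forall x c, bernstein n x (fun _ => c) = c.
Proof. induction n as [|n IH]; intros x c; simpl; [easy|rewrite !IH; ring]. Qed.

Lemma bernstein_le n : forall x f g, 0 <= x <= 1 -> (forall j, (j <= n)%nat -> f j <= g j) ->
  bernstein n x f <= bernstein n x g.
Proof.
  induction n as [|n IH]; intros x f g Hx H; simpl; [apply H; lia|].
  apply Rplus_le_compat; apply Rmult_le_compat_l; try lra; apply IH; auto with arith.
Qed.

(** Variance plus squared mean. The shift c makes the induction work: a success replaces c by c +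
    1. *)
Lemma bernstein_sqr n : forall x c,
  bernstein n x (fun j => (INR j + c) ^ 2) = INR n * x * (1 - x) + (INR n * x + c) ^ 2.
Proof.
  induction n as [|n IH]; intros x c; [simpl; ring|].
  change (bernstein (S n) x (fun j => (INR j + c) ^ 2)) with
    (x * bernstein n x (fun j => (INR (S j) + c) ^ 2) +
     (1 - x) * bernstein n x (fun j => (INR j + c) ^ 2)).
  rewrite (bernstein_ext n x (fun j => (INR (S j) + c) ^ 2) (fun j => (INR j + (c + 1)) ^ 2)).
  2:{ intros j; rewrite S_INR; ring. }
  rewrite !IH, S_INR. ring.
Qed.

Lemma bernstein_continuous n : forall f x, continuous (fun x => bernstein n x f) x.
Proof.
  induction n as [|n IH]; intros f x; simpl; cont; apply IH.
Qed.

Lemma bernstein_approx (f : R -> R) (L : R) (n : nat) (x eps : R) :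
  (forall x y, 0 <= x <= 1 -> 0 <= y <= 1 -> Rabs (f x - f y) <= L * Rabs (x - y)) ->
  0 <= L -> 0 < eps -> L ^ 2 <= eps ^ 2 * INR n -> 0 <= x <= 1 ->
  Rabs (bernstein n x (fun j => f (INR j / INR n)) - f x) <= eps.
Proof.
  intros Hf HL He Hn Hx.
  destruct n as [|n].
  (* For n = 0 the hypothesis forces L = 0, and the only node [0 / 0] equals 0, which lies in the
     interval. *)
  { simpl in Hn. assert (L = 0) by nra. subst L.
    simpl. eapply Rle_trans; [apply Hf; [|lra]|lra].
    unfold Rdiv; rewrite Rmult_0_l; lra. }
  assert (HN : 0 < INR (S n)) by (apply lt_0_INR; lia).
  set (N := INR (S n)) in *.
  assert (Hj : forall j, (j <= S n)%nat -> 0 <= INR j / N <= 1).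
  { intros j Hj. split; [apply Rdiv_le_0_compat; [apply pos_INR|easy]|].
    apply Rle_div_l; [easy|]. rewrite Rmult_1_l. apply le_INR; easy. }
  (* AM-GM: [L |d| <= eps / 2 + L^2 d^2 / (2 eps)] turns the mean deviation
     into the variance. *)
  set (C := L ^ 2 / (2 * eps * N ^ 2)).
  assert (Hd : forall j, (j <= S n)%nat ->
     Rabs (f (INR j / N) - f x) <= C * (INR j + - (N * x)) ^ 2 + eps / 2).
  { intros j Hjn. eapply Rle_trans; [apply Hf; auto|].
    set (d := Rabs (INR j / N - x)).
    assert (Hd2 : d ^ 2 = (INR j + - (N * x)) ^ 2 / N ^ 2).
    { unfold d. rewrite <- Rsqr_pow2, <- Rsqr_abs. unfold Rsqr. field. lra. }
    unfold C. replace (L ^ 2 / (2 * eps * N ^ 2) * (INR j + - (N * x)) ^ 2)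
      with (L ^ 2 * d ^ 2 / (2 * eps)) by (rewrite Hd2; field; lra).
    assert (0 <= (L * d - eps) ^ 2 / (2 * eps)).
    { apply Rdiv_le_0_compat; [apply pow2_ge_0|lra]. }
    replace (L ^ 2 * d ^ 2 / (2 * eps)) with ((L * d - eps) ^ 2 / (2 * eps) + L * d - eps / 2)
      by (field; lra). lra. }
  assert (HB : bernstein (S n) x (fun j => C * (INR j + - (N * x)) ^ 2 + eps / 2) <= eps).
  { rewrite bernstein_lin, bernstein_const, bernstein_sqr. fold N. unfold C.
    replace (L ^ 2 / (2 * eps * N ^ 2) * (N * x * (1 - x) + (N * x + - (N * x)) ^ 2) + eps / 2)
      with ((L ^ 2 / N) * (x * (1 - x)) / (2 * eps) + eps / 2) by (field; lra).
    assert (H1 : L ^ 2 / N <= eps ^ 2) by (apply Rle_div_l; lra).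
    assert (H0 : 0 <= L ^ 2 / N) by (apply Rdiv_le_0_compat; nra).
    assert (H2 : (L ^ 2 / N) * (x * (1 - x)) / (2 * eps) <= eps / 2); [|lra].
    apply Rle_div_l; [lra|]. replace (eps / 2 * (2 * eps)) with (eps ^ 2) by field.
    assert (0 <= x * (1 - x) <= 1) by nra. nra. }
  assert (Hfx : bernstein (S n) x (fun j => 1 * f (INR j / N) + - f x)
                = bernstein (S n) x (fun j => f (INR j / N)) - f x).
  { rewrite bernstein_lin, bernstein_const. ring. }
  rewrite <- Hfx. apply Rabs_le. split.
  - assert (HB' : bernstein (S n) x
      (fun j => -1 * (C * (INR j + - (N * x)) ^ 2 + eps / 2) + 0) >= - eps).
    { rewrite bernstein_lin, bernstein_const. lra. }
    eapply Rle_trans; [apply Rge_le, HB'|].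
    apply bernstein_le; [easy|]. intros j Hjn. specialize (Hd j Hjn).
    apply Rabs_le_between in Hd. lra.
  - eapply Rle_trans; [|apply HB]. apply bernstein_le; [easy|].
    intros j Hjn. specialize (Hd j Hjn). apply Rabs_le_between in Hd. lra.
Qed.

(* The Weierstrass theorem in dual form: the monomials span a dense subspace
   of C[0,1], so they determine a bounded functional. *)
Lemma functional_eq_0 (L : (R -> R) -> R) (M : R) :
  (forall f g, (forall x, 0 <= x <= 1 -> continuous f x) ->
     (forall x, 0 <= x <= 1 -> continuous g x) ->
     L (fun x => f x + g x) = L f + L g) ->
  (forall c f, (forall x, 0 <= x <= 1 -> continuous f x) ->
     L (fun x => c * f x) = c * L f) ->
  (forall f g, (forall x, f x = g x) -> L f = L g) ->
  (forall f eps, (forall x, 0 <= x <= 1 -> continuous f x) ->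
     (forall x, 0 <= x <= 1 -> Rabs (f x) <= eps) -> Rabs (L f) <= M * eps) ->
  (forall j, L (fun x => x ^ j) = 0) ->
  forall f A, (forall x, 0 <= x <= 1 -> continuous f x) ->
    (forall x y, 0 <= x <= 1 -> 0 <= y <= 1 -> Rabs (f x - f y) <= A * Rabs (x - y)) ->
    L f = 0.
Proof.
  intros Hadd Hscal Hext Hbd Hmon f A Hf HA.
  (* The factor x^j is carried along because the recursion of [bernstein] multiplies by x. *)
  assert (HB : forall n g j, L (fun x => x ^ j * bernstein n x g) = 0).
  { induction n as [|n IH]; intros g j.
    - simpl. rewrite (Hext _ (fun x => g O * x ^ j)) by (intros; ring).
      rewrite Hscal by (intros; cont). rewrite Hmon; ring.
    - assert (Hc : forall i h x, continuous (fun x => x ^ i * bernstein n x h) x).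
      { intros. cont. apply bernstein_continuous. }
      rewrite (Hext _ (fun x => (x ^ (S j) * bernstein n x (fun j => g (S j)) +
        x ^ j * bernstein n x g) + -1 * (x ^ (S j) * bernstein n x g)))
        by (intros; simpl; ring).
      rewrite Hadd, Hadd, Hscal by (intros; cont; apply bernstein_continuous).
      rewrite !IH. ring. }
  assert (HM : 0 <= M).
  { assert (H := Hbd (fun x => x ^ 0) 1). rewrite Hmon, Rabs_R0 in H.
    rewrite Rmult_1_r in H. apply H; intros; [cont|].
    simpl; rewrite Rabs_R1; lra. }
  assert (HA0 : 0 <= A).
  { specialize (HA 1 0). rewrite Rminus_0_r, Rabs_R1, Rmult_1_r in HA.
    eapply Rle_trans; [apply Rabs_pos|apply HA; lra]. }
  apply Rabs_eq_0, Rle_antisym; [|apply Rabs_pos].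
  apply le_epsilon. intros e He. rewrite Rplus_0_l.
  (* M + 1 and not M, since M may be 0. *)
  set (e' := e / (M + 1)).
  assert (He' : 0 < e') by (apply Rdiv_lt_0_compat; lra).
  destruct (nfloor_ex (A ^ 2 / e' ^ 2)) as [n [_ Hn]].
  { apply Rdiv_le_0_compat; nra. }
  set (B := fun x => bernstein (S n) x (fun j => f (INR j / INR (S n)))).
  assert (Happ : forall x, 0 <= x <= 1 -> Rabs (B x - f x) <= e').
  { intros x Hx. apply bernstein_approx with (L := A); try easy.
    assert (0 < e' ^ 2) by nra.
    replace (A ^ 2) with (e' ^ 2 * (A ^ 2 / e' ^ 2)) by (field; lra).
    apply Rmult_le_compat_l; [lra|]. rewrite S_INR. lra. }
  assert (HLB : L (fun x => B x + -1 * f x) = - L f).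
  { rewrite Hadd, Hscal; try easy.
    - rewrite (Hext B (fun x => x ^ 0 * bernstein (S n) x (fun j => f (INR j / INR (S n)))))
        by (intros; unfold B; ring). rewrite HB. ring.
    - intros; apply bernstein_continuous.
    - intros y Hy. specialize (Hf y Hy). cont. }
  rewrite <- Rabs_Ropp, <- HLB.
  eapply Rle_trans; [apply (Hbd _ e')|].
  - intros y Hy. specialize (Hf y Hy). unfold B. cont. apply bernstein_continuous.
  - intros x Hx. replace (B x + -1 * f x) with (B x - f x) by ring. auto.
  - replace e with ((M + 1) * e') by (unfold e'; field; lra). nra.
Qed.

(** * Integrals *)

(** The Weierstrass M-test. [filterlim_RInt] asks for uniform convergence on the whole line, hence
    the bounds at every x; [RInt_series] reduces an interval to this case by composing with
    [clip]. *)
Lemma RInt_series_global (f : nat -> R -> R) (M : nat -> R) (a b : R) :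
  (forall n x, continuous (f n) x) -> (forall n x, Rabs (f n x) <= M n) -> ex_series M ->
  is_RInt (fun x => Series (fun n => f n x)) a b (Series (fun n => RInt (f n) a b)).
Proof.
  intros Hc HM Hs.
  assert (Hex : forall x, ex_series (fun n => f n x)).
  { intros x. apply (ex_series_le (K := R_AbsRing) (V := R_CompleteNormedModule) _ M); [intros n;
    apply HM|easy]. }
  assert (HI : forall n, ex_RInt (f n) a b).
  { intros n. apply (ex_RInt_continuous (V := R_CompleteNormedModule)). intros; apply Hc. }
  destruct (filterlim_RInt (V := R_CompleteNormedModule)
    (fun N x => sum_n (fun n => f n x) N) a b eventually _
    (fun x => Series (fun n => f n x)) (fun N => sum_n (fun n => RInt (f n) a b) N))
    as [l [H1 H2]].
  - induction x as [|N IH].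
    + rewrite sum_O. apply (is_RInt_ext (f 0%nat)).
      * intros x _. now rewrite sum_O.
      * apply (RInt_correct (V := R_CompleteNormedModule)). apply HI.
    + rewrite sum_Sn. apply (is_RInt_ext (fun x => plus (sum_n (fun n => f n x) N) (f (S N) x))).
      * intros x _. now rewrite sum_Sn.
      * apply (is_RInt_plus (V := R_NormedModule)); [apply IH|].
        apply (RInt_correct (V := R_CompleteNormedModule)). apply HI.
  - apply filterlim_locally. intros eps.
    destruct Hs as [S HS].
    assert (HS' : is_lim_seq (sum_n M) S) by exact HS.
    apply is_lim_seq_spec in HS'. destruct (HS' eps) as [N0 HN0].
    exists N0. intros N HN x. specialize (HN0 N HN).
    assert (HMs : ex_series (fun k => M (Datatypes.S N + k)%nat)).
    { apply (ex_series_incr_n M (Datatypes.S N)). exists S; exact HS. }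
    assert (E1 : Series (fun n => f n x) = sum_n (fun n => f n x) N +
       Series (fun k => f (Datatypes.S N + k)%nat x)).
    { rewrite (Series_incr_n (fun n => f n x) (Datatypes.S N)); [|lia|apply Hex].
      simpl pred. now rewrite sum_n_Reals. }
    assert (E2 : S = sum_n M N + Series (fun k => M (Datatypes.S N + k)%nat)).
    { rewrite <- (is_series_unique M S HS).
      rewrite (Series_incr_n M (Datatypes.S N)); [|lia|exists S; exact HS].
      simpl pred. now rewrite sum_n_Reals. }
    change (Rabs (sum_n (fun n => f n x) N - Series (fun n => f n x)) < eps).
    rewrite E1. replace (sum_n (fun n => f n x) N - _) with
      (- Series (fun k => f (Datatypes.S N + k)%nat x)) by ring.
    rewrite Rabs_Ropp.
    assert (Hab : ex_series (fun k => Rabs (f (Datatypes.S N + k)%nat x))).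
    { apply (ex_series_le (K := R_AbsRing) (V := R_CompleteNormedModule) _
        (fun k => M (Datatypes.S N + k)%nat)); auto.
      intros k. unfold norm; simpl. unfold abs; simpl. rewrite Rabs_Rabsolu. apply HM. }
    eapply Rle_lt_trans; [apply Series_Rabs, Hab|].
    eapply Rle_lt_trans; [apply Series_le; [|apply HMs]|].
    + intros k; split; [apply Rabs_pos|apply HM].
    + rewrite E2 in HN0. rewrite Rabs_minus_sym in HN0.
      eapply Rle_lt_trans; [apply Rle_abs|].
      eapply Rle_lt_trans; [|apply HN0]. right. f_equal. ring.
  - replace (Series (fun n => RInt (f n) a b)) with l; [easy|].
    symmetry. apply is_series_unique. exact H1.
Qed.

Definition clip (a b x : R) : R := Rmax a (Rmin b x).

Lemma clip_id (a b x : R) : a <= x <= b -> clip a b x = x.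
Proof. intros H; unfold clip. rewrite Rmin_right, Rmax_right; lra. Qed.

Lemma clip_in (a b x : R) : a <= b -> a <= clip a b x <= b.
Proof.
  intros H; unfold clip. split; [apply Rmax_l|].
  apply Rmax_lub; [easy|apply Rmin_l].
Qed.

Lemma Rmax_abs (x y : R) : Rmax x y = (x + y + Rabs (x - y)) / 2.
Proof. unfold Rmax, Rabs. destruct Rle_dec; destruct Rcase_abs; lra. Qed.

Lemma Rmin_abs (x y : R) : Rmin x y = (x + y - Rabs (x - y)) / 2.
Proof. unfold Rmin, Rabs. destruct Rle_dec; destruct Rcase_abs; lra. Qed.

Lemma clip_continuous (a b x : R) : continuous (clip a b) x.
Proof.
  apply (continuous_ext (fun x => (a + (b + x - Rabs (b - x)) / 2 +
     Rabs (a - (b + x - Rabs (b - x)) / 2)) / 2)).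
  - intros y. unfold clip. rewrite Rmax_abs, Rmin_abs. easy.
  - unfold Rdiv. cont.
Qed.

Lemma RInt_series (f : nat -> R -> R) (M : nat -> R) (a b : R) :
  a <= b ->
  (forall n x, a <= x <= b -> continuous (f n) x) ->
  (forall n x, a <= x <= b -> Rabs (f n x) <= M n) -> ex_series M ->
  is_RInt (fun x => Series (fun n => f n x)) a b (Series (fun n => RInt (f n) a b)).
Proof.
  intros Hab Hc HM Hs.
  assert (H := RInt_series_global (fun n x => f n (clip a b x)) M a b).
  rewrite (Series_ext _ (fun n => RInt (fun x => f n (clip a b x)) a b)).
  2:{ intros n. apply RInt_ext. rewrite Rmin_left, Rmax_right by easy.
      intros x Hx. rewrite clip_id; [easy|lra]. }
  apply (is_RInt_ext (fun x => Series (fun n => f n (clip a b x)))).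
  { rewrite Rmin_left, Rmax_right by easy. intros x Hx. rewrite clip_id; [easy|lra]. }
  apply H; [| |easy].
  - intros n x. apply (cont_comp (clip a b) (f n)); [apply clip_continuous|].
    apply Hc, clip_in, Hab.
  - intros n x. apply HM, clip_in, Hab.
Qed.

Lemma ex_RInt_cont (f : R -> R) (a b : R) : a <= b ->
  (forall x, a <= x <= b -> continuous f x) -> ex_RInt f a b.
Proof.
  intros Hab H. apply (ex_RInt_continuous (V := R_CompleteNormedModule)).
  rewrite Rmin_left, Rmax_right by easy. easy.
Qed.

Lemma RInt_ext_le (f g : R -> R) (a b : R) : a <= b ->
  (forall x, a <= x <= b -> f x = g x) -> RInt f a b = RInt g a b.
Proof.
  intros Hab H. apply RInt_ext. rewrite Rmin_left, Rmax_right by easy.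
  intros x Hx; apply H; lra.
Qed.

Lemma RInt_plus_cont (f g : R -> R) (a b : R) : a <= b ->
  (forall x, a <= x <= b -> continuous f x) -> (forall x, a <= x <= b -> continuous g x) ->
  RInt (fun x => f x + g x) a b = RInt f a b + RInt g a b.
Proof.
  intros Hab Hf Hg. apply (RInt_plus (V := R_CompleteNormedModule));
  now apply ex_RInt_cont.
Qed.

Lemma RInt_scal_cont (c : R) (f : R -> R) (a b : R) : a <= b ->
  (forall x, a <= x <= b -> continuous f x) ->
  RInt (fun x => c * f x) a b = c * RInt f a b.
Proof.
  intros Hab Hf. apply (RInt_scal (V := R_CompleteNormedModule)). now apply ex_RInt_cont.
Qed.

Lemma abs_RInt_mult_le (f g : R -> R) (a b e : R) : a <= b ->
  (forall x, a <= x <= b -> continuous f x) -> (forall x, a <= x <= b -> continuous g x) ->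
  (forall x, a <= x <= b -> Rabs (g x) <= e) ->
  Rabs (RInt (fun x => f x * g x) a b) <= RInt (fun x => Rabs (f x)) a b * e.
Proof.
  intros Hab Hf Hg He.
  eapply Rle_trans; [apply abs_RInt_le; [easy|]|].
  { apply ex_RInt_cont; [easy|]. intros x Hx. specialize (Hf x Hx). specialize (Hg x Hx). cont. }
  rewrite Rmult_comm, <- RInt_scal_cont; [|easy|].
  2:{ intros x Hx. specialize (Hf x Hx). cont. }
  apply RInt_le; [easy| | |].
  1,2: apply ex_RInt_cont; [easy|]; intros x Hx; specialize (Hf x Hx);
     specialize (Hg x Hx); cont.
  intros x Hx. rewrite Rabs_mult, Rmult_comm.
  apply Rmult_le_compat_r; [apply Rabs_pos|]. apply He; lra.
Qed.

Lemma continuous_bounded (f : R -> R) a b : a <= b ->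
  (forall x, a <= x <= b -> continuous f x) ->
  exists M, forall x, a <= x <= b -> Rabs (f x) <= M.
Proof.
  intros Hab Hf. destruct (continuity_ab_maj (fun s => Rabs (f s)) a b) as [m [Hm _]]; [easy| |].
  - intros s Hs. apply continuity_pt_filterlim. apply (cont_abs f s (Hf s Hs)).
  - now exists (Rabs (f m)).
Qed.

Lemma continuous_pos_near (f : R -> R) (x : R) : continuous f x -> 0 < f x ->
  exists d : posreal, forall y, Rabs (y - x) < d -> 0 < f y.
Proof.
  intros Hc Hp. assert (H := proj1 (filterlim_locally _ _) Hc (mkposreal _ Hp)).
  destruct H as [d Hd]. exists d. intros y Hy. specialize (Hd y Hy).
  change (Rabs (f y - f x) < f x) in Hd. apply Rabs_def2 in Hd. lra.
Qed.

Lemma RInt_pos (f : R -> R) (a b c : R) : a < c < b ->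
  (forall x, a <= x <= b -> continuous f x) -> (forall x, a <= x <= b -> 0 <= f x) ->
  0 < f c -> 0 < RInt f a b.
Proof.
  intros Hc Hf Hp Hfc.
  destruct (continuous_pos_near f c) as [d Hd]; [apply Hf; lra|easy|].
  assert (Hd0 := cond_pos d).
  set (e := Rmin (b - c) (d / 2)).
  assert (He : 0 < e /\ e <= b - c /\ e <= d / 2).
  { split; [apply Rmin_pos; lra|]. split; [apply Rmin_l|apply Rmin_r]. }
  assert (E : forall u v, a <= u <= v -> v <= b -> ex_RInt f u v).
  { intros u v Hu Hv. apply ex_RInt_cont; [lra|]. intros; apply Hf; lra. }
  rewrite <- (RInt_Chasles (V := R_CompleteNormedModule) f a c b) by (apply E; lra).
  rewrite <- (RInt_Chasles (V := R_CompleteNormedModule) f c (c + e) b) by (apply E; lra).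
  unfold plus; simpl.
  assert (0 <= RInt f a c) by (apply RInt_ge_0; [lra|apply E; lra|intros; apply Hp; lra]).
  assert (0 <= RInt f (c + e) b) by (apply RInt_ge_0; [lra|apply E; lra|intros; apply Hp; lra]).
  assert (0 < RInt f c (c + e)); [|lra].
  apply RInt_gt_0; [lra| |].
  - intros x Hx. apply Hd. apply Rabs_def1; lra.
  - intros x Hx. apply Hf; lra.
Qed.

(** The integral of g times f(X) is a bounded functional of f that vanishes on monomials, hence on
    Lipschitz f by [functional_eq_0]. A narrow tent function centred at X(x) then contradicts g(x)
    <> 0. *)
Lemma moments_eq_0 (g X : R -> R) (a b : R) : a <= b ->
  (forall x, a <= x <= b -> continuous g x) ->
  (forall x, a <= x <= b -> continuous X x) ->
  (forall x, a <= x <= b -> 0 <= X x <= 1) ->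
  (forall x y, a <= x -> x < y -> y <= b -> X x < X y) ->
  (forall j, RInt (fun x => g x * X x ^ j) a b = 0) ->
  forall x, a < x < b -> g x = 0.
Proof.
  intros Hab Hg HX HX01 Hinc Hmom.
  set (L := fun f : R -> R => RInt (fun x => g x * f (X x)) a b).
  assert (HL : forall f A, (forall x, 0 <= x <= 1 -> continuous f x) ->
    (forall x y, 0 <= x <= 1 -> 0 <= y <= 1 -> Rabs (f x - f y) <= A * Rabs (x - y)) ->
    L f = 0).
  { assert (Hcc : forall f, (forall x, 0 <= x <= 1 -> continuous f x) ->
      forall x, a <= x <= b -> continuous (fun x => g x * f (X x)) x).
    { intros f Hf x Hx. apply cont_mult; [auto|]. apply (cont_comp X f); auto. }
    apply (functional_eq_0 L (RInt (fun x => Rabs (g x)) a b)).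
    - intros f h Hf Hh. unfold L.
      rewrite <- RInt_plus_cont; [|easy|now apply Hcc|now apply Hcc].
      apply RInt_ext_le; [easy|]. intros; ring.
    - intros c f Hf. unfold L. rewrite <- RInt_scal_cont; [|easy|now apply Hcc].
      apply RInt_ext_le; [easy|]. intros; ring.
    - intros f h H. unfold L. apply RInt_ext_le; [easy|]. intros; now rewrite H.
    - intros f e Hf He. unfold L. apply abs_RInt_mult_le; auto.
      intros x Hx. apply (cont_comp X f); auto.
    - apply Hmom. }
  assert (HLt : forall x0 d, 0 <= d -> L (fun y => Rmax 0 (d - Rabs (y - x0))) = 0).
  { intros x0 d Hd. apply (HL _ 1).
    - intros x _. apply (continuous_ext (fun y => (0 + (d - Rabs (y - x0)) +
         Rabs (0 - (d - Rabs (y - x0)))) / 2)).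
      + intros y. now rewrite Rmax_abs.
      + unfold Rdiv. cont.
    - intros x y _ _. rewrite Rmult_1_l, !Rmax_abs.
      unfold Rabs; repeat destruct Rcase_abs; lra. }
  assert (Hpos : forall s, s = 1 \/ s = -1 -> forall x, a < x < b -> ~ 0 < s * g x).
  { intros s Hs x Hx Hgx.
    destruct (continuous_pos_near (fun x => s * g x) x) as [d Hd]; [|easy|].
    { assert (continuous g x) by (apply Hg; lra). cont. }
    assert (Hd0 := cond_pos d).
    (* Since X increases strictly, values within e of X(x) are taken only between u and v, where s *
       g is positive. *)
    set (u := Rmax a (x - d / 2)). set (v := Rmin b (x + d / 2)).
    assert (Hu : a <= u < x /\ x - d / 2 <= u).
    { split; [split; [apply Rmax_l|apply Rmax_lub_lt; lra]|apply Rmax_r]. }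
    assert (Hv : x < v <= b /\ v <= x + d / 2).
    { split; [split; [apply Rmin_glb_lt; lra|apply Rmin_l]|apply Rmin_r]. }
    assert (H1 : X u < X x) by (apply Hinc; lra).
    assert (H2 : X x < X v) by (apply Hinc; lra).
    set (e := Rmin (X x - X u) (X v - X x)).
    assert (He : 0 < e /\ e <= X x - X u /\ e <= X v - X x).
    { split; [apply Rmin_pos; lra|]. split; [apply Rmin_l|apply Rmin_r]. }
    assert (Hz := HLt (X x) e (Rlt_le _ _ (proj1 He))). unfold L in Hz.
    assert (Hc : forall y, a <= y <= b ->
      continuous (fun y => s * (g y * Rmax 0 (e - Rabs (X y - X x)))) y).
    { intros y Hy.
      apply (continuous_ext (fun y => s * (g y * ((0 + (e - Rabs (X y - X x)) +
         Rabs (0 - (e - Rabs (X y - X x)))) / 2)))).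
      - intros z. now rewrite Rmax_abs.
      - specialize (Hg y Hy). specialize (HX y Hy). unfold Rdiv. cont. }
    assert (0 < RInt (fun y => s * (g y * Rmax 0 (e - Rabs (X y - X x)))) a b).
    { apply (RInt_pos _ a b x Hx Hc).
      - intros y Hy.
        destruct (Rle_lt_dec (e - Rabs (X y - X x)) 0) as [H|H].
        + rewrite Rmax_left by easy. right; ring.
        + rewrite Rmax_right by lra. rewrite <- Rmult_assoc.
          apply Rmult_le_pos; [|lra]. left. apply Hd.
          assert (Ha : Rabs (X y - X x) < e) by lra. apply Rabs_def2 in Ha.
          assert (~ y <= u).
          { intros Hyu. assert (X y <= X u); [|lra].
            destruct Hyu as [Hyu| ->]; [left; apply Hinc; lra|lra]. }
          assert (~ v <= y).
          { intros Hyu. assert (X v <= X y); [|lra].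
            destruct Hyu as [Hyu| ->]; [left; apply Hinc; lra|lra]. }
          apply Rabs_def1; lra.
      - rewrite Rminus_eq_0, Rabs_R0, Rminus_0_r, Rmax_right by lra. nra. }
    assert (E : RInt (fun y => s * (g y * Rmax 0 (e - Rabs (X y - X x)))) a b = 0); [|lra].
    rewrite (RInt_ext_le _ (fun y => s * (s * (s * (g y * Rmax 0 (e - Rabs (X y - X x))))))) by
      (easy || (intros; destruct Hs as [-> | ->]; ring)).
    rewrite RInt_scal_cont; [|easy|].
    2:{ intros y Hy. apply (cont_mult (fun _ => s)); [apply cont_const|now apply Hc]. }
    rewrite (RInt_ext_le _ (fun y => g y * Rmax 0 (e - Rabs (X y - X x)))) by
      (easy || (intros; destruct Hs as [-> | ->]; ring)).
    rewrite Hz. apply Rmult_0_r. }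
  intros x Hx.
  assert (A1 := Hpos 1 (or_introl eq_refl) x Hx).
  assert (A2 := Hpos (-1) (or_intror eq_refl) x Hx). lra.
Qed.

(** * Square summable sequences *)

Definition l2 (v : nat -> R) : Prop := ex_series (fun n => v n ^ 2).

Lemma ex_series_abs_le (a b : nat -> R) :
  (forall n, Rabs (a n) <= b n) -> ex_series b -> ex_series a.
Proof. intros H. apply (ex_series_le (K := R_AbsRing) (V := R_CompleteNormedModule)); easy. Qed.

Lemma ex_series_scal_R (c : R) (a : nat -> R) :
  ex_series a -> ex_series (fun n => c * a n).
Proof. apply (ex_series_scal (V := R_NormedModule)). Qed.

Lemma ex_series_plus_R (a b : nat -> R) :
  ex_series a -> ex_series b -> ex_series (fun n => a n + b n).
Proof. apply (ex_series_plus (V := R_NormedModule)). Qed.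

Lemma l2_mult_abs (a b : nat -> R) : l2 a -> l2 b -> ex_series (fun n => Rabs (a n * b n)).
Proof.
  intros Ha Hb. apply ex_series_abs_le with (fun n => a n ^ 2 + b n ^ 2).
  - intros n. rewrite Rabs_Rabsolu. apply Rabs_le.
    assert (0 <= (a n + b n) ^ 2) by apply pow2_ge_0.
    assert (0 <= (a n - b n) ^ 2) by apply pow2_ge_0. nra.
  - now apply ex_series_plus_R.
Qed.

Lemma l2_mult_ex_series (a b : nat -> R) : l2 a -> l2 b -> ex_series (fun n => a n * b n).
Proof. intros Ha Hb. apply ex_series_Rabs. now apply l2_mult_abs. Qed.

Lemma l2_abs (a : nat -> R) : l2 a -> l2 (fun n => Rabs (a n)).
Proof.
  apply ex_series_ext. intros n. now rewrite <- !Rsqr_pow2, <- Rsqr_abs.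
Qed.

Lemma l2_lin (c : R) (a b : nat -> R) : l2 a -> l2 b -> l2 (fun n => c * a n + b n).
Proof.
  intros Ha Hb. apply ex_series_abs_le with (fun n => (2 * c ^ 2) * a n ^ 2 + 2 * b n ^ 2).
  - intros n. rewrite Rabs_pos_eq by apply pow2_ge_0.
    assert (0 <= (c * a n - b n) ^ 2) by apply pow2_ge_0. lra.
  - apply ex_series_plus_R; now apply ex_series_scal_R.
Qed.

Lemma Series_nonneg (a : nat -> R) : (forall n, 0 <= a n) -> ex_series a -> 0 <= Series a.
Proof.
  intros Ha Hs. rewrite <- (Rmult_0_l (Series a)), <- Series_scal_l.
  apply Series_le; [|easy]. intros n. specialize (Ha n). lra.
Qed.

Lemma Series_cauchy_schwarz (a b : nat -> R) : l2 a -> l2 b ->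
  Series (fun n => a n * b n) ^ 2 <= Series (fun n => a n ^ 2) * Series (fun n => b n ^ 2).
Proof.
  intros Ha Hb. assert (Hab := l2_mult_ex_series a b Ha Hb).
  set (A := Series (fun n => a n ^ 2)). set (B := Series (fun n => a n * b n)).
  set (D := Series (fun n => b n ^ 2)).
  assert (H : forall x y, 0 <= x ^ 2 * A + (2 * x * y) * B + y ^ 2 * D).
  { intros x y. unfold A, B, D. rewrite <- !Series_scal_l.
    assert (E1 := ex_series_scal_R (x ^ 2) _ Ha).
    assert (E2 := ex_series_scal_R (2 * x * y) _ Hab).
    assert (E3 := ex_series_scal_R (y ^ 2) _ Hb).
    assert (E12 := ex_series_plus_R _ _ E1 E2).
    rewrite <- (Series_plus _ _ E1 E2), <- (Series_plus _ _ E12 E3).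
    apply Series_nonneg; [|now apply ex_series_plus_R].
    intros n. replace (_ + _) with ((x * a n + y * b n) ^ 2) by ring. apply pow2_ge_0. }
  assert (HA : 0 <= A) by (apply Series_nonneg; [intros; apply pow2_ge_0|easy]).
  assert (HD : 0 <= D) by (apply Series_nonneg; [intros; apply pow2_ge_0|easy]).
  clearbody A B D.
  (* At the point (D, -B) the quadratic form equals D (A D - B^2). If D = 0, the point (B, -(A + 1))
     gives 0 <= -B^2 (A + 2), so B = 0. *)
  destruct (Rle_lt_or_eq_dec _ _ HD) as [H0|H0].
  - specialize (H D (- B)).
    assert (0 <= A * D - B ^ 2); [|lra].
    apply Rmult_le_reg_l with D; [easy|]. lra.
  - specialize (H B (- (A + 1))). rewrite <- H0 in *. nra.
Qed.

Lemma Series_term_le (a : nat -> R) (n : nat) :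
  (forall n, 0 <= a n) -> ex_series a -> a n <= Series a.
Proof.
  intros Ha Hs. rewrite (Series_incr_n _ (S n)); [|lia|easy]. simpl pred.
  assert (a n <= sum_f_R0 a n).
  { destruct n; [simpl; lra|]. rewrite tech5.
    assert (0 <= sum_f_R0 a n) by now apply cond_pos_sum. lra. }
  assert (0 <= Series (fun k => a (S n + k)%nat)); [|lra].
  apply Series_nonneg; [auto|]. now apply (ex_series_incr_n a (S n)).
Qed.

Lemma l2_bounded (v : nat -> R) : l2 v -> exists M, forall n, Rabs (v n) <= M.
Proof.
  intros Hv. exists (Series (fun n => v n ^ 2) + 1). intros n.
  assert (H : v n ^ 2 <= Series (fun n => v n ^ 2)).
  { apply (Series_term_le (fun n => v n ^ 2)); [intros; apply pow2_ge_0|easy]. }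
  apply Rabs_le. nra.
Qed.

Lemma ex_series_nonneg_bounded (a : nat -> R) (M : R) :
  (forall n, 0 <= a n) -> (forall N, sum_n a N <= M) -> ex_series a.
Proof.
  intros Ha HM. destruct (ex_finite_lim_seq_incr (sum_n a) M) as [l Hl].
  - intros n. rewrite sum_Sn. unfold plus; simpl. specialize (Ha (S n)). lra.
  - easy.
  - exists l. exact Hl.
Qed.

Lemma Cmod_sqr (z : C) : Cmod z ^ 2 = Re z ^ 2 + Im z ^ 2.
Proof.
  unfold Cmod. rewrite pow2_sqrt; [easy|].
  apply Rplus_le_le_0_compat; apply pow2_ge_0.
Qed.

Lemma ell2_l2 (x : nat -> C) :
  ell2 x <-> l2 (fun n => Re (x n)) /\ l2 (fun n => Im (x n)).
Proof.
  unfold ell2, l2. split.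
  - intros H. split; apply ex_series_abs_le with (2 := H); intros n; rewrite Cmod_sqr;
      rewrite Rabs_pos_eq by apply pow2_ge_0;
      assert (0 <= Re (x n) ^ 2) by apply pow2_ge_0;
      assert (0 <= Im (x n) ^ 2) by apply pow2_ge_0; lra.
  - intros [H1 H2]. apply (ex_series_ext (fun n => Re (x n) ^ 2 + Im (x n) ^ 2)).
    + intros n. now rewrite Cmod_sqr.
    + now apply ex_series_plus_R.
Qed.

Lemma inner_eq (x y : nat -> C) : inner x y =
  (Series (fun n => Re (x n) * Re (y n) + Im (x n) * Im (y n)),
   Series (fun n => Re (x n) * Im (y n) - Im (x n) * Re (y n))).
Proof.
  unfold inner, Cseries. f_equal; apply Series_ext; intros n; unfold Re, Im; simpl; ring.
Qed.

Lemma Series_single (m : nat) (a : nat -> R) :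
  Series (fun n => if Nat.eqb m n then a n else 0) = a m.
Proof.
  apply is_series_unique.
  assert (H : forall N, sum_n (fun n => if Nat.eqb m n then a n else 0) N =
    if Nat.leb m N then a m else 0).
  { induction N as [|N IH].
    - rewrite sum_O. destruct m; easy.
    - rewrite sum_Sn, IH. unfold plus; simpl AbelianMonoid.plus.
      destruct (Nat.eqb_spec m (S N)) as [->|Hm].
      + rewrite (proj2 (Nat.leb_gt _ _)), Nat.leb_refl by lia. apply Rplus_0_l.
      + destruct (Nat.leb_spec m N).
        * rewrite (proj2 (Nat.leb_le _ _)) by lia. apply Rplus_0_r.
        * rewrite (proj2 (Nat.leb_gt _ _)) by lia. apply Rplus_0_r. }
  change (is_lim_seq (sum_n (fun n => if Nat.eqb m n then a n else 0)) (a m)).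
  apply (is_lim_seq_ext_loc (fun _ => a m)); [|apply is_lim_seq_const].
  exists m. intros N HN. rewrite H. now rewrite (proj2 (Nat.leb_le _ _)).
Qed.

(** The real part of [inner]. An orthonormal system stays orthonormal over the real scalars, so
    Bessel's inequality can be proved with real coefficients. *)
Definition rpair (x y : nat -> C) : R :=
  Series (fun n => Re (x n) * Re (y n) + Im (x n) * Im (y n)).

Lemma ex_rpair (x y : nat -> C) : ell2 x -> ell2 y ->
  ex_series (fun n => Re (x n) * Re (y n) + Im (x n) * Im (y n)).
Proof.
  intros Hx Hy. apply ell2_l2 in Hx. apply ell2_l2 in Hy.
  apply ex_series_plus_R; now apply l2_mult_ex_series.
Qed.

Lemma rpair_sym (x y : nat -> C) : rpair x y = rpair y x.
Proof. apply Series_ext. intros n; req; ring. Qed.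

Definition Caxpy (c : R) (x y : nat -> C) (n : nat) : C :=
  (c * Re (x n) + Re (y n), c * Im (x n) + Im (y n)).

Lemma ell2_axpy (c : R) (x y : nat -> C) : ell2 x -> ell2 y -> ell2 (Caxpy c x y).
Proof.
  intros Hx Hy. apply ell2_l2 in Hx. apply ell2_l2 in Hy. apply ell2_l2.
  split; apply l2_lin; easy.
Qed.

Lemma rpair_axpy (c : R) (x y z : nat -> C) : ell2 x -> ell2 y -> ell2 z ->
  rpair z (Caxpy c x y) = c * rpair z x + rpair z y.
Proof.
  intros Hx Hy Hz. unfold rpair.
  rewrite <- Series_scal_l, <- Series_plus; [|apply ex_series_scal_R|]; try now apply ex_rpair.
  apply Series_ext. intros n. simpl. req; ring.
Qed.

(** The projections onto e_0, ..., e_N are subtracted one at a time. Each step lowers [rpair r r] by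
    the square of one coefficient and leaves the later coefficients unchanged; the last remainder
    still has a nonnegative square. *)
Lemma bessel (e : nat -> nat -> C) (p : nat -> C) :
  (forall i, ell2 (e i)) ->
  (forall i j, rpair (e i) (e j) = if Nat.eqb i j then 1 else 0) -> ell2 p ->
  forall N, sum_n (fun i => rpair (e i) p ^ 2) N <= rpair p p.
Proof.
  intros He Ho Hp N.
  assert (H : exists r, ell2 r /\
    rpair r r = rpair p p - sum_n (fun i => rpair (e i) p ^ 2) N /\
    forall j, (N < j)%nat -> rpair (e j) r = rpair (e j) p).
  { assert (Step : forall i r s, ell2 r -> rpair r r = rpair p p - s ->
      (forall j, (i <= j)%nat -> rpair (e j) r = rpair (e j) p) ->
      exists r', ell2 r' /\ rpair r' r' = rpair p p - (s + rpair (e i) p ^ 2) /\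
      forall j, (i < j)%nat -> rpair (e j) r' = rpair (e j) p).
    { intros i r s Hr Hrr Hrj. set (c := rpair (e i) p).
      assert (Hr' := ell2_axpy (- c) (e i) r (He i) Hr).
      exists (Caxpy (- c) (e i) r). split; [easy|]. split.
      - rewrite rpair_axpy by easy. rewrite (rpair_sym _ (e i)), (rpair_sym _ r).
        rewrite !rpair_axpy by easy. rewrite (rpair_sym r (e i)), Ho, Nat.eqb_refl.
        rewrite Hrj by lia. fold c. rewrite Hrr. ring.
      - intros j Hj. rewrite rpair_axpy by easy. rewrite Ho.
        rewrite (proj2 (Nat.eqb_neq _ _)) by lia. rewrite Hrj by lia. ring. }
    induction N as [|N [r [Hr [Hrr Hrj]]]].
    - destruct (Step O p 0 Hp) as [r' H]; [ring|easy|].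
      exists r'. rewrite sum_O. rewrite Rplus_0_l in H. easy.
    - destruct (Step (S N) r _ Hr Hrr) as [r' H]; [intros; apply Hrj; lia|].
      exists r'. rewrite sum_Sn. easy. }
  destruct H as [r [Hr [Hrr _]]].
  assert (0 <= rpair r r); [|lra].
  apply Series_nonneg; [|now apply ex_rpair]. intros n. nra.
Qed.

(** * Weighted Hankel operators *)

Section Hankel.

Variables (al : R) (d : nat -> R) (rho Md : R).
Hypothesis al01 : 0 <= al <= 1.
Hypothesis rho1 : 1 < rho.
Hypothesis d_bound : forall n, Rabs (d n) * rho ^ n <= Md.

Definition weight (s : R) : R := 1 - al * s.

Definition hankel_mx (m n : nat) : R :=
  d m * d n * RInt (fun s => s ^ (m + n) * weight s) 0 1.

Definition hankel_op (v : nat -> R) (m : nat) : R := Series (fun n => hankel_mx m n * v n).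

(** With A v = [gen_fun v] seen in L^2([0, 1], weight ds), the matrix is A^T A. Symmetry, positivity
    and the trace bound all come from this factorization. *)
Definition gen_fun (v : nat -> R) (s : R) : R := Series (fun n => d n * v n * s ^ n).

Lemma weight_continuous s : continuous weight s.
Proof. unfold weight. cont. Qed.

Lemma weight_01 s : 0 <= s <= 1 -> 0 <= weight s <= 1.
Proof. intros; unfold weight; nra. Qed.

Lemma d_l2 : l2 d.
Proof.
  clear al01. (* otherwise [lra] makes the lemma depend on it *)
  apply ex_series_abs_le with (fun n => Md ^ 2 * (/ rho ^ 2) ^ n).
  - intros n. rewrite pow_inv, <- pow_mult, Nat.mul_comm, pow_mult.
    assert (Hp : 0 < rho ^ n) by (apply pow_lt; lra).
    rewrite <- Rsqr_pow2, Rabs_pos_eq by apply Rle_0_sqr. rewrite Rsqr_abs.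
    specialize (d_bound n). assert (H0 := Rabs_pos (d n)).
    apply (Rle_div_r _ (Md ^ 2)); [now apply pow_lt|]. unfold Rsqr.
    assert (0 <= Rabs (d n) * rho ^ n) by (apply Rmult_le_pos; lra).
    replace (Rabs (d n) * Rabs (d n) * (rho ^ n) ^ 2) with ((Rabs (d n) * rho ^ n) ^ 2) by ring.
    apply pow_incr; easy.
  - apply ex_series_scal_R. apply ex_series_geom.
    rewrite Rabs_pos_eq; [|left; apply Rinv_0_lt_compat; nra].
    rewrite <- Rinv_1. apply Rinv_lt_contravar; nra.
Qed.

Lemma gen_fun_abs v : l2 v -> ex_series (fun n => Rabs (d n * v n)).
Proof. apply l2_mult_abs, d_l2. Qed.

Lemma gen_fun_term_le v n s : 0 <= s <= 1 -> Rabs (d n * v n * s ^ n) <= Rabs (d n * v n).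
Proof.
  intros Hs. rewrite Rabs_mult, (Rabs_pos_eq (s ^ n)) by (apply pow_le; lra).
  rewrite <- (Rmult_1_r (Rabs (d n * v n))) at 2. apply Rmult_le_compat_l; [apply Rabs_pos|].
  rewrite <- (pow1 n). apply pow_incr; easy.
Qed.

(** The decay of d_n like rho^(-n) with rho > 1 puts the whole interval, endpoint 1 included,
    strictly inside the disc of convergence. *)
Lemma gen_fun_continuous v s : l2 v -> 0 <= s <= 1 -> continuous (gen_fun v) s.
Proof.
  intros Hv Hs.
  apply (continuous_ext (PSeries (fun n => d n * v n))); [easy|].
  apply continuity_pt_filterlim, PSeries_continuity.
  apply Rbar_lt_le_trans with rho.
  - simpl. rewrite Rabs_pos_eq; lra.
  - apply (proj1 (CV_radius_bounded (fun n => d n * v n))).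
    destruct (l2_bounded v Hv) as [M HM]. exists (Md * M). intros n.
    replace (d n * v n * rho ^ n) with (d n * rho ^ n * v n) by ring.
    rewrite Rabs_mult. apply Rmult_le_compat; try apply Rabs_pos; [|apply HM].
    rewrite Rabs_mult, (Rabs_pos_eq (rho ^ n)); [apply d_bound|apply pow_le; lra].
Qed.

(** Sum and integral are exchanged by the M-test, with majorant |d_n a_n| times a bound of |g|. *)
Lemma gen_fun_moments g a : (forall s, 0 <= s <= 1 -> continuous g s) -> l2 a ->
  is_series (fun n => d n * a n * RInt (fun s => s ^ n * g s) 0 1)
    (RInt (fun s => gen_fun a s * g s) 0 1).
Proof.
  intros Hg Ha.
  destruct (continuous_bounded g 0 1 Rle_0_1 Hg) as [M HM].
  assert (E : ex_series (fun n => Rabs (d n * a n) * M)).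
  { apply (ex_series_scal_r M). now apply gen_fun_abs. }
  assert (Hc : forall n s, 0 <= s <= 1 -> continuous (fun s => d n * a n * s ^ n * g s) s).
  { intros n s Hs. specialize (Hg s Hs). cont. }
  assert (Hle : forall n s, 0 <= s <= 1 -> Rabs (d n * a n * s ^ n * g s) <= Rabs (d n * a n) * M).
  { intros n s Hs. rewrite Rabs_mult. apply Rmult_le_compat; try apply Rabs_pos; [|auto].
    now apply gen_fun_term_le. }
  assert (H := RInt_series (fun n s => d n * a n * s ^ n * g s) (fun n => Rabs (d n * a n) * M) 0 1
    Rle_0_1 Hc Hle E).
  assert (Ei : forall n, RInt (fun s => d n * a n * s ^ n * g s) 0 1 =
     d n * a n * RInt (fun s => s ^ n * g s) 0 1).
  { intros n. rewrite <- RInt_scal_cont; [|lra|].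
    - apply RInt_ext_le; [lra|]. intros; req; ring.
    - intros s Hs. specialize (Hg s Hs). cont. }
  replace (RInt (fun s => gen_fun a s * g s) 0 1) with
    (Series (fun n => d n * a n * RInt (fun s => s ^ n * g s) 0 1)).
  - apply Series_correct. apply ex_series_abs_le with (fun n => Rabs (d n * a n) * M); [|easy].
    intros n. rewrite <- Ei.
    replace (Rabs (d n * a n) * M) with ((1 - 0) * (Rabs (d n * a n) * M)) by ring.
    apply abs_RInt_le_const; [lra| |auto].
    apply ex_RInt_cont; [lra|auto].
  - symmetry.
    rewrite (RInt_ext_le _ (fun s => Series (fun n => d n * a n * s ^ n * g s))); [|lra|].
    + rewrite <- (Series_ext _ _ Ei). now apply is_RInt_unique.
    + intros s Hs. unfold gen_fun. now rewrite <- Series_scal_r.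
Qed.

Lemma hankel_op_is_series v m : l2 v ->
  is_series (fun n => hankel_mx m n * v n) (d m * RInt (fun s => gen_fun v s * (s ^ m * weight s))
    0 1).
Proof.
  intros Hv.
  apply (is_series_ext (fun n => d m * (d n * v n * RInt (fun s => s ^ n * (s ^ m * weight s)) 0
    1))).
  - intros n. unfold hankel_mx.
    rewrite (RInt_ext_le (fun s => s ^ n * (s ^ m * weight s)) (fun s => s ^ (m + n) * weight s));
      [req; ring|lra|].
    intros s _. rewrite pow_add; req; ring.
  - apply (is_series_scal (V := R_NormedModule)). apply gen_fun_moments; [|easy].
    intros s _. apply cont_mult; [cont|apply weight_continuous].
Qed.

Lemma hankel_op_gen v m : l2 v ->
  hankel_op v m = d m * RInt (fun s => s ^ m * (weight s * gen_fun v s)) 0 1.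
Proof.
  intros Hv. unfold hankel_op. rewrite (is_series_unique _ _ (hankel_op_is_series v m Hv)).
  f_equal. apply RInt_ext_le; [lra|]. intros; req; ring.
Qed.

(** A second exchange of sum and integral, now with g = weight * [gen_fun b]. The result is
    symmetric in a and b. *)
Lemma hankel_op_pairing a b : l2 a -> l2 b ->
  is_series (fun m => a m * hankel_op b m) (RInt (fun s => weight s * (gen_fun a s * gen_fun b s))
    0 1).
Proof.
  intros Ha Hb.
  apply (is_series_ext (fun m => d m * a m * RInt (fun s => s ^ m * (weight s * gen_fun b s)) 0 1)).
  - intros m. rewrite hankel_op_gen by easy. req; ring.
  - replace (RInt _ 0 1) with (RInt (fun s => gen_fun a s * (weight s * gen_fun b s)) 0 1).
    + apply gen_fun_moments; [|easy]. intros s Hs.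
      apply cont_mult; [apply weight_continuous|now apply gen_fun_continuous].
    + apply RInt_ext_le; [lra|]. intros; req; ring.
Qed.

Lemma hankel_op_sym a b : l2 a -> l2 b ->
  Series (fun m => a m * hankel_op b m) = Series (fun m => b m * hankel_op a m).
Proof.
  intros Ha Hb.
  rewrite (is_series_unique _ _ (hankel_op_pairing a b Ha Hb)),
    (is_series_unique _ _ (hankel_op_pairing b a Hb Ha)).
  apply RInt_ext_le; [lra|]. intros; req; ring.
Qed.

Lemma hankel_mx_bound m n : Rabs (hankel_mx m n) <= Rabs (d m) * Rabs (d n).
Proof.
  unfold hankel_mx. rewrite !Rabs_mult.
  rewrite <- (Rmult_1_r (Rabs (d m) * Rabs (d n))) at 2.
  apply Rmult_le_compat_l; [apply Rmult_le_pos; apply Rabs_pos|].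
  replace 1 with ((1 - 0) * 1) at 2 by ring. apply abs_RInt_le_const; [lra| |].
  - apply ex_RInt_cont; [lra|]. intros; apply cont_mult; [cont|apply weight_continuous].
  - intros s Hs. assert (Hw := weight_01 s Hs).
    assert (0 <= s ^ (m + n) <= 1).
    { split; [apply pow_le; lra|]. rewrite <- (pow1 (m + n)). apply pow_incr; lra. }
    rewrite Rabs_pos_eq; nra.
Qed.

(** The entries are at most |d_m d_n| in absolute value; the rest is Cauchy-Schwarz. Summed over m,
    this bounds the operator norm by the sum of the d_n^2. *)
Lemma hankel_op_bound v m : l2 v ->
  hankel_op v m ^ 2 <= d m ^ 2 * (Series (fun n => d n ^ 2) * Series (fun n => v n ^ 2)).
Proof.
  intros Hv.
  assert (E : ex_series (fun n => Rabs (d n) * Rabs (v n))).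
  { apply (ex_series_ext (fun n => Rabs (d n * v n))); [intros; apply Rabs_mult|].
    now apply gen_fun_abs. }
  assert (H1 : Rabs (hankel_op v m) <= Rabs (d m) * Series (fun n => Rabs (d n) * Rabs (v n))).
  { unfold hankel_op. rewrite <- Series_scal_l.
    assert (Hle : forall n, Rabs (hankel_mx m n * v n) <= Rabs (d m) * (Rabs (d n) * Rabs (v n))).
    { intros n. rewrite Rabs_mult, <- Rmult_assoc.
      apply Rmult_le_compat_r; [apply Rabs_pos|apply hankel_mx_bound]. }
    assert (E' := ex_series_scal_R (Rabs (d m)) _ E).
    eapply Rle_trans; [apply Series_Rabs|].
    - apply ex_series_abs_le with (2 := E'). intros n. now rewrite Rabs_Rabsolu.
    - apply Series_le; [|easy]. intros n. split; [apply Rabs_pos|apply Hle]. }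
  assert (H2 := Series_cauchy_schwarz _ _ (l2_abs d d_l2) (l2_abs v Hv)).
  cbv beta in H2.
  rewrite (Series_ext (fun n => Rabs (d n) ^ 2) (fun n => d n ^ 2)) in H2
    by (intros n; now rewrite <- !Rsqr_pow2, <- Rsqr_abs).
  rewrite (Series_ext (fun n => Rabs (v n) ^ 2) (fun n => v n ^ 2)) in H2
    by (intros n; now rewrite <- !Rsqr_pow2, <- Rsqr_abs).
  rewrite <- (Rsqr_pow2 (hankel_op v m)), Rsqr_abs, Rsqr_pow2.
  apply Rle_trans with ((Rabs (d m) * Series (fun n => Rabs (d n) * Rabs (v n))) ^ 2).
  - apply pow_incr. split; [apply Rabs_pos|easy].
  - rewrite Rpow_mult_distr, <- (Rsqr_pow2 (Rabs (d m))), <- Rsqr_abs, Rsqr_pow2.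
    apply Rmult_le_compat_l; [apply pow2_ge_0|exact H2].
Qed.

Lemma hankel_op_l2 v : l2 v -> l2 (hankel_op v).
Proof.
  intros Hv. apply ex_series_abs_le with
    (fun m => d m ^ 2 * (Series (fun n => d n ^ 2) * Series (fun n => v n ^ 2))).
  - intros m. rewrite Rabs_pos_eq by apply pow2_ge_0. apply hankel_op_bound, Hv.
  - apply (ex_series_scal_r (Series (fun n => d n ^ 2) * Series (fun n => v n ^ 2))), d_l2.
Qed.

Lemma hankel_op_lin c a b m : l2 a -> l2 b ->
  hankel_op (fun n => c * a n + b n) m = c * hankel_op a m + hankel_op b m.
Proof.
  intros Ha Hb. unfold hankel_op.
  assert (Ea := ex_intro _ _ (hankel_op_is_series a m Ha) : ex_series (fun n => hankel_mx m n * a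
    n)).
  assert (Eb := ex_intro _ _ (hankel_op_is_series b m Hb) : ex_series (fun n => hankel_mx m n * b
    n)).
  rewrite <- Series_scal_l, <- Series_plus; [|now apply ex_series_scal_R|easy].
  apply Series_ext. intros n; ring.
Qed.

(** * The operator on complex sequences: boundedness, positivity, trace, spectrum *)

Definition Chankel_op (v : nat -> C) (m : nat) : C :=
  (hankel_op (fun n => Re (v n)) m, hankel_op (fun n => Im (v n)) m).

Lemma hankel_op_ext a b m : (forall n, a n = b n) -> hankel_op a m = hankel_op b m.
Proof. intros H. apply Series_ext. intros n. now rewrite H. Qed.

Lemma hankel_op_zero v m : (forall n, v n = 0) -> hankel_op v m = 0.
Proof.
  intros H. transitivity (0 * Series (hankel_mx m)); [|ring].
  rewrite <- Series_scal_l. apply Series_ext. intros n. rewrite H. req; ring.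
Qed.

Lemma Chankel_op_bounded : bounded_operator Chankel_op.
Proof.
  assert (HD : 0 <= Series (fun n => d n ^ 2)).
  { apply Series_nonneg; [intros; apply pow2_ge_0|apply d_l2]. }
  split; [|split].
  - intros x Hx. apply ell2_l2 in Hx. apply ell2_l2. split; apply hankel_op_l2, Hx.
  - intros a x y Hx Hy n. apply ell2_l2 in Hx. apply ell2_l2 in Hy.
    destruct Hx as [Hx1 Hx2]. destruct Hy as [Hy1 Hy2].
    unfold Chankel_op.
    rewrite (hankel_op_ext _ (fun j => Re a * Re (x j) + (- Im a * Im (x j) + Re (y j)))).
    2:{ intros j. unfold Re, Im; simpl; ring. }
    rewrite (hankel_op_ext (fun j => Im (a * x j + y j)%C)
      (fun j => Re a * Im (x j) + (Im a * Re (x j) + Im (y j)))).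
    2:{ intros j. unfold Re, Im; simpl; ring. }
    rewrite !hankel_op_lin by (try apply l2_lin; easy).
    apply injective_projections; simpl; unfold Re, Im; ring.
  - set (D := Series (fun n => d n ^ 2)) in *. exists D. intros x Hx.
    assert (Hx' := proj1 (ell2_l2 x) Hx). destruct Hx' as [H1 H2].
    unfold ell2_norm. rewrite <- (sqrt_pow2 D) by easy.
    rewrite <- sqrt_mult; [|apply pow2_ge_0|apply Series_nonneg; [intros; apply pow2_ge_0|easy]].
    apply sqrt_le_1_alt.
    rewrite (Series_ext (fun n => Cmod (x n) ^ 2) (fun n => Re (x n) ^ 2 + Im (x n) ^ 2))
      by (intros; apply Cmod_sqr).
    rewrite Series_plus by easy.
    replace (D ^ 2 * _) with (D * (D * (Series (fun n => Re (x n) ^ 2) +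
      Series (fun n => Im (x n) ^ 2)))) by ring.
    rewrite <- (Series_scal_r (D * _) (fun n => d n ^ 2)).
    apply Series_le; [|apply ex_series_scal_r, d_l2].
    intros m. split; [apply pow2_ge_0|]. rewrite Cmod_sqr. simpl Re; simpl Im.
    assert (B1 := hankel_op_bound _ m H1). assert (B2 := hankel_op_bound _ m H2).
    fold D in B1, B2. cbv beta in B1, B2. lra.
Qed.

Lemma Chankel_op_represents (H : nat -> nat -> R) :
  (forall m n, H m n = hankel_mx m n) -> represents H Chankel_op.
Proof.
  intros HH. split; [apply Chankel_op_bounded|]. intros m n.
  assert (Hb : forall i j, Re (std_basis i j) = (if Nat.eqb i j then 1 else 0) /\
     Im (std_basis i j) = 0).
  { intros i j. unfold std_basis. destruct (Nat.eqb i j); simpl; auto. }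
  assert (E1 : forall j, hankel_op (fun i => Re (std_basis n i)) j = hankel_mx j n).
  { intros j. unfold hankel_op. rewrite <- (Series_single n (fun i => hankel_mx j i)).
    apply Series_ext. intros i. rewrite (proj1 (Hb n i)). destruct (Nat.eqb n i); req; ring. }
  assert (E2 : forall j, hankel_op (fun i => Im (std_basis n i)) j = 0).
  { intros j. apply hankel_op_zero. intros i. apply Hb. }
  rewrite inner_eq. apply injective_projections; simpl fst; simpl snd.
  - rewrite HH, <- (Series_single m (fun i => hankel_mx i n)). apply Series_ext.
    intros j. rewrite (proj1 (Hb m j)), (proj2 (Hb m j)). simpl Re. rewrite E1.
    destruct (Nat.eqb m j); req; ring.
  - rewrite <- (Rmult_0_l (Series (fun _ => 0))), <- Series_scal_l.
    apply Series_ext. intros j. rewrite (proj2 (Hb m j)). simpl Im. rewrite E2. req; ring.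
Qed.

Lemma Chankel_op_form x : ell2 x -> Re (inner x (Chankel_op x)) =
  RInt (fun s => weight s * (gen_fun (fun n => Re (x n)) s ^ 2 + gen_fun (fun n => Im (x n)) s ^
    2)) 0 1.
Proof.
  intros Hx. apply ell2_l2 in Hx. destruct Hx as [H1 H2].
  assert (P1 := hankel_op_pairing _ _ H1 H1). assert (P2 := hankel_op_pairing _ _ H2 H2).
  rewrite inner_eq. simpl Re.
  rewrite Series_plus; [|now exists (RInt (fun s => weight s * (gen_fun (fun n => Re (x n)) s *
    gen_fun (fun n => Re (x n)) s)) 0 1)|now exists (RInt (fun s => weight s * (gen_fun (fun n =>
      Im (x n)) s *
    gen_fun (fun n => Im (x n)) s)) 0 1)].
  rewrite (is_series_unique _ _ P1), (is_series_unique _ _ P2).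
  rewrite <- RInt_plus_cont; [apply RInt_ext_le; [lra|intros; req; ring]|lra| |];
    intros s Hs; apply cont_mult; try apply weight_continuous;
    apply cont_mult; now apply gen_fun_continuous.
Qed.

Lemma Chankel_op_adjoint x y : ell2 x -> ell2 y -> inner (Chankel_op x) y = inner x (Chankel_op y).
Proof.
  intros Hx Hy. apply ell2_l2 in Hx. apply ell2_l2 in Hy.
  destruct Hx as [Hx1 Hx2]. destruct Hy as [Hy1 Hy2].
  assert (S : forall a b, l2 a -> l2 b -> Series (fun n => hankel_op a n * b n) =
    Series (fun n => a n * hankel_op b n)).
  { intros a b Ha Hb. rewrite (hankel_op_sym a b) by easy. apply Series_ext. intros; req; ring. }
  rewrite !inner_eq. simpl Re; simpl Im.
  f_equal.
  - rewrite !Series_plus by (apply l2_mult_ex_series; try apply hankel_op_l2; easy).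
    rewrite !S by easy. easy.
  - rewrite !Series_minus by (apply l2_mult_ex_series; try apply hankel_op_l2; easy).
    rewrite !S by easy. easy.
Qed.

Lemma Chankel_op_positive : positive_operator Chankel_op.
Proof.
  split; [apply Chankel_op_bounded|]. intros x Hx. split.
  - apply ell2_l2 in Hx. destruct Hx as [H1 H2].
    rewrite inner_eq. simpl Im.
    rewrite Series_minus by (apply l2_mult_ex_series; try apply hankel_op_l2; easy).
    rewrite (hankel_op_sym (fun n => Im (x n)) (fun n => Re (x n))) by easy. apply Rminus_eq_0.
  - rewrite Chankel_op_form by easy. apply ell2_l2 in Hx. destruct Hx as [H1 H2].
    apply RInt_ge_0; [lra| |].
    + apply ex_RInt_cont; [lra|]. intros s Hs.
      apply cont_mult; [apply weight_continuous|].
      apply cont_plus; apply cont_pow; now apply gen_fun_continuous.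
    + intros s Hs. apply Rmult_le_pos; [apply weight_01; lra|].
      apply Rplus_le_le_0_compat; apply pow2_ge_0.
Qed.

(* Bessel's inequality for the vectors (d_n s^n) at each fixed s, integrated
   against the weight. *)
Lemma Chankel_op_trace_class : trace_class Chankel_op.
Proof.
  (* A positive self-adjoint operator is its own absolute value and its own adjoint. *)
  split; [apply Chankel_op_bounded|]. exists Chankel_op. split.
  { split; [apply Chankel_op_positive|]. exists Chankel_op. split; [|easy].
    split; [apply Chankel_op_bounded|apply Chankel_op_adjoint]. }
  intros e [He1 [He2 _]].
  set (D := Series (fun n => d n ^ 2)).
  assert (Hc : forall i s, 0 <= s <= 1 -> continuous (fun s => weight s *
    (gen_fun (fun n => Re (e i n)) s ^ 2 + gen_fun (fun n => Im (e i n)) s ^ 2)) s).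
  { intros i s Hs. assert (H := proj1 (ell2_l2 _) (He1 i)). destruct H as [H1 H2].
    apply cont_mult; [apply weight_continuous|].
    apply cont_plus; apply cont_pow; now apply gen_fun_continuous. }
  assert (Hcs : forall N s, 0 <= s <= 1 -> continuous (fun s => sum_n (fun i => weight s *
    (gen_fun (fun n => Re (e i n)) s ^ 2 + gen_fun (fun n => Im (e i n)) s ^ 2)) N) s).
  { induction N as [|N IH]; intros s Hs.
    - apply (continuous_ext (fun s => weight s *
        (gen_fun (fun n => Re (e 0%nat n)) s ^ 2 + gen_fun (fun n => Im (e 0%nat n)) s ^ 2)));
        [intros t; symmetry; apply sum_O|now apply Hc].
    - apply (continuous_ext (fun s => sum_n (fun i => weight s *
        (gen_fun (fun n => Re (e i n)) s ^ 2 + gen_fun (fun n => Im (e i n)) s ^ 2)) N + weight s *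
        (gen_fun (fun n => Re (e (S N) n)) s ^ 2 + gen_fun (fun n => Im (e (S N) n)) s ^ 2)));
        [intros t; rewrite sum_Sn; reflexivity|].
      apply cont_plus; [now apply IH|now apply Hc]. }
  assert (Hsum : forall N, sum_n (fun i => Re (inner (e i) (Chankel_op (e i)))) N =
    RInt (fun s => sum_n (fun i => weight s *
    (gen_fun (fun n => Re (e i n)) s ^ 2 + gen_fun (fun n => Im (e i n)) s ^ 2)) N) 0 1).
  { induction N as [|N IH].
    - rewrite sum_O, Chankel_op_form by easy. apply RInt_ext_le; [lra|]. intros s _.
      now rewrite sum_O.
    - rewrite sum_Sn, IH, Chankel_op_form by easy. unfold plus; simpl.
      rewrite <- RInt_plus_cont; [|lra|apply Hcs|apply Hc].
      apply RInt_ext_le; [lra|]. intros s _. now rewrite sum_Sn. }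
  (* The factor 2 arises because the real and the imaginary parts of the e_i each contribute a
     Bessel sum of at most D. *)
  apply ex_series_nonneg_bounded with (2 * D).
  { intros n. now apply Chankel_op_positive. }
  intros N. rewrite Hsum.
  eapply Rle_trans; [apply Rle_abs|].
  replace (2 * D) with ((1 - 0) * (2 * D)) by ring.
  apply abs_RInt_le_const; [lra|apply ex_RInt_cont; [lra|apply Hcs]|].
  intros s Hs.
  set (ds := fun n => d n * s ^ n).
  assert (Hds : forall n, 0 <= ds n ^ 2 <= d n ^ 2).
  { intros n. split; [apply pow2_ge_0|]. unfold ds. rewrite Rpow_mult_distr.
    rewrite <- (Rmult_1_r (d n ^ 2)) at 2. apply Rmult_le_compat_l; [apply pow2_ge_0|].
    assert (0 <= s ^ n <= 1); [|nra].
    split; [apply pow_le; lra|]. rewrite <- (pow1 n). apply pow_incr; lra. }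
  assert (Hdl : l2 ds).
  { apply ex_series_abs_le with (2 := d_l2). intros n.
    rewrite Rabs_pos_eq; apply Hds. }
  assert (HdD : Series (fun n => ds n ^ 2) <= D) by (apply Series_le; [apply Hds|apply d_l2]).
  assert (l20 : l2 (fun _ => 0)).
  { apply ex_series_abs_le with (2 := d_l2). intros n. rewrite Rabs_pos_eq by lra.
    replace (0 ^ 2) with 0 by ring. apply pow2_ge_0. }
  (* The real pairings of e_i with ds and with i ds are the generating functions of its real and
     imaginary parts at s. *)
  set (p1 := fun n => (ds n, 0) : C). set (p2 := fun n => (0, ds n) : C).
  assert (Hp1 : ell2 p1) by (apply ell2_l2; easy).
  assert (Hp2 : ell2 p2) by (apply ell2_l2; easy).
  assert (Hon : forall i j, rpair (e i) (e j) = if Nat.eqb i j then 1 else 0).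
  { intros i j. specialize (He2 i j). rewrite inner_eq in He2.
    apply (f_equal Re) in He2. unfold rpair. etransitivity; [exact He2|].
    now destruct (Nat.eqb i j). }
  assert (B1 := bessel e p1 He1 Hon Hp1 N). assert (B2 := bessel e p2 He1 Hon Hp2 N).
  assert (E1 : rpair p1 p1 <= D).
  { unfold rpair, p1. simpl Re; simpl Im.
    rewrite (Series_ext _ (fun n => ds n ^ 2)); [easy|intros; req; ring]. }
  assert (E2 : rpair p2 p2 <= D).
  { unfold rpair, p2. simpl Re; simpl Im.
    rewrite (Series_ext _ (fun n => ds n ^ 2)); [easy|intros; req; ring]. }
  assert (G1 : forall i, gen_fun (fun n => Re (e i n)) s = rpair (e i) p1).
  { intros i. apply Series_ext. intros n. unfold p1, ds. simpl Re; simpl Im. req; ring. }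
  assert (G2 : forall i, gen_fun (fun n => Im (e i n)) s = rpair (e i) p2).
  { intros i. apply Series_ext. intros n. unfold p2, ds. simpl Re; simpl Im. req; ring. }
  assert (Hw := weight_01 s Hs).
  rewrite (sum_n_ext _ (fun i => mult (weight s) (plus (rpair (e i) p1 ^ 2) (rpair (e i) p2 ^ 2)))).
  2:{ intros i. now rewrite G1, G2. }
  rewrite sum_n_mult_l, sum_n_plus.
  set (S1 := sum_n (fun i => rpair (e i) p1 ^ 2) N) in *.
  set (S2 := sum_n (fun i => rpair (e i) p2 ^ 2) N) in *.
  change (Rabs (weight s * (S1 + S2)) <= 2 * D).
  assert (HS1 : 0 <= S1) by
    (unfold S1; rewrite sum_n_Reals; apply cond_pos_sum; intros; apply pow2_ge_0).
  assert (HS2 : 0 <= S2) by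
    (unfold S2; rewrite sum_n_Reals; apply cond_pos_sum; intros; apply pow2_ge_0).
  clearbody S1 S2.
  rewrite Rabs_pos_eq; [|apply Rmult_le_pos; lra].
  rewrite <- (Rmult_1_l (2 * D)). apply Rmult_le_compat; lra.
Qed.

(** Symmetry gives (l - nu) <p, v> = 0. As l is a priori complex, this is split into real and
    imaginary parts and recombined as |l - nu|^2 |<p, v>|^2 = 0. *)
Lemma eigenvector_pairing (p : nat -> R) (nu : R) (l : C) (v : nat -> C) :
  l2 p -> (forall n, hankel_op p n = nu * p n) -> is_eigenvector Chankel_op l v ->
  l = RtoC nu \/
  (Series (fun n => p n * Re (v n)) = 0 /\ Series (fun n => p n * Im (v n)) = 0).
Proof.
  intros Hp Hnu [Hv [_ Hl]]. apply ell2_l2 in Hv. destruct Hv as [H1 H2].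
  assert (S : forall a, l2 a -> Series (fun n => p n * hankel_op a n) = nu * Series (fun n => p n
    * a n)).
  { intros a Ha. rewrite hankel_op_sym by easy. rewrite <- Series_scal_l. apply Series_ext.
    intros n. rewrite Hnu. req; ring. }
  set (x := Series (fun n => p n * Re (v n))). set (y := Series (fun n => p n * Im (v n))).
  assert (Ex : nu * x = Re l * x - Im l * y).
  { unfold x, y. rewrite <- (S (fun n => Re (v n)) H1), <- !Series_scal_l.
    rewrite <- Series_minus by (apply ex_series_scal_R; now apply l2_mult_ex_series).
    apply Series_ext. intros n. specialize (Hl n). apply (f_equal Re) in Hl.
    unfold Chankel_op in Hl. simpl in Hl. rewrite Hl. unfold Re, Im. req; ring. }
  assert (Ey : nu * y = Re l * y + Im l * x).
  { unfold x, y. rewrite <- (S (fun n => Im (v n)) H2), <- !Series_scal_l.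
    rewrite <- Series_plus by (apply ex_series_scal_R; now apply l2_mult_ex_series).
    apply Series_ext. intros n. specialize (Hl n). apply (f_equal Im) in Hl.
    unfold Chankel_op in Hl. simpl in Hl. rewrite Hl. unfold Re, Im. req; ring. }
  assert (E : ((Re l - nu) ^ 2 + Im l ^ 2) * (x ^ 2 + y ^ 2) = 0).
  { transitivity (((Re l - nu) * x - Im l * y) ^ 2 + ((Re l - nu) * y + Im l * x) ^ 2); [ring|].
    replace ((Re l - nu) * x - Im l * y) with 0 by lra.
    replace ((Re l - nu) * y + Im l * x) with 0 by lra. ring. }
  apply Rmult_integral in E. destruct E as [E|E].
  - left. assert (Re l = nu) by nra. assert (Im l = 0) by nra.
    apply injective_projections; easy.
  - right. split; nra.
Qed.

(** An eigenvector with any other eigenvalue is orthogonal to every p_m and so vanishes by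
    completeness. Strict decrease makes the nu_m distinct, hence the p_m orthogonal. The value 1 at
    index 0 keeps p_m nonzero. *)
Lemma spectral_decomposition (p : nat -> nat -> R) (nu : nat -> R) :
  (forall m, l2 (p m)) -> (forall m n, hankel_op (p m) n = nu m * p m n) ->
  (forall m, p m O = 1) -> (forall m, nu (S m) < nu m) ->
  (forall v, l2 v -> (forall m, Series (fun n => p m n * v n) = 0) -> forall n, v n = 0) ->
  (forall l, is_eigenvalue Chankel_op l -> is_simple_eigenvalue Chankel_op l) /\
  (forall l, is_eigenvalue Chankel_op l <-> exists m, l = RtoC (nu m)) /\
  (forall m, is_eigenvector Chankel_op (RtoC (nu m)) (fun n => RtoC (p m n))).
Proof.
  intros Hl2 Hnu Hp0 Hdec Hcomp.
  assert (Hinj : forall i j, nu i = nu j -> i = j).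
  { assert (Hlt : forall i j, (i < j)%nat -> nu j < nu i).
    { intros i j Hij. induction Hij; [apply Hdec|]. specialize (Hdec m). lra. }
    intros i j Hij. destruct (Nat.lt_trichotomy i j) as [H|[H|H]]; [|easy|];
      apply Hlt in H; lra. }
  assert (Hev : forall m, is_eigenvector Chankel_op (RtoC (nu m)) (fun n => RtoC (p m n))).
  { intros m. split; [|split].
    - apply ell2_l2. split; [apply Hl2|].
      apply (ex_series_ext (fun n => 0 * p m n ^ 2)); [intros n; simpl; req; ring|].
      apply ex_series_scal_R, Hl2.
    - exists O. rewrite Hp0. intros H. apply RtoC_inj in H. lra.
    - intros n. unfold Chankel_op. apply injective_projections.
      + simpl. rewrite Rmult_0_l, Rminus_0_r. apply Hnu.
      + simpl. rewrite Rmult_0_l, Rmult_0_r, Rplus_0_r.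
        now apply hankel_op_zero. }
  assert (Hval : forall l v, is_eigenvector Chankel_op l v -> exists m, l = RtoC (nu m)).
  { intros l v Hv. apply NNPP. intros Hn.
    assert (H0 : forall m, Series (fun n => p m n * Re (v n)) = 0 /\
      Series (fun n => p m n * Im (v n)) = 0).
    { intros m. destruct (eigenvector_pairing (p m) (nu m) l v) as [H|H]; auto.
      exfalso. apply Hn. now exists m. }
    destruct Hv as [Hv [[n Hvn] _]]. apply ell2_l2 in Hv. destruct Hv as [H1 H2].
    apply Hvn. apply injective_projections.
    - apply (Hcomp _ H1 (fun m => proj1 (H0 m))).
    - apply (Hcomp _ H2 (fun m => proj2 (H0 m))). }
  split; [|split; [|easy]].
  2:{ intros l. split; [intros [v Hv]; eauto|]. intros [m ->]. exists (fun n => RtoC (p m n)).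
    auto. }
  intros l [v0 Hv0]. destruct (Hval l v0 Hv0) as [m ->]. clear v0 Hv0.
  exists (fun n => RtoC (p m n)). split; [auto|]. intros u Hu.
  set (N := Series (fun n => p m n * p m n)).
  assert (HN : 0 < N).
  { apply Rlt_le_trans with (p m O * p m O); [rewrite Hp0; lra|].
    apply (Series_term_le (fun n => p m n * p m n)); [intros n; apply Rle_0_sqr|now apply
      l2_mult_ex_series]. }
  assert (Hu' := Hu). destruct Hu' as [Hul [_ _]]. apply ell2_l2 in Hul.
  (* The remainder of a after projection onto p_m is orthogonal to all p_i, so it is zero. This is
     applied to the real and the imaginary part of u. *)
  assert (K : forall a, l2 a -> (forall i, i <> m -> Series (fun n => p i n * a n) = 0) ->
    forall n, a n = Series (fun n => p m n * a n) / N * p m n).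
  { intros a Ha H0 n. set (c := Series (fun n => p m n * a n) / N).
    assert (H := Hcomp (fun n => - c * p m n + a n) (l2_lin (- c) _ _ (Hl2 m) Ha)).
    enough (- c * p m n + a n = 0) by lra. apply H. clear H n. intros i.
    rewrite (Series_ext _ (fun n => - c * (p i n * p m n) + p i n * a n)) by (intros; req; ring).
    rewrite Series_plus by (try apply ex_series_scal_R; now apply l2_mult_ex_series).
    rewrite Series_scal_l. destruct (Nat.eq_dec i m) as [->|Hi].
    - fold N. unfold c. field. lra.
    - rewrite H0 by easy.
      destruct (eigenvector_pairing (p i) (nu i) _ _ (Hl2 i) (Hnu i) (Hev m)) as [H|[H _]].
      + apply RtoC_inj in H. exfalso. apply Hi. now apply Hinj.
      + simpl in H. rewrite H. ring. }
  assert (P : forall i, i <> m -> Series (fun n => p i n * Re (u n)) = 0 /\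
      Series (fun n => p i n * Im (u n)) = 0).
  { intros i Hi. destruct (eigenvector_pairing (p i) (nu i) _ _ (Hl2 i) (Hnu i) Hu) as [H|H];
    [|easy].
    apply RtoC_inj in H. exfalso. apply Hi. now apply Hinj. }
  assert (K1 := K _ (proj1 Hul) (fun i Hi => proj1 (P i Hi))).
  assert (K2 := K _ (proj2 Hul) (fun i Hi => proj2 (P i Hi))).
  eexists (_, _). intros n. apply injective_projections; simpl.
  - rewrite Rmult_0_r, Rminus_0_r. apply K1.
  - rewrite Rmult_0_r, Rplus_0_l. apply K2.
Qed.

End Hankel.

(** * Elliptic integrals *)

Definition Delta (k th : R) : R := sqrt (1 - k ^ 2 * sin th ^ 2).

(** The incomplete integral of the first kind. The amplitude th is the working variable, with du = d
    th / Delta; sn, cn and dn are then elementary in th. *)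
Definition ellF (k th : R) : R := RInt (fun t => / Delta k t) 0 th.

Lemma ellF_PI2 (k : R) : ellF k (PI / 2) = ellK k.
Proof. easy. Qed.

Lemma Delta_arg_pos (k th : R) : 0 < k < 1 -> 0 < 1 - k ^ 2 * sin th ^ 2.
Proof.
  intros Hk. assert (H := SIN_bound th). assert (sin th ^ 2 <= 1) by nra.
  assert (0 <= sin th ^ 2) by apply pow2_ge_0. nra.
Qed.

Lemma Delta_pos (k th : R) : 0 < k < 1 -> 0 < Delta k th.
Proof. intros Hk. apply sqrt_lt_R0. now apply Delta_arg_pos. Qed.

Lemma Delta_sqr (k th : R) : 0 < k < 1 -> Delta k th ^ 2 = 1 - k ^ 2 * sin th ^ 2.
Proof. intros Hk. apply pow2_sqrt. left. now apply Delta_arg_pos. Qed.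

Lemma Delta_derive (k th : R) : 0 < k < 1 ->
  is_derive (Delta k) th (- k ^ 2 * sin th * cos th / Delta k th).
Proof.
  intros Hk. assert (H := Delta_arg_pos k th Hk). assert (H0 := Delta_pos k th Hk).
  unfold Delta in *. auto_derive.
  - simpl in H. lra.
  - replace (1 + - _) with (1 - k ^ 2 * sin th ^ 2) by ring. field. lra.
Qed.

Lemma Delta_continuous (k th : R) : continuous (Delta k) th.
Proof. unfold Delta. cont. Qed.

Lemma Delta_inv_continuous (k th : R) : 0 < k < 1 -> continuous (fun t => / Delta k t) th.
Proof.
  intros Hk. apply cont_inv; [apply Delta_continuous|].
  apply Rgt_not_eq. now apply Delta_pos.
Qed.

Lemma ellF_0 (k : R) : ellF k 0 = 0.
Proof. unfold ellF. now rewrite RInt_point. Qed.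

Lemma ellF_derive (k th : R) : 0 < k < 1 -> is_derive (ellF k) th (/ Delta k th).
Proof.
  intros Hk. apply (is_derive_RInt (fun t => / Delta k t) (ellF k) 0 th).
  - apply filter_forall. intros x. apply (RInt_correct (V := R_CompleteNormedModule)).
    apply (ex_RInt_continuous (V := R_CompleteNormedModule)). intros; now apply
      Delta_inv_continuous.
  - now apply Delta_inv_continuous.
Qed.

Lemma ellF_continuous (k th : R) : 0 < k < 1 -> continuous (ellF k) th.
Proof.
  intros Hk. apply (ex_derive_continuous (ellF k)). eexists. now apply ellF_derive.
Qed.

Lemma ellF_incr (k x y : R) : 0 < k < 1 -> x < y -> ellF k x < ellF k y.
Proof.
  intros Hk Hxy.
  destruct (MVT_gen (ellF k) x y (fun t => / Delta k t)) as [c [_ Hc]].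
  - intros; now apply ellF_derive.
  - intros z _. apply continuity_pt_filterlim. now apply ellF_continuous.
  - assert (0 < / Delta k c) by (apply Rinv_0_lt_compat; now apply Delta_pos). nra.
Qed.

Lemma ellK_pos (k : R) : 0 < k < 1 -> 0 < ellK k.
Proof.
  intros Hk. rewrite <- ellF_PI2, <- (ellF_0 k). apply ellF_incr; [easy|].
  assert (H := PI_RGT_0). lra.
Qed.

(** * The two families of orthogonal polynomials *)

Section StieltjesCarlitz.

(* [fam = true] is the family q_n; [fam = false] is the family s_n, with the index
   of the eigenvalues shifted to start at 0.  With [u = ellF k th] one has
   [sin th = sn u], [cos th = cn u] and [Delta k th = dn u]. *)
Variables (k : R) (fam : bool).
Hypothesis hk : 0 < k < 1.

(** With t = sn u, alpha and beta are the coefficients in a^2 = 1 - alpha t^2 and b^2 = 1 - beta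
    t^2; alpha is also the parameter of the Hankel weight. *)
Definition alpha : R := if fam then k ^ 2 else 1.
Definition beta : R := if fam then 1 else k ^ 2.
Definition afun (th : R) : R := if fam then Delta k th else cos th.
Definition bfun (th : R) : R := if fam then cos th else Delta k th.
(** Its square is the point at which the polynomials are evaluated. It satisfies cos(r K) = 0 for
    q_n and sin(r K) = 0 for s_n. *)
Definition freq (m : nat) : R := PI / ellK k * (INR m + (if fam then 1 / 2 else 1)).
Definition mode (m : nat) (th : R) : R := sin (freq m * ellF k th).

Lemma alpha_01 : 0 < alpha <= 1.
Proof. unfold alpha. destruct fam; nra. Qed.

Lemma beta_01 : 0 < beta <= 1.
Proof. unfold beta. destruct fam; nra. Qed.

Lemma alpha_beta : alpha * beta = k ^ 2.
Proof. unfold alpha, beta. destruct fam; ring. Qed.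

Lemma alpha_or_beta_1 : (1 - alpha) * (1 - beta) = 0.
Proof. unfold alpha, beta. destruct fam; ring. Qed.

Lemma afun_sqr th : afun th ^ 2 = 1 - alpha * sin th ^ 2.
Proof.
  unfold afun, alpha. destruct fam; [now apply Delta_sqr|].
  assert (H := sin2_cos2 th). unfold Rsqr in H. lra.
Qed.

Lemma bfun_sqr th : bfun th ^ 2 = 1 - beta * sin th ^ 2.
Proof.
  unfold bfun, beta. destruct fam; [|now apply Delta_sqr].
  assert (H := sin2_cos2 th). unfold Rsqr in H. lra.
Qed.

Lemma sin_derive th : is_derive sin th (afun th * bfun th / Delta k th).
Proof.
  replace (afun th * bfun th / Delta k th) with (cos th); [apply is_derive_sin|].
  assert (H := Delta_pos k th hk). unfold afun, bfun. destruct fam; field; lra.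
Qed.

Lemma afun_derive th : is_derive afun th (- alpha * sin th * bfun th / Delta k th).
Proof.
  assert (H := Delta_pos k th hk). unfold afun, bfun, alpha. destruct fam; [now apply
    Delta_derive|].
  replace (-1 * sin th * Delta k th / Delta k th) with (- sin th) by (field; lra).
  replace (- (1) * sin th * Delta k th / Delta k th) with (- sin th) by (field; lra).
  apply is_derive_cos.
Qed.

Lemma bfun_derive th : is_derive bfun th (- beta * sin th * afun th / Delta k th).
Proof.
  assert (H := Delta_pos k th hk). unfold afun, bfun, beta. destruct fam; [|now apply Delta_derive].
  replace (- (1) * sin th * Delta k th / Delta k th) with (- sin th) by (field; lra).
  apply is_derive_cos.
Qed.

Lemma afun_continuous th : continuous afun th.
Proof. apply (ex_derive_continuous afun). eexists. apply afun_derive. Qed.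

Lemma bfun_continuous th : continuous bfun th.
Proof. apply (ex_derive_continuous bfun). eexists. apply bfun_derive. Qed.

Lemma mode_derive m th : is_derive (mode m) th (freq m * cos (freq m * ellF k th) / Delta k th).
Proof.
  assert (H := Delta_pos k th hk). assert (H1 := ellF_derive k th hk).
  unfold mode. auto_derive; [now exists (/ Delta k th)|].
  replace (Derive (fun x => ellF k x) th) with (/ Delta k th);
    [field; lra|symmetry; now apply is_derive_unique].
Qed.

Lemma mode_continuous m th : continuous (mode m) th.
Proof. apply (ex_derive_continuous (mode m)). eexists. apply mode_derive. Qed.

Lemma mode_0 m : mode m 0 = 0.
Proof. unfold mode. now rewrite ellF_0, Rmult_0_r, sin_0. Qed.

Lemma freq_K m : freq m * ellK k = PI * (INR m + (if fam then 1 / 2 else 1)).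
Proof. unfold freq. field. apply Rgt_not_eq, ellK_pos, hk. Qed.

Lemma freq_pos m : 0 < freq m.
Proof.
  assert (H := PI_RGT_0). assert (H1 := ellK_pos k hk). assert (H2 := pos_INR m).
  unfold freq. apply Rmult_lt_0_compat; [now apply Rdiv_lt_0_compat|destruct fam; lra].
Qed.

Lemma sin_INR_PI n : sin (INR n * PI) = 0.
Proof. apply sin_eq_0_1. exists (Z.of_nat n). now rewrite <- INR_IZR_INZ. Qed.

(** A boundary term at u = K. For q_n the factor b = cn vanishes there, for s_n the sine does. In
    [afun_dmode_PI2] it is the cosine for q_n and a = cn for s_n. *)
Lemma bfun_mode_PI2 m : bfun (PI / 2) * mode m (PI / 2) = 0.
Proof.
  unfold mode. rewrite ellF_PI2, freq_K. unfold bfun. destruct fam.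
  - rewrite cos_PI2; ring.
  - rewrite (Rmult_comm PI), <- S_INR, sin_INR_PI. ring.
Qed.

Lemma afun_dmode_PI2 m : afun (PI / 2) * cos (freq m * ellF k (PI / 2)) = 0.
Proof.
  rewrite ellF_PI2, freq_K. unfold afun. destruct fam.
  - replace (PI * (INR m + 1 / 2)) with (INR m * PI + PI / 2) by field.
    rewrite cos_plus, sin_INR_PI, cos_PI2. ring.
  - rewrite cos_PI2; ring.
Qed.

Lemma PI2_pos : 0 < PI / 2.
Proof. assert (H := PI_RGT_0). lra. Qed.

(* [t^(2n+1) a mode du] for [t = sn u]. *)
Definition moment_integrand (m n : nat) (th : R) : R :=
  sin th ^ (2 * n + 1) * afun th * mode m th * / Delta k th.

Definition moment (m n : nat) : R := RInt (moment_integrand m n) 0 (PI / 2).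

Lemma moment_integrand_continuous (m n : nat) th : continuous (moment_integrand m n) th.
Proof.
  assert (H := fun th => Delta_inv_continuous k th hk).
  assert (H1 := afun_continuous). assert (H2 := mode_continuous m).
  unfold moment_integrand. cont.
Qed.

(** * The recurrence of the moments and its decaying solutions *)

Definition jacobi_diag (n : nat) : R :=
  beta * (2 * INR n + 1) ^ 2 + alpha * (2 * INR n + 2) ^ 2.

(** Green's identity in u with g = t^(2n+1) a and f = sin(r u): the function is g' f - g f', its
    u-derivative is (g'' + r^2 g) f, and g'' is expanded by the formulas for a^2 and b^2. At n = 0
    the value [pred 0 = 0] is harmless, its coefficient being 0. *)
Lemma moment_recurrence_derive m n th :
  is_derive (fun th => bfun th * ((2 * INR n + 1) * sin th ^ (2 * n) -
      alpha * (2 * INR n + 2) * sin th ^ (2 * n + 2)) * mode m th -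
      sin th ^ (2 * n + 1) * afun th * (freq m * cos (freq m * ellF k th))) th
   ((2 * INR n + 1) * (2 * INR n) * moment_integrand m (pred n) th +
    (freq m ^ 2 - jacobi_diag n) * moment_integrand m n th +
    k ^ 2 * (2 * INR n + 2) * (2 * INR n + 3) * moment_integrand m (S n) th).
Proof.
  unfold moment_integrand.
  assert (H0 := Delta_pos k th hk).
  assert (Ha := afun_derive th). assert (Hb := bfun_derive th).
  assert (Hp := mode_derive m th). assert (Hu := ellF_derive k th hk).
  auto_derive.
  - repeat split; eexists; eassumption.
  - replace (Derive (fun x => bfun x) th) with (- beta * sin th * afun th / Delta k th)
      by (symmetry; now apply is_derive_unique).
    replace (Derive (fun x => afun x) th) with (- alpha * sin th * bfun th / Delta k th)
      by (symmetry; now apply is_derive_unique).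
    replace (Derive (fun x => mode m x) th) with (freq m * cos (freq m * ellF k th) / Delta k th)
      by (symmetry; now apply is_derive_unique).
    replace (Derive (fun x => ellF k x) th) with (/ Delta k th)
      by (symmetry; now apply is_derive_unique).
    assert (Hc : cos th = afun th * bfun th / Delta k th).
    { rewrite <- (is_derive_unique _ _ _ (is_derive_sin th)). apply is_derive_unique, sin_derive. }
    assert (Hfa := afun_sqr th). assert (Hfb := bfun_sqr th).
    rewrite Hc. fold (mode m th). rewrite <- alpha_beta. unfold jacobi_diag.
    unfold Rdiv.
    set (A := afun th) in *. set (B := bfun th) in *. set (i := / Delta k th).
    set (P := mode m th). set (c := cos (freq m * ellF k th)). set (s := sin th) in *.
    set (f := freq m).
    clearbody A B i P c s f. clear - Hfa Hfb.
    destruct n as [|n].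
    + simpl. ring [Hfa Hfb].
    + replace (S n + (S n + 0))%nat with (S (S (2 * n))) by lia.
      replace (2 * S (S n))%nat with (S (S (S (S (2 * n))))) by lia.
      replace (2 * S n)%nat with (S (S (2 * n))) by lia.
      replace (S (S (2 * n)) + 2)%nat with (S (S (S (S (2 * n))))) by lia.
      rewrite !Nat.add_1_r. unfold pred. rewrite !S_INR, mult_INR. simpl (INR 2).
      rewrite <- !tech_pow_Rmult.
      set (p := s ^ (2 * n)). set (N := INR n). clearbody p N.
      ring [Hfa Hfb].
Qed.

Lemma moment_recurrence m n :
  (2 * INR n + 1) * (2 * INR n) * moment m (pred n) + (freq m ^ 2 - jacobi_diag n) * moment m n +
  k ^ 2 * (2 * INR n + 2) * (2 * INR n + 3) * moment m (S n) = 0.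
Proof.
  assert (HP := PI2_pos).
  assert (Hc := moment_integrand_continuous m (pred n)). assert (Hc1 :=
    moment_integrand_continuous m n).
  assert (Hc2 := moment_integrand_continuous m (S n)).
  unfold moment. rewrite <- !RInt_scal_cont by (auto; lra).
  rewrite <- !RInt_plus_cont by (lra || (intros; cont)).
  assert (H := is_RInt_derive (V := R_CompleteNormedModule) _ _ 0 (PI / 2)
    (fun th _ => moment_recurrence_derive m n th)).
  apply is_RInt_unique in H.
  2:{ intros; cont. }
  etransitivity; [exact H|]. clear H. cbv beta.
  match goal with |- minus ?a ?b = _ => change (a - b = 0) end.
  rewrite mode_0, sin_0, (pow_i (2 * n + 1)) by lia.
  assert (B1 := bfun_mode_PI2 m). assert (B2 := afun_dmode_PI2 m).
  set (g := (2 * INR n + 1) * sin (PI / 2) ^ (2 * n) - _).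
  transitivity (g * (bfun (PI / 2) * mode m (PI / 2)) - sin (PI / 2) ^ (2 * n + 1) * freq m *
    (afun (PI / 2) * cos (freq m * ellF k (PI / 2)))); [ring|rewrite B1, B2; ring].
Qed.

(** Formal eigenvectors, for the eigenvalue x, of the symmetric Jacobi matrix with diagonal
    [jacobi_diag n] and off-diagonal entries - k (2n + 2) (2n + 3). *)
Definition jacobi (x : R) (v : nat -> R) : Prop := forall n,
  k * (2 * INR n + 3) * (2 * INR n + 2) * v (S n) =
  (jacobi_diag n - x) * v n - k * (2 * INR n + 1) * (2 * INR n) * v (pred n).

(** At n = 0 the recurrence already gives v_1 from v_0, so v_0 determines the sequence.
    Cross-multiplication also covers v_0 = 0. *)
Lemma jacobi_unique x v w : jacobi x v -> jacobi x w -> forall n, v n * w O = w n * v O.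
Proof.
  intros Hv Hw n.
  enough (v n * w O = w n * v O /\ v (S n) * w O = w (S n) * v O) by easy.
  assert (Hs : forall n, v n * w O = w n * v O -> v (pred n) * w O = w (pred n) * v O ->
    v (S n) * w O = w (S n) * v O).
  { clear n. intros n H1 H2. assert (H0 := pos_INR n).
    specialize (Hv n). specialize (Hw n).
    assert (0 < k * (2 * INR n + 3) * (2 * INR n + 2)).
    { repeat apply Rmult_lt_0_compat; lra. }
    apply Rmult_eq_reg_l with (k * (2 * INR n + 3) * (2 * INR n + 2)); [|lra].
    rewrite <- !Rmult_assoc, Hv, Hw.
    transitivity ((jacobi_diag n - x) * (v n * w O) -
      k * (2 * INR n + 1) * (2 * INR n) * (v (pred n) * w O)); [ring|].
    rewrite H1, H2. ring. }
  induction n as [|n [IH1 IH2]].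
  - split; [ring|]. apply Hs; simpl; ring.
  - split; [easy|]. now apply Hs.
Qed.

Lemma jacobi_scal x c v : jacobi x v -> jacobi x (fun n => c * v n).
Proof.
  intros H n. specialize (H n).
  transitivity (c * (k * (2 * INR n + 3) * (2 * INR n + 2) * v (S n))); [ring|].
  rewrite H. ring.
Qed.

Lemma moment_jacobi m : jacobi (freq m ^ 2) (fun n => k ^ n * moment m n).
Proof.
  intros n. assert (H := moment_recurrence m n).
  destruct n as [|n].
  - simpl in *. lra.
  - simpl pred in *.
    transitivity (k ^ S n * (k ^ 2 * (2 * INR (S n) + 2) * (2 * INR (S n) + 3) * moment m (S (S
      n))));
      [simpl; ring|].
    replace (k ^ 2 * (2 * INR (S n) + 2) * (2 * INR (S n) + 3) * moment m (S (S n))) with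
      (- ((2 * INR (S n) + 1) * (2 * INR (S n)) * moment m n +
       (freq m ^ 2 - jacobi_diag (S n)) * moment m (S n))) by lra.
    simpl (k ^ S n). ring.
Qed.

Lemma afun_pos th : 0 < th < PI / 2 -> 0 < afun th.
Proof.
  intros H. unfold afun. destruct fam; [now apply Delta_pos|]. apply cos_gt_0; lra.
Qed.

Lemma afun_le_1 th : Rabs (afun th) <= 1.
Proof.
  assert (H := afun_sqr th). assert (H1 := alpha_01). assert (H2 := pow2_ge_0 (sin th)).
  apply Rabs_le. nra.
Qed.

Lemma sin_pow_afun_le_1 n th : Rabs (sin th ^ n * afun th) <= 1.
Proof.
  rewrite Rabs_mult, <- RPow_abs. assert (H := afun_le_1 th).
  assert (Hs : Rabs (sin th) <= 1) by (apply Rabs_le, SIN_bound).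
  rewrite <- (Rmult_1_l 1). apply Rmult_le_compat; try apply Rabs_pos;
    [apply pow_le, Rabs_pos| |easy].
  rewrite <- (pow1 n). apply pow_incr. split; [apply Rabs_pos|easy].
Qed.

(** Otherwise the recurrence makes all moments vanish, and [moments_eq_0] in the variable sin^2
    kills the integrand, which is positive for small th because 0 < r u < pi there. *)
Lemma moment_0_neq_0 m : moment m O <> 0.
Proof.
  intros H0. assert (HP := PI2_pos).
  assert (Hz : forall n, moment m n = 0).
  { enough (H : forall n, moment m n = 0 /\ moment m (S n) = 0) by (intros n; exact (proj1 (H n))).
    assert (Hs : forall n, moment m n = 0 -> moment m (pred n) = 0 -> moment m (S n) = 0).
    { intros n H1 H2. assert (H := moment_recurrence m n). rewrite H1, H2 in H.
      assert (Hn := pos_INR n).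
      assert (Hp : 0 < k ^ 2 * (2 * INR n + 2) * (2 * INR n + 3)).
      { apply Rmult_lt_0_compat; [apply Rmult_lt_0_compat|]; [apply pow_lt| |]; lra. }
      rewrite !Rmult_0_r, !Rplus_0_l in H. apply Rmult_integral in H.
      destruct H as [H|H]; [lra|easy]. }
    induction n as [|n [IH1 IH2]]; [split; [easy|]; now apply Hs|].
    split; [easy|]. now apply Hs. }
  assert (Hg := moments_eq_0
    (moment_integrand m 0) (fun th => sin th ^ 2)
    0 (PI / 2) (Rlt_le _ _ HP)).
  assert (Hs : forall x, 0 <= x <= PI / 2 -> 0 <= sin x).
  { intros x Hx. apply sin_ge_0; lra. }
  destruct (continuous_pos_near (fun th => PI - freq m * ellF k th) 0) as [d Hd].
  { assert (H := ellF_continuous k 0 hk). cont. }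
  { rewrite ellF_0. lra. }
  assert (Hd0 := cond_pos d).
  set (th := Rmin (d / 2) (PI / 4)).
  assert (Ht : 0 < th /\ th <= d / 2 /\ th <= PI / 4).
  { split; [apply Rmin_pos; lra|]. split; [apply Rmin_l|apply Rmin_r]. }
  assert (Hth : 0 < th < PI / 2) by lra.
  apply (Rlt_irrefl 0). rewrite <- (Hg) with (x := th) at 2.
  - assert (0 < sin th) by (apply sin_gt_0; lra).
    assert (0 < mode m th).
    { apply sin_gt_0.
      - apply Rmult_lt_0_compat; [apply freq_pos|]. rewrite <- (ellF_0 k). now apply ellF_incr.
      - assert (0 < PI - freq m * ellF k th); [|lra].
        apply (Hd th). apply Rabs_def1; lra. }
    assert (0 < / Delta k th) by (apply Rinv_0_lt_compat; now apply Delta_pos).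
    assert (0 < afun th) by now apply afun_pos.
    assert (0 < sin th ^ (2 * 0 + 1)) by now apply pow_lt.
    unfold moment_integrand. now do 3 (apply Rmult_lt_0_compat; [|easy]).
  - intros; apply moment_integrand_continuous.
  - intros. cont.
  - intros x Hx. specialize (Hs x Hx). assert (Hb := SIN_bound x). nra.
  - intros x y Hx Hxy Hy. assert (sin x < sin y) by (apply sin_increasing_1; lra).
    assert (0 <= sin x) by (apply Hs; lra). nra.
  - intros j. transitivity (moment m j); [|apply Hz]. apply RInt_ext_le; [lra|]. intros x _.
    unfold moment_integrand. rewrite <- pow_mult, Nat.mul_0_r, Nat.add_0_l, pow_1, pow_add, pow_1.
      req; ring.
  - easy.
Qed.

(* Writing the solution of the recurrence as a ratio of moments shows that it
   decays like [k^n]. *)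
Definition eigvec (m n : nat) : R := k ^ n * moment m n / moment m O.

Lemma eigvec_jacobi m : jacobi (freq m ^ 2) (eigvec m).
Proof.
  assert (H := jacobi_scal _ (/ moment m O) _ (moment_jacobi m)).
  intros n. specialize (H n). unfold eigvec, Rdiv. rewrite !(Rmult_comm _ (/ moment m O)). exact H.
Qed.

Lemma eigvec_0 m : eigvec m O = 1.
Proof. unfold eigvec. simpl. field. apply moment_0_neq_0. Qed.

Lemma eigvec_unique m v : jacobi (freq m ^ 2) v -> forall n, v n = v O * eigvec m n.
Proof.
  intros Hv n. assert (H := jacobi_unique _ _ _ Hv (eigvec_jacobi m) n).
  rewrite eigvec_0 in H. lra.
Qed.

Lemma moment_bound m : exists M, forall n, Rabs (moment m n) <= M.
Proof.
  assert (HP := PI2_pos).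
  exists (RInt (fun th => Rabs (mode m th * / Delta k th)) 0 (PI / 2) * 1). intros n.
  unfold moment, moment_integrand. rewrite (RInt_ext_le _ (fun th => mode m th * / Delta k th *
    (sin th ^ (2 * n + 1) * afun th)))
    by (lra || (intros; req; ring)).
  apply abs_RInt_mult_le; [lra| | |].
  - intros x _. apply cont_mult; [apply mode_continuous|now apply Delta_inv_continuous].
  - intros x _. apply cont_mult; [cont|apply afun_continuous].
  - intros x _. apply sin_pow_afun_le_1.
Qed.

Lemma eigvec_bound m : exists M, forall n, Rabs (eigvec m n) <= M * k ^ n.
Proof.
  destruct (moment_bound m) as [M HM]. exists (M / Rabs (moment m O)). intros n.
  unfold eigvec, Rdiv. rewrite !Rabs_mult, Rabs_inv, (Rabs_pos_eq (k ^ n)) by (apply pow_le; lra).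
  assert (0 < / Rabs (moment m O)) by (apply Rinv_0_lt_compat, Rabs_pos_lt, moment_0_neq_0).
  assert (0 < k ^ n) by (apply pow_lt; lra). specialize (HM n).
  replace (k ^ n * Rabs (moment m n) * / Rabs (moment m O)) with
    (Rabs (moment m n) * (k ^ n * / Rabs (moment m O))) by ring.
  replace (M * / Rabs (moment m O) * k ^ n) with (M * (k ^ n * / Rabs (moment m O))) by ring.
  apply Rmult_le_compat_r; [|easy]. apply Rlt_le, Rmult_lt_0_compat; easy.
Qed.

Lemma geom_l2 (v : nat -> R) (M : R) : (forall n, Rabs (v n) <= M * k ^ n) -> l2 v.
Proof.
  intros H. apply ex_series_abs_le with (fun n => M ^ 2 * (k ^ 2) ^ n).
  - intros n. rewrite <- RPow_abs, <- pow_mult, Nat.mul_comm, pow_mult, <- Rpow_mult_distr.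
    apply pow_incr. split; [apply Rabs_pos|easy].
  - apply ex_series_scal_R, ex_series_geom. rewrite Rabs_pos_eq; nra.
Qed.

Lemma eigvec_l2 m : l2 (eigvec m).
Proof. destruct (eigvec_bound m) as [M HM]. now apply geom_l2 with M. Qed.


(** This is sin^2(pi u / (2 K)). It increases from 0 to 1, as [moments_eq_0] requires, and
    consecutive frequencies differ by pi / K, so multiplication by it only mixes neighbouring
    modes. *)
Definition cheb (th : R) : R := (1 - cos (PI / ellK k * ellF k th)) / 2.

Lemma mode_shift m th :
  mode (S (S m)) th + mode m th = 2 * cos (PI / ellK k * ellF k th) * mode (S m) th.
Proof.
  unfold mode. set (w := PI / ellK k * ellF k th).
  replace (freq (S (S m)) * ellF k th) with (freq (S m) * ellF k th + w)
    by (unfold freq, w; rewrite !S_INR; ring).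
  replace (freq m * ellF k th) with (freq (S m) * ellF k th - w)
    by (unfold freq, w; rewrite !S_INR; ring).
  rewrite sin_plus, sin_minus. ring.
Qed.

(** The mode of index -1 would have frequency -1/2 in units of pi / K for q_n, so it is minus mode
    0; for s_n its frequency is 0, so it vanishes. *)
Lemma mode_shift_0 th : mode 1 th + (if fam then -1 else 0) * mode 0 th =
  2 * cos (PI / ellK k * ellF k th) * mode 0 th.
Proof.
  unfold mode. set (w := PI / ellK k * ellF k th).
  replace (freq 1 * ellF k th) with (freq 0 * ellF k th + w)
    by (unfold freq, w; simpl; ring).
  rewrite sin_plus.
  assert (H : (if fam then -1 else 0) * sin (freq 0 * ellF k th) = sin (freq 0 * ellF k th - w)).
  { unfold freq, w. simpl INR. destruct fam.
    - replace (_ - _) with (- (PI / ellK k * (0 + 1 / 2) * ellF k th))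
        by (field; apply Rgt_not_eq, ellK_pos, hk).
      rewrite sin_neg. ring.
    - replace (_ - _) with 0 by ring. rewrite sin_0. ring. }
  rewrite H, sin_minus. ring.
Qed.

Lemma cheb_continuous th : continuous cheb th.
Proof. assert (H := ellF_continuous k th hk). unfold cheb, Rdiv. cont. Qed.

(* Multiplication by [cheb] acts on the modes by a three-term recurrence. *)
Lemma cheb_moments f :
  (forall th, 0 <= th <= PI / 2 -> continuous f th) ->
  (forall m, RInt (fun th => f th * mode m th) 0 (PI / 2) = 0) ->
  forall j m, RInt (fun th => f th * mode m th * cheb th ^ j) 0 (PI / 2) = 0.
Proof.
  intros Hf H0. assert (HP := PI2_pos).
  assert (Hc : forall j m th, 0 <= th <= PI / 2 ->
    continuous (fun th => f th * mode m th * cheb th ^ j) th).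
  { intros j m th Hth. specialize (Hf th Hth). assert (H1 := mode_continuous m th).
    assert (H2 := cheb_continuous th). cont. }
  induction j as [|j IH]; intros m.
  - etransitivity; [|exact (H0 m)]. apply RInt_ext_le; [lra|]. intros; simpl; req; ring.
  - assert (E : exists a b c, exists p q r : nat, forall th, f th * mode m th * cheb th ^ S j =
      a * (f th * mode p th * cheb th ^ j) + (b * (f th * mode q th * cheb th ^ j) +
      c * (f th * mode r th * cheb th ^ j))).
    { destruct m as [|m].
      - exists (1 / 2), (- (1) / 4), (- (if fam then -1 else 0) / 4), O, 1%nat, O. intros th.
        assert (H := mode_shift_0 th). unfold cheb at 1. simpl (_ ^ S j). fold (cheb th).
        transitivity (f th * cheb th ^ j * (mode 0 th / 2 -
          2 * cos (PI / ellK k * ellF k th) * mode 0 th / 4)); [unfold cheb; field|].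
        rewrite <- H. field.
      - exists (1 / 2), (- (1) / 4), (- (1) / 4), (S m), (S (S m)), m. intros th.
        assert (H := mode_shift m th).
        transitivity (f th * cheb th ^ j * (mode (S m) th / 2 -
          2 * cos (PI / ellK k * ellF k th) * mode (S m) th / 4)); [unfold cheb; simpl; field|].
        rewrite <- H. field. }
    destruct E as [a [b [c [p [q [r E]]]]]].
    rewrite (RInt_ext_le _ _ _ _ (Rlt_le _ _ HP) (fun th _ => E th)).
    assert (Hs : forall a p th, 0 <= th <= PI / 2 ->
      continuous (fun th => a * (f th * mode p th * cheb th ^ j)) th).
    { intros. apply cont_mult; [cont|auto]. }
    rewrite RInt_plus_cont; [|lra|auto|intros; apply cont_plus; auto].
    rewrite RInt_plus_cont; [|lra|auto|auto].
    rewrite !RInt_scal_cont by (lra || auto). rewrite !IH. req; ring.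
Qed.

Lemma PSeries_bounded_continuous v M x :
  (forall n, Rabs (v n) <= M) -> Rabs x < 1 -> continuous (PSeries v) x.
Proof.
  intros HM Hx. apply continuity_pt_filterlim, PSeries_continuity.
  apply Rbar_lt_le_trans with 1; [easy|].
  apply (proj1 (CV_radius_bounded v)). exists M. intros n. rewrite pow1, Rmult_1_r. apply HM.
Qed.

(** The constant term vanishes by continuity at 0; dividing by z reduces the other coefficients to
    this case. Boundedness gives radius of convergence at least 1. *)
Lemma PSeries_bounded_eq_0 e : 0 < e <= 1 -> forall n v M, (forall n, Rabs (v n) <= M) ->
  (forall z, 0 < z < e -> PSeries v z = 0) -> v n = 0.
Proof.
  intros He.
  assert (H0 : forall v M, (forall n, Rabs (v n) <= M) ->
    (forall z, 0 < z < e -> PSeries v z = 0) -> v O = 0).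
  { intros v M HM Hz. apply NNPP. intros Hv.
    assert (Hc : continuous (fun x => Rabs (PSeries v x)) 0).
    { apply cont_abs. apply PSeries_bounded_continuous with M; [easy|]. rewrite Rabs_R0; lra. }
    destruct (continuous_pos_near _ _ Hc) as [d Hd].
    { rewrite PSeries_0. now apply Rabs_pos_lt. }
    assert (Hd0 := cond_pos d). set (z := Rmin (e / 2) (d / 2)).
    assert (Hzb : 0 < z /\ z <= e / 2 /\ z <= d / 2).
    { split; [apply Rmin_pos; lra|]. split; [apply Rmin_l|apply Rmin_r]. }
    assert (Hp : 0 < Rabs (PSeries v z)) by (apply Hd; apply Rabs_def1; lra).
    rewrite Hz, Rabs_R0 in Hp by lra. lra. }
  induction n as [|n IH]; intros v M HM Hz; [now apply (H0 v M)|].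
  apply (IH (PS_decr_1 v) M); [intros; apply HM|].
  intros z Hze. assert (H := Hz z Hze). rewrite PSeries_decr_1 in H.
  - rewrite (H0 v M HM Hz), Rplus_0_l in H.
    apply Rmult_integral in H. destruct H; [lra|easy].
  - apply CV_radius_inside. apply Rbar_lt_le_trans with 1.
    + simpl. rewrite Rabs_pos_eq; lra.
    + apply (proj1 (CV_radius_bounded v)). exists M. intros i. rewrite pow1, Rmult_1_r. apply HM.
Qed.

(** Up to the factor [moment m 0], the pairing of v with eigenvector m is the integral of f times
    mode m, where f contains the power series of v at k t^2. As all these integrals vanish, f times
    mode 0 is orthogonal to every power of [cheb] and hence zero, so the power series vanishes on
    (0, k). *)
Lemma eigvec_complete v : l2 v -> (forall m, Series (fun n => eigvec m n * v n) = 0) ->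
  forall n, v n = 0.
Proof.
  intros Hv H0. destruct (l2_bounded v Hv) as [M HM]. assert (HP := PI2_pos).
  assert (Hz : forall th, 0 <= k * sin th ^ 2 <= k).
  { intros th. assert (H := SIN_bound th). assert (0 <= sin th ^ 2 <= 1) by nra. nra. }
  set (f := fun th => afun th * sin th * PSeries v (k * sin th ^ 2) * / Delta k th).
  assert (Hf : forall th, continuous f th).
  { intros th. assert (H1 := afun_continuous). assert (H2 := fun th => Delta_inv_continuous k th
    hk).
    assert (H3 : continuous (fun th => PSeries v (k * sin th ^ 2)) th).
    { apply (cont_comp (fun th => k * sin th ^ 2) (PSeries v)); [cont|].
      apply PSeries_bounded_continuous with M; [easy|].
      specialize (Hz th). rewrite Rabs_pos_eq; lra. }
    unfold f. cont. }
  assert (Hzero : forall m, RInt (fun th => f th * mode m th) 0 (PI / 2) = 0).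
  { intros m.
    destruct (continuous_bounded (fun th => mode m th * / Delta k th) 0 (PI / 2)) as [B HB]; [lra|
      |].
    { intros x _. apply cont_mult; [apply mode_continuous|now apply Delta_inv_continuous]. }
    assert (HB0 : 0 <= B).
    { eapply Rle_trans; [apply Rabs_pos|]. apply (HB 0); lra. }
    assert (HI : RInt (fun th => Series (fun n => v n * k ^ n * moment_integrand m n th)) 0 (PI /
      2) =
      Series (fun n => RInt (fun th => v n * k ^ n * moment_integrand m n th) 0 (PI / 2))).
    { apply is_RInt_unique.
      apply (RInt_series (fun n th => v n * k ^ n * moment_integrand m n th)
        (fun n => M * B * k ^ n)); [lra| | |].
      - intros n x _. apply cont_mult; [cont|apply moment_integrand_continuous].
      - intros n x Hx. unfold moment_integrand.
        replace (v n * k ^ n * (sin x ^ (2 * n + 1) * afun x * mode m x * / Delta k x)) with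
          ((v n * (mode m x * / Delta k x) * k ^ n) * (sin x ^ (2 * n + 1) * afun x)) by ring.
        rewrite Rabs_mult. rewrite <- (Rmult_1_r (M * B * k ^ n)).
        apply Rmult_le_compat; try apply Rabs_pos.
        + rewrite !(Rabs_mult _ (k ^ n)), (Rabs_pos_eq (k ^ n)) by (apply pow_le; lra).
          apply Rmult_le_compat_r; [apply pow_le; lra|]. rewrite Rabs_mult.
          apply Rmult_le_compat; try apply Rabs_pos; auto.
        + apply sin_pow_afun_le_1.
      - apply ex_series_scal_R, ex_series_geom. rewrite Rabs_pos_eq; lra. }
    rewrite (RInt_ext_le _ (fun th => Series (fun n => v n * k ^ n * moment_integrand m n th)));
      [|lra|].
      + etransitivity; [exact HI|].
        rewrite (Series_ext _ (fun n => moment m 0 * (eigvec m n * v n))).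
        * rewrite Series_scal_l, H0. req; ring.
        * intros n. rewrite RInt_scal_cont by (lra || (intros; apply moment_integrand_continuous)).
          unfold eigvec. fold (moment m n). req. field. apply moment_0_neq_0.
      + intros th _. unfold f, PSeries. req.
        transitivity (sin th * afun th * mode m th * / Delta k th *
          Series (fun n => v n * (k * sin th ^ 2) ^ n)); [ring|].
        rewrite <- Series_scal_l. apply Series_ext. intros n. unfold moment_integrand.
        rewrite Rpow_mult_distr, <- pow_mult, pow_add, pow_1. req; ring. }
  assert (Hmom := cheb_moments f (fun th _ => Hf th) Hzero).
  assert (HK := ellK_pos k hk).
  assert (Hu : forall th, 0 < th < PI / 2 -> 0 < ellF k th < ellK k).
  { intros th Hth. split.
    - rewrite <- (ellF_0 k) at 1. now apply ellF_incr.
    - rewrite <- (ellF_PI2 k). now apply ellF_incr. }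
  assert (Hf0 : forall th, 0 < th < PI / 2 -> f th = 0).
  { intros th Hth.
    assert (H := moments_eq_0 (fun th => f th * mode 0 th) cheb 0 (PI / 2) (Rlt_le _ _ HP)).
    (* Mode 0 has no zero inside the interval: its phase stays below r K, which is pi / 2 or pi. *)
    assert (Hphi : 0 < mode 0 th).
    { specialize (Hu th Hth). assert (HPI := PI_RGT_0).
      assert (Hq : 0 < freq 0 * ellF k th < PI); [|apply sin_gt_0; lra].
      assert (Hw := freq_pos 0). split; [apply Rmult_lt_0_compat; lra|].
      apply Rlt_le_trans with (freq 0 * ellK k); [apply Rmult_lt_compat_l; lra|].
      rewrite freq_K. simpl INR. destruct fam; lra. }
    assert (Hprod : f th * mode 0 th = 0).
    { apply H; [| | | | |easy].
      - intros x _. apply cont_mult; [apply Hf|apply mode_continuous].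
      - intros x _. apply cheb_continuous.
      - intros x _. unfold cheb. assert (Hb := COS_bound (PI / ellK k * ellF k x)). lra.
      - intros x y Hx Hxy Hy. unfold cheb.
        assert (Hxy' := ellF_incr k x y hk Hxy).
        assert (Hr : forall z, 0 <= z <= PI / 2 -> 0 <= PI / ellK k * ellF k z <= PI).
        { intros z Hzz. assert (Hz0 : 0 <= ellF k z <= ellK k).
          { rewrite <- (ellF_PI2 k), <- (ellF_0 k).
            split; [destruct (proj1 Hzz) as [Hlt| <-]|destruct (proj2 Hzz) as [Hlt| ->]];
              try apply Rle_refl; apply Rlt_le; now apply ellF_incr. }
          assert (HPI := PI_RGT_0). split.
          - apply Rmult_le_pos; [apply Rdiv_le_0_compat; lra|lra].
          - replace PI with (PI / ellK k * ellK k) at 2 by (field; lra).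
            apply Rmult_le_compat_l; [apply Rdiv_le_0_compat; lra|lra]. }
        assert (Hrx := Hr x). assert (Hry := Hr y).
        assert (cos (PI / ellK k * ellF k y) < cos (PI / ellK k * ellF k x)); [|lra].
        apply cos_decreasing_1; try lra.
        apply Rmult_lt_compat_l; [|easy]. apply Rdiv_lt_0_compat; [apply PI_RGT_0|easy].
      - intros j. apply Hmom. }
    apply Rmult_integral in Hprod. destruct Hprod; [easy|lra]. }
  intros n. apply (PSeries_bounded_eq_0 k) with (M := M); [lra|easy|].
  (* Every z in (0, k) is k sin^2 th with th = [asin y]. *)
  intros z Hzk. set (y := sqrt (z / k)).
  assert (Hy2 : y ^ 2 = z / k) by (apply pow2_sqrt, Rlt_le, Rdiv_lt_0_compat; lra).
  assert (Hy : 0 < y < 1).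
  { assert (0 < z / k < 1) by (split; [apply Rdiv_lt_0_compat|apply Rlt_div_l]; lra).
    split; [apply sqrt_lt_R0; lra|].
    unfold y. rewrite <- sqrt_1. apply sqrt_lt_1_alt. lra. }
  assert (Hs : sin (asin y) = y) by (apply sin_asin; lra).
  assert (Hth : 0 < asin y < PI / 2).
  { assert (Hb := asin_bound_lt y). split; [|lra].
    apply sin_increasing_0; try lra. now rewrite sin_0, Hs. }
  assert (H := Hf0 _ Hth). unfold f in H. rewrite Hs, Hy2 in H.
  replace (k * (z / k)) with z in H by (field; lra).
  assert (0 < afun (asin y)) by now apply afun_pos.
  assert (0 < / Delta k (asin y)) by (apply Rinv_0_lt_compat; now apply Delta_pos).
  apply Rmult_integral in H. destruct H as [H|H]; [|lra].
  apply Rmult_integral in H. destruct H as [H|H]; [|easy].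
  apply Rmult_integral in H. destruct H; lra.
Qed.

End StieltjesCarlitz.

(** * Commutation with the Jacobi matrix *)

(** Bernoulli's inequality for (1 + h)^n with 1 + h = 1 / r. The constant 3 + 2 / h is chosen so
    that its product with 1 + n h dominates 2 n + 3. *)
Lemma arith_geom_bounded (r : R) : 0 < r < 1 ->
  exists B, forall n, (2 * INR n + 3) * r ^ n <= B.
Proof.
  intros Hr. set (h := / r - 1).
  assert (Hh : 0 < h).
  { unfold h. assert (1 < / r); [|lra]. rewrite <- Rinv_1. apply Rinv_lt_contravar; lra. }
  exists (3 + 2 / h). intros n.
  assert (Hp : 0 < r ^ n) by now apply pow_lt.
  assert (H := poly n h Hh). replace (1 + h) with (/ r) in H by (unfold h; ring).
  rewrite pow_inv in H.
  assert (Hn := pos_INR n).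
  assert (H1 : (1 + INR n * h) * r ^ n <= 1).
  { apply Rle_trans with (/ r ^ n * r ^ n); [apply Rmult_le_compat_r; lra|].
    right. field. lra. }
  assert (H2 : 2 * INR n + 3 <= (3 + 2 / h) * (1 + INR n * h)).
  { replace ((3 + 2 / h) * (1 + INR n * h)) with
      (2 * INR n + 3 + (2 / h + 3 * INR n * h)) by (field; lra).
    assert (0 < 2 / h) by (apply Rdiv_lt_0_compat; lra).
    assert (0 <= INR n * h) by (apply Rmult_le_pos; lra). lra. }
  apply Rle_trans with ((3 + 2 / h) * ((1 + INR n * h) * r ^ n)).
  - rewrite <- Rmult_assoc. apply Rmult_le_compat_r; lra.
  - rewrite <- (Rmult_1_r (3 + 2 / h)) at 2. apply Rmult_le_compat_l; [|easy].
    assert (0 < 2 / h) by (apply Rdiv_lt_0_compat; lra). lra.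
Qed.

Definition binom_weight (k : R) (n : nat) : R :=
  (2 * INR n + 1) * central_binom n * (k / 4) ^ n.

Lemma binom_weight_0 k : binom_weight k O = 1.
Proof. unfold binom_weight, central_binom, Binomial.C. simpl. field. Qed.

Lemma binom_weight_S k n : binom_weight k (S n) = binom_weight k n * (k * (2 * INR n + 3) / (2 *
  (INR n + 1))).
Proof.
  unfold binom_weight, central_binom, Binomial.C.
  replace (2 * S n - S n)%nat with (S n) by lia.
  replace (2 * n - n)%nat with n by lia.
  replace (2 * S n)%nat with (S (S (2 * n))) by lia.
  rewrite !fact_simpl, !mult_INR, !S_INR, mult_INR. simpl (INR 2).
  assert (H := pos_INR n).
  assert (H1 := INR_fact_neq_0 n). simpl pow. field. split; lra.
Qed.

Lemma binom_weight_pos k n : 0 < k -> 0 < binom_weight k n.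
Proof.
  intros Hk. induction n as [|n IH]; [rewrite binom_weight_0; lra|].
  rewrite binom_weight_S. assert (H := pos_INR n). apply Rmult_lt_0_compat; [easy|].
  apply Rdiv_lt_0_compat; [apply Rmult_lt_0_compat|]; lra.
Qed.

Lemma binom_weight_le k n : 0 < k -> binom_weight k n <= (2 * INR n + 1) * k ^ n.
Proof.
  intros Hk. induction n as [|n IH]; [rewrite binom_weight_0; simpl; lra|].
  rewrite binom_weight_S, S_INR. assert (H := pos_INR n). assert (Hp := binom_weight_pos k n Hk).
  apply Rle_trans with ((2 * INR n + 1) * k ^ n * (k * (2 * INR n + 3) / (2 * INR n + 1))).
  - apply Rmult_le_compat; [lra| |easy|].
    + apply Rdiv_le_0_compat; [apply Rmult_le_pos|]; lra.
    + apply Rmult_le_compat_l; [apply Rmult_le_pos; lra|]. apply Rinv_le_contravar; lra.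
  - right. simpl. field. lra.
Qed.

Lemma binom_weight_decay k : 0 < k < 1 -> exists rho M,
  1 < rho /\ forall n, Rabs (binom_weight k n) * rho ^ n <= M.
Proof.
  (* A rate strictly between 1 and 1 / k: k rho = (1 + k) / 2 < 1 leaves room to absorb the factor 2
     n + 1. *)
  intros Hk. exists ((1 + / k) / 2).
  assert (Hk' : 1 < / k) by (rewrite <- Rinv_1; apply Rinv_lt_contravar; lra).
  destruct (arith_geom_bounded ((1 + k) / 2)) as [B HB]; [lra|].
  exists B. split; [lra|]. intros n. rewrite Rabs_pos_eq by (apply Rlt_le, binom_weight_pos; lra).
  assert (Hr : 0 < ((1 + / k) / 2) ^ n) by (apply pow_lt; lra).
  apply Rle_trans with ((2 * INR n + 1) * k ^ n * ((1 + / k) / 2) ^ n).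
  { apply Rmult_le_compat_r; [lra|]. apply binom_weight_le; lra. }
  rewrite Rmult_assoc, <- Rpow_mult_distr.
  replace (k * ((1 + / k) / 2)) with ((1 + k) / 2) by (field; lra).
  assert (0 < ((1 + k) / 2) ^ n) by (apply pow_lt; lra).
  specialize (HB n). nra.
Qed.

Lemma RInt_pow_weight (a : R) (N : nat) :
  RInt (fun s => s ^ N * weight a s) 0 1 = / (INR N + 1) - a / (INR N + 2).
Proof.
  assert (H := pos_INR N).
  apply is_RInt_unique.
  set (F := fun s : R => s ^ (N + 1) / (INR N + 1) - a * s ^ (N + 2) / (INR N + 2)).
  replace (/ (INR N + 1) - a / (INR N + 2)) with (minus (F 1) (F 0)).
  - apply (is_RInt_derive (V := R_CompleteNormedModule) F).
    + intros x _. unfold F, weight. auto_derive; [easy|].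
      rewrite !plus_INR. simpl (INR 1). simpl (INR 2).
      replace (Init.Nat.pred (N + 1)) with N by lia.
      replace (Init.Nat.pred (N + 2)) with (S N) by lia.
      simpl. field. lra.
    + intros x _. apply cont_mult; [cont|apply weight_continuous].
  - change (F 1 - F 0 = / (INR N + 1) - a / (INR N + 2)). unfold F.
    rewrite !pow1, !pow_i by lia. field. lra.
Qed.

Section Commutation.

Variables (k : R) (fam : bool).
Hypothesis hk : 0 < k < 1.

Local Notation al := (alpha k fam).
Local Notation jdiag := (jacobi_diag k fam).
Local Notation H := (hankel_mx al (binom_weight k)).

Lemma hankel_mx_eq m n : H m n = binom_weight k m * binom_weight k n *
  (/ (INR m + INR n + 1) - al / (INR m + INR n + 2)).
Proof. unfold hankel_mx. now rewrite RInt_pow_weight, plus_INR. Qed.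

(** Up to sign, J H = H J entrywise. After division by d_m d_n both sides are values of one rational
    function G at (m, n) and (n, m), and the claim is its symmetry. *)
Lemma hankel_mx_commutes m n :
  k * (2 * INR m + 3) * (2 * INR m + 2) * H (S m) n - jdiag m * H m n +
    k * (2 * INR m + 1) * (2 * INR m) * H (pred m) n =
  k * (2 * INR n + 3) * (2 * INR n + 2) * H m (S n) - jdiag n * H m n +
    k * (2 * INR n + 1) * (2 * INR n) * H m (pred n).
Proof.
  assert (E : (1 - al) * (1 - beta k fam) = 0) by apply alpha_or_beta_1.
  assert (Eab : al * beta k fam = k ^ 2) by apply alpha_beta.
  unfold jacobi_diag. rewrite !hankel_mx_eq, !S_INR.
  set (a := al) in *. set (b := beta k fam) in *.
  assert (Hm := pos_INR m). assert (Hn := pos_INR n).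
  assert (Hab : (a = 1 /\ b = k ^ 2) \/ (a = k ^ 2 /\ b = 1)).
  { apply Rmult_integral in E. destruct E; [left|right]; split; nra. }
  clearbody a b. clear E Eab.
  (* G contains 1 / (m + n), a denominator that [field] cannot clear at m = n = 0. *)
  destruct (Nat.eq_dec (m + n) 0) as [H0|H0].
  { assert (m = O) by lia. assert (n = O) by lia. subst m n.
    simpl pred. change (INR 0) with 0. rewrite !Rplus_0_l, !Rplus_0_r. ring. }
  assert (Hmn : 1 <= INR m + INR n).
  { rewrite <- plus_INR. apply (le_INR 1). lia. }
  set (h := fun x => / (x + 1) - a / (x + 2)).
  set (G := fun x y => k ^ 2 * (2 * x + 3) ^ 2 * h (x + y + 1) -
    (b * (2 * x + 1) ^ 2 + a * (2 * x + 2) ^ 2) * h (x + y) + 4 * x ^ 2 * h (x + y - 1)).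
  assert (Gsym : G (INR m) (INR n) = G (INR n) (INR m)).
  { unfold G, h. destruct Hab as [[-> ->]|[-> ->]]; field; lra. }
  (* The ratio d_m / d_(m-1) = k (2m + 1) / (2m) produces the coefficient 4 m^2 of G and removes
     [pred]. *)
  assert (P : forall m, k * (2 * INR m + 1) * (2 * INR m) * binom_weight k (pred m) =
    4 * INR m ^ 2 * binom_weight k m).
  { intros [|i]; [simpl; ring|]. simpl pred. rewrite binom_weight_S, S_INR.
    assert (Hi := pos_INR i). field. lra. }
  assert (Q : forall m n, k * (2 * INR m + 1) * (2 * INR m) * (binom_weight k (pred m) *
    binom_weight k n *
     h (INR (pred m) + INR n)) = binom_weight k m * binom_weight k n * (4 * INR m ^ 2 * h (INR m +
       INR n - 1))).
  { intros m' n'.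
    transitivity (k * (2 * INR m' + 1) * (2 * INR m') * binom_weight k (pred m') * binom_weight k
      n' *
      h (INR (pred m') + INR n')); [ring|]. rewrite P.
    destruct m' as [|i]; [simpl; ring|]. simpl pred.
    replace (INR (S i) + INR n' - 1) with (INR i + INR n') by (rewrite S_INR; ring). ring. }
  assert (Main : forall m n, 0 <= INR m ->
    k * (2 * INR m + 3) * (2 * INR m + 2) * (binom_weight k (S m) * binom_weight k n * h (INR m +
      1 + INR n)) -
    (b * (2 * INR m + 1) ^ 2 + a * (2 * INR m + 2) ^ 2) * (binom_weight k m * binom_weight k n * h
      (INR m + INR n)) +
    k * (2 * INR m + 1) * (2 * INR m) * (binom_weight k (pred m) * binom_weight k n * h (INR (pred
      m) + INR n)) =
    binom_weight k m * binom_weight k n * G (INR m) (INR n)).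
  { intros m' n' Hm'. rewrite Q, binom_weight_S. unfold G.
    replace (INR m' + 1 + INR n') with (INR m' + INR n' + 1) by ring. field. lra. }
  assert (E1 := Main m n Hm). assert (E2 := Main n m Hn).
  assert (E3 : binom_weight k m * binom_weight k n * G (INR m) (INR n) = binom_weight k n *
    binom_weight k m * G (INR n) (INR m)).
  { rewrite Gsym. ring. }
  rewrite E3, <- E2 in E1. unfold h in E1.
  etransitivity; [exact E1|].
  rewrite !(Rplus_comm (INR m) _). rewrite (Rplus_comm (INR n + 1) (INR m)).
  replace (INR m + (INR n + 1)) with (INR n + 1 + INR m) by ring.
  ring.
Qed.

(* Summation by parts: the partial sums telescope to the Casoratian of two
   decaying sequences. *)
Lemma hankel_op_jacobi x v M : jacobi k fam x v -> (forall n, Rabs (v n) <= M * k ^ n) ->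
  jacobi k fam x (hankel_op al (binom_weight k) v).
Proof.
  intros Hv HM m.
  destruct (binom_weight_decay k hk) as [rho [Md [Hrho Hd]]].
  assert (Hal := alpha_01 k fam hk).
  assert (Hl2 : l2 v) by (now apply (geom_l2 k hk v M)).
  assert (Hs := fun m => hankel_op_is_series al (binom_weight k) rho Md Hrho Hd v m Hl2).
  set (c := fun n => k * (2 * INR n + 3) * (2 * INR n + 2)).
  set (T := fun n => c n * (H m (S n) * v n - H m n * v (S n))).
  assert (Hc : exists B, forall n, Rabs (c n * v n) <= B /\ Rabs (c n * v (S n)) <= B).
  (* c_n grows quadratically, so k^n is split into two factors sqrt(k)^n, one for each linear
     factor. *)
  { destruct (arith_geom_bounded (sqrt k)) as [B HB].
    { split; [apply sqrt_lt_R0; lra|]. rewrite <- sqrt_1. apply sqrt_lt_1_alt. lra. }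
    assert (HcB : forall n, Rabs (c n) * k ^ n <= B * B).
    { intros n. assert (Hn := pos_INR n). unfold c. rewrite Rabs_pos_eq.
      2:{ apply Rmult_le_pos; [apply Rmult_le_pos|]; lra. }
      specialize (HB n). assert (Hq : 0 < sqrt k ^ n) by (apply pow_lt, sqrt_lt_R0; lra).
      replace (k ^ n) with (sqrt k ^ n * sqrt k ^ n).
      2:{ rewrite <- Rpow_mult_distr, sqrt_sqrt; [easy|lra]. }
      apply Rle_trans with (((2 * INR n + 3) * sqrt k ^ n) * ((2 * INR n + 3) * sqrt k ^ n)).
      - set (s := sqrt k ^ n) in *. clearbody s.
        replace (k * (2 * INR n + 3) * (2 * INR n + 2) * (s * s)) with
          ((2 * INR n + 3) * s * (k * (2 * INR n + 2) * s)) by ring.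
        apply Rmult_le_compat_l; [apply Rmult_le_pos; lra|].
        apply Rmult_le_compat_r; [lra|]. nra.
      - apply Rmult_le_compat; try easy; apply Rmult_le_pos; lra. }
    assert (HM0 : 0 <= M).
    { specialize (HM O). rewrite Rmult_1_r in HM.
      eapply Rle_trans; [apply Rabs_pos|exact HM]. }
    exists (M * (B * B)). intros n. rewrite !Rabs_mult.
    assert (Hk : 0 < k ^ n) by (apply pow_lt; lra).
    assert (Hcn := Rabs_pos (c n)). specialize (HcB n).
    assert (HMc : M * (Rabs (c n) * k ^ n) <= M * (B * B)) by now apply Rmult_le_compat_l.
    assert (H1 := HM n). assert (H2 := HM (S n)). simpl in H2.
    assert (H2' : Rabs (v (S n)) <= M * k ^ n).
    { eapply Rle_trans; [exact H2|]. apply Rmult_le_compat_l; nra. }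
    split.
    - apply Rle_trans with (Rabs (c n) * (M * k ^ n)); [now apply Rmult_le_compat_l|lra].
    - apply Rle_trans with (Rabs (c n) * (M * k ^ n)); [now apply Rmult_le_compat_l|lra]. }
  (* The entries of row m decay like rho^(-n), while c_n v_n and c_n v_(n+1) stay bounded. *)
  assert (Hlim : is_lim_seq T 0).
  { destruct Hc as [B HB].
    apply is_lim_seq_abs_0.
    assert (Hd0 : forall n, Rabs (binom_weight k n) <= Md * (/ rho) ^ n).
    { intros n. assert (0 < rho ^ n) by (apply pow_lt; lra). rewrite pow_inv.
      apply (Rle_div_r _ Md); [easy|apply Hd]. }
    assert (HMd : 0 <= Md).
    { specialize (Hd O). rewrite Rmult_1_r in Hd. eapply Rle_trans; [apply Rabs_pos|exact Hd]. }
    assert (Hrr : 0 < / rho < 1).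
    { split; [apply Rinv_0_lt_compat; lra|]. rewrite <- Rinv_1. apply Rinv_lt_contravar; lra. }
    apply is_lim_seq_le_le with (fun _ => 0) (fun n => 2 * Rabs (binom_weight k m) * Md * B * (/
      rho) ^ n).
    - intros n. split; [apply Rabs_pos|]. unfold T.
      assert (Hb := fun n => hankel_mx_bound al (binom_weight k) ltac:(lra) m n).
      assert (Hh : forall j, (n <= j)%nat -> Rabs (H m j) <= Rabs (binom_weight k m) * (Md * (/
        rho) ^ n)).
      { intros j Hj. eapply Rle_trans; [apply Hb|]. apply Rmult_le_compat_l; [apply Rabs_pos|].
        eapply Rle_trans; [apply Hd0|]. apply Rmult_le_compat_l; [easy|].
        replace j with (n + (j - n))%nat by lia. rewrite pow_add.
        rewrite <- (Rmult_1_r ((/ rho) ^ n)) at 2. apply Rmult_le_compat_l; [apply pow_le; lra|].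
        rewrite <- (pow1 (j - n)). apply pow_incr; lra. }
      replace (c n * (H m (S n) * v n - H m n * v (S n))) with
        (H m (S n) * (c n * v n) + - (H m n * (c n * v (S n)))) by ring.
      eapply Rle_trans; [apply Rabs_triang|]. rewrite Rabs_Ropp, !(Rabs_mult (H _ _)).
      assert (A1 : Rabs (H m (S n)) * Rabs (c n * v n) <= Rabs (binom_weight k m) * (Md * (/ rho)
        ^ n) * B).
      { apply Rmult_le_compat; try apply Rabs_pos; [apply Hh; lia|apply HB]. }
      assert (A2 : Rabs (H m n) * Rabs (c n * v (S n)) <= Rabs (binom_weight k m) * (Md * (/ rho)
        ^ n) * B).
      { apply Rmult_le_compat; try apply Rabs_pos; [apply Hh; lia|apply HB]. }
      lra.
    - apply is_lim_seq_const.
    - replace (Finite 0) with (Rbar_mult (2 * Rabs (binom_weight k m) * Md * B) 0)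
        by (simpl; f_equal; ring).
      apply is_lim_seq_scal_l. apply is_lim_seq_geom. rewrite Rabs_pos_eq; lra. }
  assert (Hsum : is_series (fun n => k * (2 * INR m + 3) * (2 * INR m + 2) * (H (S m) n * v n) +
      - (jdiag m - x) * (H m n * v n) +
      k * (2 * INR m + 1) * (2 * INR m) * (H (pred m) n * v n)) 0).
  { change (is_lim_seq (sum_n (fun n => k * (2 * INR m + 3) * (2 * INR m + 2) * (H (S m) n * v n) +
      - (jdiag m - x) * (H m n * v n) +
      k * (2 * INR m + 1) * (2 * INR m) * (H (pred m) n * v n))) 0).
    apply (is_lim_seq_ext T); [|exact Hlim].
    (* Commutation moves the Jacobi matrix from the index m to n, and the recurrence of v cancels
       the diagonal terms; T n - T (n - 1) is left. *)
    assert (Ht : forall n, k * (2 * INR m + 3) * (2 * INR m + 2) * (H (S m) n * v n) +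
      - (jdiag m - x) * (H m n * v n) +
      k * (2 * INR m + 1) * (2 * INR m) * (H (pred m) n * v n) =
      T n - k * (2 * INR n + 1) * (2 * INR n) * (H m n * v (pred n) - H m (pred n) * v n)).
    { intros n. assert (Hcomm := hankel_mx_commutes m n). specialize (Hv n). unfold T, c.
      transitivity ((k * (2 * INR m + 3) * (2 * INR m + 2) * H (S m) n - jdiag m * H m n +
        k * (2 * INR m + 1) * (2 * INR m) * H (pred m) n) * v n + x * v n * H m n); [ring|].
      rewrite Hcomm.
      replace (x * v n) with (jdiag n * v n - k * (2 * INR n + 3) * (2 * INR n + 2) * v (S n) -
        k * (2 * INR n + 1) * (2 * INR n) * v (pred n)) by lra. ring. }
    induction n as [|n IH].
    - rewrite sum_O, Ht. simpl. ring.
    - rewrite sum_Sn, <- IH, Ht. change (Init.Nat.pred (S n)) with n.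
      match goal with |- _ = plus ?a ?b => change (T (S n) = a + b) end.
      replace (k * (2 * INR (S n) + 1) * _ * _) with (T n); [ring|].
      unfold T, c. rewrite S_INR. ring. }
  assert (Hsum' := is_series_plus (V := R_NormedModule) _ _ _ _
    (is_series_plus (V := R_NormedModule) _ _ _ _
      (is_series_scal (V := R_NormedModule) (k * (2 * INR m + 3) * (2 * INR m + 2)) _ _ (Hs (S m)))
      (is_series_scal (V := R_NormedModule) (- (jdiag m - x)) _ _ (Hs m)))
    (is_series_scal (V := R_NormedModule) (k * (2 * INR m + 1) * (2 * INR m)) _ _ (Hs (pred m)))).
  apply is_series_unique in Hsum. apply is_series_unique in Hsum'.
  assert (Heq := eq_trans (eq_sym Hsum') Hsum). clear Hsum Hsum'.
  unfold hankel_op. rewrite !(is_series_unique _ _ (Hs _)).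
  match type of Heq with plus (plus (scal ?a ?x) (scal ?b ?y)) (scal ?c ?z) = _ =>
    change (a * x + b * y + c * z = 0) in Heq end.
  lra.
Qed.

End Commutation.

(** * The eigenvalues *)

Lemma cont_pt (f : R -> R) (x : R) : continuous f x -> continuity_pt f x.
Proof. apply continuity_pt_filterlim. Qed.

Ltac cont2 := repeat match goal with
  | |- continuity_2d_pt (fun u _ => @?f u) ?x ?y =>
      apply (continuity_1d_2d_pt_comp f (fun u _ => u) x y);
        [apply cont_pt; cont|apply continuity_2d_pt_id1]
  | |- continuity_2d_pt (fun _ v => @?f v) ?x ?y =>
      apply (continuity_1d_2d_pt_comp f (fun _ v => v) x y);
        [apply cont_pt; cont|apply continuity_2d_pt_id2]
  | |- continuity_2d_pt (fun u v => @?f u v + @?g u v) ?x ?y =>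
      apply (continuity_2d_pt_plus f g x y)
  | |- continuity_2d_pt (fun u v => @?f u v - @?g u v) ?x ?y =>
      apply (continuity_2d_pt_minus f g x y)
  | |- continuity_2d_pt (fun u v => @?f u v * @?g u v) ?x ?y =>
      apply (continuity_2d_pt_mult f g x y)
  | |- continuity_2d_pt (fun u v => / @?f u v) ?x ?y =>
      apply (continuity_2d_pt_inv f x y)
  | |- continuity_2d_pt (fun u v => @?f u v ^ ?n) ?x ?y =>
      apply (continuity_1d_2d_pt_comp (fun z => z ^ n) f x y);
        [apply cont_pt; cont|]
  end.

Lemma RInt_param_continuous (F : R -> R -> R) (a b x : R) : a <= b ->
  (forall t, a <= t <= b -> continuity_2d_pt F x t) ->
  (forall y, ex_RInt (F y) a b) ->
  continuous (fun y => RInt (F y) a b) x.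
Proof.
  intros Hab Hc Hex. apply filterlim_locally. intros eps.
  assert (He : 0 < eps / (2 * (b - a + 1))).
  { apply Rdiv_lt_0_compat; [apply cond_pos|lra]. }
  destruct (uniform_continuity_2d_1d' F a b x Hc (mkposreal _ He)) as [d Hd].
  exists d. intros y Hy. change (Rabs (y - x) < d) in Hy. apply Rabs_def2 in Hy.
  change (Rabs (RInt (F y) a b - RInt (F x) a b) < eps).
  assert (E : RInt (F y) a b - RInt (F x) a b = RInt (fun t => F y t - F x t) a b).
  { symmetry. apply (RInt_minus (V := R_CompleteNormedModule)); apply Hex. }
  rewrite E. assert (Hd0 := cond_pos d).
  apply Rle_lt_trans with ((b - a) * (eps / (2 * (b - a + 1)))).
  - apply abs_RInt_le_const; [easy| |].
    + apply (ex_RInt_minus (V := R_NormedModule)); apply Hex.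
    + intros t Ht. left. apply (Hd t x t y); try lra. rewrite Rminus_eq_0, Rabs_R0. lra.
  - replace ((b - a) * (eps / (2 * (b - a + 1)))) with
      (eps * ((b - a) / (2 * (b - a + 1)))) by (field; lra).
    rewrite <- (Rmult_1_r eps) at 2. apply Rmult_lt_compat_l; [apply cond_pos|].
    apply Rlt_div_l; lra.
Qed.

(** Integrating the derivative of y (1 - y^2)^(n+1) gives the ratio (2n + 2) / (2n + 3) of
    consecutive integrals, the inverse of that of d_n / k^n. *)
Lemma wallis_binom_weight (k : R) (n : nat) : 0 < k ->
  RInt (fun y => (1 - y ^ 2) ^ n) 0 1 = k ^ n / binom_weight k n.
Proof.
  intros Hk. induction n as [|n IH].
  - rewrite binom_weight_0. simpl. rewrite RInt_const. unfold scal; simpl. unfold mult; simpl.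
    field.
  - assert (Hn := pos_INR n).
    assert (E : (2 * INR n + 3) * RInt (fun y => (1 - y ^ 2) ^ S n) 0 1 +
      - (2 * INR n + 2) * RInt (fun y => (1 - y ^ 2) ^ n) 0 1 = 0).
    { rewrite <- !RInt_scal_cont by (lra || (intros; cont)).
      rewrite <- RInt_plus_cont by (lra || (intros; cont)).
      apply is_RInt_unique.
      replace 0 with (minus (1 * (1 - 1 ^ 2) ^ S n) (0 * (1 - 0 ^ 2) ^ S n)) at 2.
      2:{ change (1 * (1 - 1 ^ 2) ^ S n - 0 * (1 - 0 ^ 2) ^ S n = 0).
          replace (1 - 1 ^ 2) with 0 by ring. rewrite (pow_i (S n)) by lia. ring. }
      apply (is_RInt_derive (V := R_CompleteNormedModule) (fun y => y * (1 - y ^ 2) ^ S n)).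
      - intros x _. auto_derive; [easy|].
        change (match n with O => 1 | S _ => INR n + 1 end) with (INR (S n)).
        replace (1 + - (x * (x * 1))) with (1 - x ^ 2) by ring.
        change ((1 - x ^ 2) ^ S n) with ((1 - x ^ 2) * (1 - x ^ 2) ^ n).
        rewrite S_INR. set (p := (1 - x ^ 2) ^ n). ring.
      - intros x _. cont. }
    rewrite IH in E. rewrite binom_weight_S. assert (Hd := binom_weight_pos k n Hk).
    apply Rmult_eq_reg_l with (2 * INR n + 3); [|lra].
    transitivity ((2 * INR n + 2) * (k ^ n / binom_weight k n)); [lra|]. simpl. field. lra.
Qed.

Lemma C1_lipschitz (f df : R -> R) :
  (forall x, 0 <= x <= 1 -> is_derive f x (df x)) ->
  (forall x, 0 <= x <= 1 -> continuous df x) ->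
  exists A, forall x y, 0 <= x <= 1 -> 0 <= y <= 1 -> Rabs (f x - f y) <= A * Rabs (x - y).
Proof.
  intros Hf Hdf. destruct (continuous_bounded df 0 1 Rle_0_1 Hdf) as [M HM].
  exists M. intros x y Hx Hy.
  assert (Hin : forall z, Rmin y x <= z <= Rmax y x -> 0 <= z <= 1).
  { intros z [H1 H2]. split.
    - eapply Rle_trans; [|exact H1]. apply Rmin_glb; lra.
    - eapply Rle_trans; [exact H2|]. apply Rmax_lub; lra. }
  destruct (MVT_gen f y x df) as [c [Hc E]].
  - intros z Hz. apply Hf, Hin. lra.
  - intros z Hz. apply continuity_pt_filterlim. apply (ex_derive_continuous f).
    eexists. apply Hf, Hin, Hz.
  - rewrite E, Rabs_mult. apply Rmult_le_compat_r; [apply Rabs_pos|]. apply HM, Hin, Hc.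
Qed.

(** Since (1 - x)^(-3/2) has the coefficients d_n / k^n, an average that multiplies s^n by k^n / d_n
    turns this kernel into the geometric series of 1 / (1 + c t). *)
Definition power_kernel (c s : R) : R := / ((1 + c * s) * sqrt (1 + c * s)).

Lemma power_kernel_derive c s : 0 < 1 + c * s ->
  is_derive (power_kernel c) s (- (3 / 2) * c * / ((1 + c * s) ^ 2 * sqrt (1 + c * s))).
Proof.
  intros H. assert (Hq := sqrt_lt_R0 _ H). unfold power_kernel. auto_derive.
  - split; [easy|]. split; [|easy]. apply Rgt_not_eq. now apply Rmult_lt_0_compat.
  - assert (E := sqrt_sqrt (1 + c * s) (Rlt_le _ _ H)).
    set (q := sqrt (1 + c * s)) in *. rewrite <- E. clearbody q. field. lra.
Qed.

Lemma power_kernel_continuous c s : 0 < 1 + c * s -> continuous (power_kernel c) s.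
Proof. intros H. apply (ex_derive_continuous (power_kernel c)). eexists. now apply
  power_kernel_derive. Qed.

(** The Lipschitz bound makes [functional_eq_0] applicable for every c >= 0, also where the binomial
    series diverges. *)
Lemma power_kernel_lipschitz c : 0 <= c -> exists A, forall x y, 0 <= x <= 1 -> 0 <= y <= 1 ->
  Rabs (power_kernel c x - power_kernel c y) <= A * Rabs (x - y).
Proof.
  intros Hc.
  assert (H : forall x, 0 <= x <= 1 -> 0 < 1 + c * x).
  { intros x Hx. assert (0 <= c * x) by (apply Rmult_le_pos; lra). lra. }
  apply (C1_lipschitz _ (fun s => - (3 / 2) * c * / ((1 + c * s) ^ 2 * sqrt (1 + c * s)))).
  - intros x Hx. apply power_kernel_derive. auto.
  - intros x Hx. specialize (H x Hx). assert (Hq := sqrt_lt_R0 _ H). cont.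
    apply Rgt_not_eq, Rmult_lt_0_compat; [now apply pow_lt|easy].
Qed.

Lemma RInt_pker_abel c t : 0 <= c -> 0 <= t ->
  RInt (fun y => power_kernel c ((1 - y ^ 2) * t)) 0 1 = / (1 + c * t).
Proof.
  intros Hc Ht. assert (Hct : 0 <= c * t) by now apply Rmult_le_pos.
  assert (Hp : forall y, 0 <= y <= 1 -> 0 < 1 + c * ((1 - y ^ 2) * t)).
  { intros y Hy. assert (0 <= (c * t) * (1 - y ^ 2)) by (apply Rmult_le_pos; nra). lra. }
  apply is_RInt_unique.
  set (F := fun y => y / ((1 + c * t) * sqrt (1 + c * ((1 - y ^ 2) * t)))).
  replace (/ (1 + c * t)) with (minus (F 1) (F 0)).
  - apply (is_RInt_derive (V := R_CompleteNormedModule) F).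
    + intros x Hx. rewrite Rmin_left, Rmax_right in Hx by lra.
      assert (H := Hp x Hx). assert (Hq := sqrt_lt_R0 _ H). unfold F, power_kernel. auto_derive.
      * replace (1 + - _) with (1 - x ^ 2) by ring. repeat split; [easy|].
        apply Rgt_not_eq, Rmult_lt_0_compat; lra.
      * replace (1 + - _) with (1 - x ^ 2) by ring.
        assert (E := sqrt_sqrt _ (Rlt_le _ _ H)).
        set (q := sqrt _) in *. rewrite <- E.
        assert (Ex : x * x * (c * t) = 1 + c * t - q * q) by (rewrite E; ring).
        clearbody q. transitivity ((q * q + x * x * (c * t)) / ((1 + c * t) * (q * q * q)));
          [field; lra|rewrite Ex; field; lra].
    + intros x Hx. rewrite Rmin_left, Rmax_right in Hx by lra.
      apply (cont_comp (fun y => (1 - y ^ 2) * t) (power_kernel c)); [cont|]. apply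
        power_kernel_continuous. auto.
  - change (F 1 - F 0 = / (1 + c * t)). unfold F.
    replace (1 + c * ((1 - 1 ^ 2) * t)) with 1 by ring. rewrite sqrt_1.
    assert (sqrt (1 + c * ((1 - 0 ^ 2) * t)) <> 0).
    { apply Rgt_not_eq, sqrt_lt_R0, Hp. lra. }
    field. split; lra.
Qed.

(** * The eigenvalue equation as an identity between integral transforms *)

Section Eigenvalue.

Variables (k : R) (fam : bool) (m : nat).
Hypothesis hk : 0 < k < 1.

Local Notation al := (alpha k fam).
Local Notation d := (binom_weight k).
Local Notation psi := (eigvec k fam m).
Local Notation mom := (moment k fam m).
Local Notation momf := (moment_integrand k fam m).

(** Since [psi O] is 1, the eigenvalue is component 0 of the image of psi. *)
Definition eigval : R := hankel_op al d psi O.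

Lemma hankel_op_eigvec n : hankel_op al d psi n = eigval * psi n.
Proof.
  destruct (eigvec_bound k fam hk m) as [M HM].
  exact (eigvec_unique k fam hk m _ (hankel_op_jacobi k fam hk _ _ M (eigvec_jacobi k fam hk m)
    HM) n).
Qed.

(** Component n of the image of psi is d_n times the n-th moment of this function, so the eigenvalue
    equation prescribes all its moments. *)
Definition density (s : R) : R := weight al s * gen_fun d psi s.

Lemma density_continuous s : 0 <= s <= 1 -> continuous density s.
Proof.
  intros Hs. destruct (binom_weight_decay k hk) as [rho [Md [Hrho Hd]]].
  apply cont_mult; [apply weight_continuous|].
  exact (gen_fun_continuous d rho Md Hrho Hd psi s (eigvec_l2 k fam hk m) Hs).
Qed.

Lemma density_moments n : RInt (fun s => density s * s ^ n) 0 1 = eigval * k ^ n * mom n / (mom 0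
  * d n).
Proof.
  destruct (binom_weight_decay k hk) as [rho [Md [Hrho Hd]]].
  assert (Hal := alpha_01 k fam hk). assert (Hp := binom_weight_pos k n (proj1 hk)).
  assert (H := hankel_op_gen al d rho Md Hrho Hd psi n (eigvec_l2 k fam hk m)).
  rewrite hankel_op_eigvec in H. fold density in H.
  rewrite (RInt_ext_le _ (fun s => s ^ n * (weight al s * gen_fun d psi s))); [|lra|].
  2:{ intros s _. unfold density. req; ring. }
  apply Rmult_eq_reg_l with (d n); [|lra]. rewrite <- H. unfold eigvec. field.
  split; [lra|]. now apply moment_0_neq_0.
Qed.

(* Both sides are integrals of the functions [f] and [B f], where
   [(B f)(t) = int_0^1 f((1 - y^2) t) dy] maps [s^n] to [k^n / d_n * t^n] and
   [power_kernel c] to [1 / (1 + c t)]. *)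
Lemma density_transform c : 0 <= c ->
  RInt (fun s => density s * power_kernel c s) 0 1 =
  eigval / mom 0 * RInt (fun th => momf 0 th * / (1 + c * sin th ^ 2)) 0 (PI / 2).
Proof.
  intros Hc. assert (HP := PI2_pos). assert (Hal := alpha_01 k fam hk).
  assert (Hms := fun th => moment_integrand_continuous k fam hk m 0 th).
  set (B := (fun f th => RInt (fun y => f ((1 - y ^ 2) * sin th ^ 2)) 0 1) : (R -> R) -> R -> R).
  set (q := eigval / mom 0).
  (* L is a bounded functional that vanishes on monomials by [density_moments] and
     [wallis_binom_weight]. *)
  set (L := fun f => RInt (fun s => density s * f s) 0 1 -
    q * RInt (fun th => momf 0 th * B f th) 0 (PI / 2)).
  assert (Hin : forall th y, 0 <= y <= 1 -> 0 <= (1 - y ^ 2) * sin th ^ 2 <= 1).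
  { intros th y Hy. assert (Hs := SIN_bound th). assert (0 <= sin th ^ 2 <= 1) by nra.
    assert (0 <= 1 - y ^ 2 <= 1) by nra. split; [apply Rmult_le_pos; lra|].
    rewrite <- (Rmult_1_l 1). apply Rmult_le_compat; lra. }
  assert (HfB : forall (f : R -> R) (th y : R), (forall x, 0 <= x <= 1 -> continuous f x) -> 0 <=
    y <= 1 ->
    continuous (fun y => f ((1 - y ^ 2) * sin th ^ 2)) y).
  { intros f th y Hf Hy. apply (cont_comp (fun y => (1 - y ^ 2) * sin th ^ 2) f); [cont|auto]. }
  assert (HB : forall (f : R -> R) (th : R), (forall x, 0 <= x <= 1 -> continuous f x) ->
    continuous (B f) th).
  { intros f th Hf. apply (RInt_param_continuous (fun th y => f ((1 - y ^ 2) * sin th ^ 2))).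
    - lra.
    - intros y Hy. apply (continuity_1d_2d_pt_comp f (fun th y => (1 - y ^ 2) * sin th ^ 2)).
      + apply continuity_pt_filterlim. apply Hf, Hin, Hy.
      + cont2.
    - intros y. apply ex_RInt_cont; [lra|]. auto. }
  assert (HL : L (power_kernel c) = 0).
  { assert (Hpc : forall s, 0 <= s <= 1 -> continuous (power_kernel c) s).
    { intros s Hs. apply power_kernel_continuous. assert (0 <= c * s) by (apply Rmult_le_pos;
      lra). lra. }
    destruct (power_kernel_lipschitz c Hc) as [A HA].
    assert (Hdf : forall f : R -> R, (forall x, 0 <= x <= 1 -> continuous f x) ->
      forall s, 0 <= s <= 1 -> continuous (fun s => density s * f s) s).
    { intros f Hf s Hs. apply cont_mult; [now apply density_continuous|auto]. }
    assert (HmB : forall f : R -> R, (forall x, 0 <= x <= 1 -> continuous f x) ->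
      forall th, continuous (fun th => momf 0 th * B f th) th).
    { intros f Hf th. apply cont_mult; [apply Hms|now apply HB]. }
    apply (functional_eq_0 L (RInt (fun s => Rabs (density s)) 0 1 +
      Rabs q * RInt (fun th => Rabs (momf 0 th)) 0 (PI / 2))) with (A := A); [| | | | |easy|easy].
    - intros f g Hf Hg. unfold L.
      rewrite (RInt_ext_le (fun s => density s * (f s + g s)) (fun s => density s * f s + density
        s * g s))
        by (lra || (intros; req; ring)).
      rewrite RInt_plus_cont by (lra || auto).
      rewrite (RInt_ext_le (fun th => momf 0 th * B (fun x => f x + g x) th)
        (fun th => momf 0 th * B f th + momf 0 th * B g th)).
      + rewrite RInt_plus_cont by (lra || auto). req; ring.
      + lra.
      + intros th _. unfold B. rewrite RInt_plus_cont by (lra || auto). req; ring.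
    - intros a f Hf. unfold L.
      rewrite (RInt_ext_le (fun s => density s * (a * f s)) (fun s => a * (density s * f s)))
        by (lra || (intros; req; ring)).
      rewrite RInt_scal_cont by (lra || auto).
      rewrite (RInt_ext_le (fun th => momf 0 th * B (fun x => a * f x) th)
        (fun th => a * (momf 0 th * B f th))).
      + rewrite RInt_scal_cont by (lra || auto). req; ring.
      + lra.
      + intros th _. unfold B. rewrite RInt_scal_cont by (lra || auto). req; ring.
    - intros f g Hfg. unfold L. f_equal; [|f_equal].
      + apply RInt_ext_le; [lra|]. intros; now rewrite Hfg.
      + apply RInt_ext_le; [lra|]. intros; f_equal. apply RInt_ext_le; [lra|].
        intros; now rewrite Hfg.
    - intros f e Hf He. unfold L.
      eapply Rle_trans; [apply Rabs_triang|]. rewrite Rabs_Ropp, Rabs_mult, Rmult_plus_distr_r.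
      apply Rplus_le_compat; [apply abs_RInt_mult_le; auto using density_continuous; lra|].
      rewrite Rmult_assoc. apply Rmult_le_compat_l; [apply Rabs_pos|].
      apply abs_RInt_mult_le; [lra|auto|auto|].
      intros th _. unfold B. replace e with ((1 - 0) * e) by ring.
      apply abs_RInt_le_const; [lra|apply ex_RInt_cont; [lra|auto]|auto].
    - intros n. unfold L. rewrite density_moments.
      rewrite (RInt_ext_le _ (fun th => (k ^ n / d n) * moment_integrand k fam m n th)); [|lra|].
      + rewrite RInt_scal_cont; [|lra|intros; now apply moment_integrand_continuous].
        fold (mom n). unfold q.
        assert (Hp := binom_weight_pos k n (proj1 hk)). req; field. split; [lra|now apply
          moment_0_neq_0].
      + intros th _. unfold B.
        rewrite (RInt_ext_le _ (fun y => (sin th ^ 2) ^ n * (1 - y ^ 2) ^ n))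
          by (lra || (intros; rewrite Rpow_mult_distr; req; ring)).
        rewrite RInt_scal_cont by (lra || (intros; cont)).
        rewrite (wallis_binom_weight k n (proj1 hk)). unfold moment_integrand.
        rewrite <- pow_mult, (pow_add _ (2 * n) 1), Nat.mul_0_r, Nat.add_0_l. req; ring. }
  unfold L in HL. apply Rminus_diag_uniq in HL. rewrite HL. f_equal.
  apply RInt_ext_le; [lra|]. intros th _. unfold B. rewrite RInt_pker_abel; [easy|easy|].
  apply pow2_ge_0.
Qed.

(** At 0 the density is d_0 psi_0 = 1. This normalization is what fixes the scale of the eigenvalue
    in the limit. *)
Lemma density_near_0 : exists A, 0 <= A /\ forall s, 0 <= s <= 1 -> Rabs (density s - 1) <= A * s.
Proof.
  destruct (binom_weight_decay k hk) as [rho [Md [Hrho Hd]]]. assert (Hal := alpha_01 k fam hk).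
  assert (Hab := gen_fun_abs d rho Md Hrho Hd psi (eigvec_l2 k fam hk m)).
  assert (Hab1 := proj1 (ex_series_incr_1 _) Hab).
  set (A := Series (fun n => Rabs (d (S n) * psi (S n)))).
  assert (HA : 0 <= A) by (apply Series_nonneg; [intros; apply Rabs_pos|exact Hab1]).
  exists (A + 1). split; [lra|]. intros s Hs.
  assert (Hgen : Rabs (gen_fun d psi s - 1) <= A * s).
  { unfold gen_fun. rewrite Series_incr_1.
    2:{ apply ex_series_abs_le with (2 := Hab). intros n. now apply gen_fun_term_le. }
    rewrite binom_weight_0, eigvec_0 by easy. replace (1 * 1 * s ^ 0 + _ - 1) with
      (Series (fun n => d (S n) * psi (S n) * s ^ S n)) by (simpl; ring).
    rewrite Rmult_comm. unfold A. rewrite <- Series_scal_l.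
    assert (Hle : forall n, Rabs (d (S n) * psi (S n) * s ^ S n) <=
      s * Rabs (d (S n) * psi (S n))).
    { intros n. rewrite Rabs_mult, Rmult_comm. apply Rmult_le_compat_r; [apply Rabs_pos|].
      rewrite Rabs_pos_eq by (apply pow_le; lra). simpl.
      rewrite <- (Rmult_1_r s) at 3. apply Rmult_le_compat_l; [lra|].
      rewrite <- (pow1 n). apply pow_incr; lra. }
    assert (Hex := ex_series_scal_R s _ Hab1).
    eapply Rle_trans; [apply Series_Rabs|].
    - apply ex_series_abs_le with (2 := Hex). intros n. rewrite Rabs_Rabsolu. apply Hle.
    - apply Series_le; [|exact Hex]. intros n. split; [apply Rabs_pos|apply Hle]. }
  unfold density. set (g := gen_fun d psi s) in *.
  replace (weight al s * g - 1) with (weight al s * (g - 1) + - (al * s)) by (unfold weight; ring).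
  eapply Rle_trans; [apply Rabs_triang|]. rewrite Rabs_Ropp, Rabs_mult.
  assert (Hw := weight_01 al ltac:(lra) s Hs).
  rewrite (Rabs_pos_eq (weight al s)), (Rabs_pos_eq (al * s)) by (lra || (apply Rmult_le_pos; lra)).
  assert (H1 : weight al s * Rabs (g - 1) <= 1 * (A * s)).
  { apply Rmult_le_compat; try lra; [apply Rabs_pos]. }
  assert (al * s <= 1 * s) by (apply Rmult_le_compat_r; lra). lra.
Qed.

(** The kernel c (1 + c s)^(-3/2) has mass 2 - 2 / sqrt(1 + c) and concentrates at 0, so the limit
    is twice the density at 0. The error is controlled by c s (1 + c s)^(-3/2) <= (1 + c s)^(-1/2),
    whose integral is of order 1 / sqrt(c). *)
Lemma density_pker_limit : exists A, forall c, 0 < c ->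
  Rabs (c * RInt (fun s => density s * power_kernel c s) 0 1 - 2) <= A / sqrt c.
Proof.
  destruct density_near_0 as [A [HA0 HA]]. exists (2 + 2 * A). intros c Hc.
  assert (Hpos : forall s, 0 <= s <= 1 -> 0 < 1 + c * s).
  { intros s Hs. assert (0 <= c * s) by (apply Rmult_le_pos; lra). lra. }
  assert (Hpc : forall s, 0 <= s <= 1 -> continuous (power_kernel c) s).
  { intros s Hs. apply power_kernel_continuous. auto. }
  assert (Hsq : 0 < sqrt c) by now apply sqrt_lt_R0.
  assert (Hs1 : sqrt c < sqrt (1 + c)) by (apply sqrt_lt_1_alt; lra).
  assert (I1 : RInt (fun s => c * power_kernel c s) 0 1 = 2 - 2 / sqrt (1 + c)).
  { apply is_RInt_unique. set (F := fun s => - 2 / sqrt (1 + c * s)).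
    replace (2 - 2 / sqrt (1 + c)) with (minus (F 1) (F 0)).
    - apply (is_RInt_derive (V := R_CompleteNormedModule) F).
      + intros x Hx. rewrite Rmin_left, Rmax_right in Hx by lra.
        assert (H := Hpos x Hx). assert (Hq := sqrt_lt_R0 _ H). unfold F, power_kernel. auto_derive.
        * split; [easy|]. split; [lra|easy].
        * assert (E := sqrt_sqrt _ (Rlt_le _ _ H)). set (q := sqrt (1 + c * x)) in *. rewrite <- E.
          clearbody q. field. lra.
      + intros x Hx. rewrite Rmin_left, Rmax_right in Hx by lra.
        apply cont_mult; [cont|auto].
    - change (F 1 - F 0 = 2 - 2 / sqrt (1 + c)). unfold F.
      rewrite Rmult_0_r, Rplus_0_r, sqrt_1, Rmult_1_r. field. lra. }
  assert (I2 : RInt (fun s => / sqrt (1 + c * s)) 0 1 = 2 / c * (sqrt (1 + c) - 1)).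
  { apply is_RInt_unique. set (F := fun s => 2 / c * sqrt (1 + c * s)).
    replace (2 / c * (sqrt (1 + c) - 1)) with (minus (F 1) (F 0)).
    - apply (is_RInt_derive (V := R_CompleteNormedModule) F).
      + intros x Hx. rewrite Rmin_left, Rmax_right in Hx by lra.
        assert (H := Hpos x Hx). assert (Hq := sqrt_lt_R0 _ H). unfold F. auto_derive.
        * easy.
        * field. lra.
      + intros x Hx. rewrite Rmin_left, Rmax_right in Hx by lra.
        assert (H := Hpos x Hx). assert (Hq := sqrt_lt_R0 _ H). cont. lra.
    - change (F 1 - F 0 = 2 / c * (sqrt (1 + c) - 1)). unfold F.
      rewrite Rmult_0_r, Rplus_0_r, sqrt_1, Rmult_1_r. ring. }
  assert (Hd : forall s, 0 <= s <= 1 -> continuous density s) by apply density_continuous.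
  assert (E : c * RInt (fun s => density s * power_kernel c s) 0 1 - 2 =
    RInt (fun s => c * power_kernel c s * (density s - 1)) 0 1 - 2 / sqrt (1 + c)).
  { rewrite <- RInt_scal_cont by (lra || (intros s Hs; specialize (Hd s Hs);
      specialize (Hpc s Hs); cont)).
    rewrite (RInt_ext_le (fun s => c * (density s * power_kernel c s))
      (fun s => c * power_kernel c s * (density s - 1) + c * power_kernel c s)) by (lra ||
        (intros; req; ring)).
    rewrite RInt_plus_cont by (lra || (intros s Hs; specialize (Hd s Hs);
      specialize (Hpc s Hs); cont)).
    rewrite I1. ring. }
  rewrite E. clear E.
  assert (J : Rabs (RInt (fun s => c * power_kernel c s * (density s - 1)) 0 1) <=
    A * (2 / c * (sqrt (1 + c) - 1))).
  { rewrite <- I2, <- RInt_scal_cont; [|lra|].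
    2:{ intros s Hs. assert (H := Hpos s Hs). assert (Hq := sqrt_lt_R0 _ H). cont. lra. }
    eapply Rle_trans; [apply abs_RInt_le; [lra|]|].
    { apply ex_RInt_cont; [lra|]. intros s Hs. specialize (Hd s Hs). specialize (Hpc s Hs). cont. }
    apply RInt_le; [lra| | |].
    - apply ex_RInt_cont; [lra|]. intros s Hs. specialize (Hd s Hs). specialize (Hpc s Hs). cont.
    - apply ex_RInt_cont; [lra|]. intros s Hs. assert (H := Hpos s Hs).
      assert (Hq := sqrt_lt_R0 _ H). cont. lra.
    - intros s Hs. assert (H := Hpos s ltac:(lra)). assert (Hq := sqrt_lt_R0 _ H).
      assert (Hds := HA s ltac:(lra)).
      assert (Hk0 : 0 < power_kernel c s).
      { unfold power_kernel. apply Rinv_0_lt_compat. now apply Rmult_lt_0_compat. }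
      rewrite Rabs_mult, (Rabs_pos_eq (c * power_kernel c s)) by (apply Rmult_le_pos; lra).
      apply Rle_trans with (c * power_kernel c s * (A * s)).
      + apply Rmult_le_compat_l; [apply Rmult_le_pos; lra|easy].
      + replace (c * power_kernel c s * (A * s)) with (A * (c * s * power_kernel c s)) by ring.
        apply Rmult_le_compat_l; [easy|]. unfold power_kernel.
        rewrite Rinv_mult, <- Rmult_assoc. rewrite <- (Rmult_1_l (/ sqrt _)) at 2.
        apply Rmult_le_compat_r; [left; now apply Rinv_0_lt_compat|].
        apply (Rle_div_l (c * s)); lra. }
  eapply Rle_trans; [apply Rabs_triang|]. rewrite Rabs_Ropp.
  assert (H2 : Rabs (2 / sqrt (1 + c)) <= 2 / sqrt c).
  { rewrite Rabs_pos_eq by (apply Rdiv_le_0_compat; lra).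
    apply Rmult_le_compat_l; [lra|]. apply Rinv_le_contravar; lra. }
  assert (H3 : 2 / c * (sqrt (1 + c) - 1) <= 2 / sqrt c).
  { assert (Hcc := sqrt_sqrt c (Rlt_le _ _ Hc)). assert (H1c := sqrt_sqrt (1 + c) ltac:(lra)).
    assert (sqrt (1 + c) - 1 <= sqrt c) by nra.
    apply Rle_trans with (2 / c * sqrt c).
    - apply Rmult_le_compat_l; [apply Rdiv_le_0_compat; lra|easy].
    - right. rewrite <- Hcc at 1. field. lra. }
  assert (H4 := Rmult_le_compat_l A _ _ HA0 H3).
  replace ((2 + 2 * A) / sqrt c) with (A * (2 / sqrt c) + 2 / sqrt c) by (field; lra). lra.
Qed.

End Eigenvalue.

(** * The transforms along the imaginary axis and the value of the eigenvalue *)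

Section Imaginary.

Variables (k : R) (fam : bool) (m : nat).
Hypothesis hk : 0 < k < 1.

Local Notation al := (alpha k fam).
Local Notation be := (beta k fam).
Local Notation fa := (afun k fam).
Local Notation fb := (bfun k fam).
Local Notation phi := (mode k fam m).
Local Notation mom := (moment k fam m).
Local Notation momf := (moment_integrand k fam m).
Local Notation r := (freq k fam m).

Definition comodulus : R := sqrt (1 - k ^ 2).

Lemma comodulus_sqr : comodulus ^ 2 = 1 - k ^ 2.
Proof. apply pow2_sqrt. nra. Qed.

Lemma comodulus_01 : 0 < comodulus < 1.
Proof.
  unfold comodulus. split; [apply sqrt_lt_R0; nra|]. rewrite <- sqrt_1 at 2. apply sqrt_lt_1_alt.
    nra.
Qed.

(* The counterparts of [afun] and [bfun] on the imaginary axis: with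
   [w = ellF comodulus s] one has [sn(i w) = i tan s], [cn(i w) = 1 / cos s] and
   [dn(i w) = Delta comodulus s / cos s]. *)
Definition imag_a (s : R) : R := if fam then Delta comodulus s else 1.
Definition imag_b (s : R) : R := if fam then 1 else Delta comodulus s.
(** Equal to cos^2 s (1 + c sin^2 th) with c = k^2 tan^2 s: up to cos^2 s, the common denominator of
    the addition formulas at u + i w. *)
Definition den (s th : R) : R := cos s ^ 2 + k ^ 2 * sin s ^ 2 * sin th ^ 2.

Lemma imag_a_pos s : 0 < imag_a s.
Proof. unfold imag_a. destruct fam; [apply Delta_pos, comodulus_01|lra]. Qed.

Lemma imag_b_pos s : 0 < imag_b s.
Proof. unfold imag_b. destruct fam; [lra|apply Delta_pos, comodulus_01]. Qed.

Lemma imag_a_b s : Delta comodulus s = imag_a s * imag_b s.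
Proof. unfold imag_a, imag_b. destruct fam; ring. Qed.

Lemma imag_a_sqr s : imag_a s ^ 2 = 1 - (1 - al) * sin s ^ 2.
Proof.
  unfold imag_a, alpha. destruct fam; [|ring]. rewrite Delta_sqr, comodulus_sqr by apply
    comodulus_01. ring.
Qed.

Lemma imag_b_sqr s : imag_b s ^ 2 = 1 - (1 - be) * sin s ^ 2.
Proof.
  unfold imag_b, beta. destruct fam; [ring|]. rewrite Delta_sqr, comodulus_sqr by apply
    comodulus_01. ring.
Qed.

Lemma imag_a_derive s : is_derive imag_a s (- (1 - al) * sin s * cos s / imag_a s).
Proof.
  unfold imag_a, alpha. destruct fam.
  - rewrite <- comodulus_sqr. apply Delta_derive, comodulus_01.
  - replace (- (1 - 1) * sin s * cos s / 1) with 0 by field. apply (is_derive_const (V :=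
    R_NormedModule)).
Qed.

Lemma imag_b_derive s : is_derive imag_b s (- (1 - be) * sin s * cos s / imag_b s).
Proof.
  unfold imag_b, beta. destruct fam.
  - replace (- (1 - 1) * sin s * cos s / 1) with 0 by field. apply (is_derive_const (V :=
    R_NormedModule)).
  - rewrite <- comodulus_sqr. apply Delta_derive, comodulus_01.
Qed.

Lemma den_pos s th : - (PI / 2) < s < PI / 2 -> 0 < den s th.
Proof.
  intros Hs. assert (0 < cos s) by (apply cos_gt_0; lra). unfold den.
  assert (0 < cos s ^ 2) by now apply pow_lt.
  assert (0 <= (k * sin s * sin th) ^ 2) by apply pow2_ge_0. nra.
Qed.

Lemma den_integral_derive g s :
  (forall th : R, continuous g th) -> - (PI / 2) < s < PI / 2 ->
  is_derive (fun s => RInt (fun th => g th * / den s th) 0 (PI / 2)) s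
   (RInt (fun th => g th * (2 * cos s * sin s * (1 - k ^ 2 * sin th ^ 2) * / den s th ^ 2))
      0 (PI / 2)).
Proof.
  intros Hg Hs. assert (HP := PI2_pos).
  assert (Hd : forall u th, - (PI / 2) < u < PI / 2 ->
    is_derive (fun u => g th * / den u th) u
      (g th * (2 * cos u * sin u * (1 - k ^ 2 * sin th ^ 2) * / den u th ^ 2))).
  { intros u th Hu. assert (H := den_pos u th Hu). unfold den in *. auto_derive.
    - simpl in H. lra.
    - simpl in *. field. lra. }
  assert (Hloc : locally s (fun u => - (PI / 2) < u < PI / 2)).
  { apply (open_and (fun u => - (PI / 2) < u) (fun u => u < PI / 2));
      [apply open_gt|apply open_lt|easy]. }
  rewrite (RInt_ext_le _ (fun th => Derive (fun u => g th * / den u th) s)).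
  2: lra.
  2:{ intros th _. symmetry. now apply is_derive_unique, Hd. }
  apply (is_derive_RInt_param (fun s th => g th * / den s th)).
  - revert Hloc. apply filter_imp. intros u Hu th _. eexists. now apply Hd.
  - intros th _.
    apply (continuity_2d_pt_ext_loc
      (fun u th => g th * (2 * cos u * sin u * (1 - k ^ 2 * sin th ^ 2) * / den u th ^ 2))).
    + destruct Hloc as [e He]. exists e. intros u v Hu _. symmetry.
      apply is_derive_unique, Hd, He, Hu.
    + unfold den. cont2. apply Rgt_not_eq, pow_lt. now apply (den_pos s th).
  - revert Hloc. apply filter_imp. intros u Hu. apply ex_RInt_cont; [lra|].
    intros th _. assert (H := den_pos u th Hu). unfold den in *. cont. lra.
Qed.

Lemma RInt_derive_eq_0 (W dW : R -> R) :
  (forall th, 0 <= th <= PI / 2 -> is_derive W th (dW th)) ->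
  (forall th, 0 <= th <= PI / 2 -> continuous dW th) ->
  W 0 = 0 -> W (PI / 2) = 0 -> RInt dW 0 (PI / 2) = 0.
Proof.
  intros HW Hc H0 H1. assert (HP := PI2_pos). apply is_RInt_unique.
  replace 0 with (minus (W (PI / 2)) (W 0)) at 2.
  2:{ rewrite H0, H1. change (0 - 0 = 0). ring. }
  apply (is_RInt_derive (V := R_CompleteNormedModule) W); rewrite Rmin_left, Rmax_right by lra;
    easy.
Qed.

(** The derivative of the mode with respect to u, not th. *)
Definition dmode (th : R) : R := r * cos (r * ellF k th).
Definition even_integrand (th : R) : R := fb th * dmode th * / Delta k th.

(* Up to constant factors the two kernels are the imaginary and real parts of
   [b(u + i w)], so the Cauchy-Riemann equations relate the two transforms. *)
Definition odd_transform (s : R) : R := sin s * imag_a s * RInt (fun th => momf 0 th * / den s th)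
  0 (PI / 2).
Definition even_transform (s : R) : R := cos s * imag_b s * RInt (fun th => even_integrand th * /
  den s th) 0 (PI / 2).

Lemma dmode_derive th : is_derive dmode th (- r ^ 2 * phi th / Delta k th).
Proof.
  assert (H := Delta_pos k th hk). assert (H1 := ellF_derive k th hk).
  unfold dmode. auto_derive; [now exists (/ Delta k th)|].
  replace (Derive (fun x => ellF k x) th) with (/ Delta k th);
    [unfold mode; field; lra|symmetry; now apply is_derive_unique].
Qed.

Lemma even_integrand_continuous th : continuous even_integrand th.
Proof.
  assert (H := ellF_continuous k). assert (H1 := bfun_continuous k fam hk).
  assert (H2 := fun th => Delta_inv_continuous k th hk).
  assert (H3 : continuous dmode th).
  { apply (ex_derive_continuous dmode). eexists. apply dmode_derive. }
  unfold even_integrand. cont.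
Qed.

Lemma cos_afun_bfun th : cos th = fa th * fb th / Delta k th.
Proof.
  rewrite <- (is_derive_unique _ _ _ (is_derive_sin th)).
  apply is_derive_unique, sin_derive, hk.
Qed.

Lemma bfun_mode_den_derive s th : - (PI / 2) < s < PI / 2 ->
  is_derive (fun th => fb th * phi th * / den s th) th
   ((- be * sin th * fa th * phi th + fb th * dmode th) / Delta k th * / den s th -
    fb th ^ 2 * phi th * (2 * k ^ 2 * sin s ^ 2 * sin th * fa th / Delta k th) * / den s th ^ 2).
Proof.
  intros Hs. assert (H0 := Delta_pos k th hk). assert (HN := den_pos s th Hs).
  assert (Hb := bfun_derive k fam hk th). assert (Hp := mode_derive k fam hk m th).
  fold (dmode th) in Hp.
  unfold den in *. auto_derive.
  - split; [eexists; eassumption|]. split; [eexists; eassumption|]. split; [|easy].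
    simpl in HN. lra.
  - replace (Derive (fun x => fb x) th) with (- be * sin th * fa th / Delta k th)
      by (symmetry; now apply is_derive_unique).
    replace (Derive (fun x => phi x) th) with (dmode th / Delta k th)
      by (symmetry; now apply is_derive_unique).
    rewrite (cos_afun_bfun th). simpl in *. field. lra.
Qed.

Lemma afun_dmode_den_derive s th : - (PI / 2) < s < PI / 2 ->
  is_derive (fun th => sin th * fa th * dmode th * / den s th) th
   (((fa th ^ 2 - al * sin th ^ 2) * fb th * dmode th - r ^ 2 * sin th * fa th * phi th)
      / Delta k th * / den s th -
    sin th ^ 2 * fa th ^ 2 * dmode th * (2 * k ^ 2 * sin s ^ 2 * fb th / Delta k th) *
      / den s th ^ 2).
Proof.
  intros Hs. assert (H0 := Delta_pos k th hk). assert (HN := den_pos s th Hs).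
  assert (Ha := afun_derive k fam hk th). assert (Hp := dmode_derive th).
  unfold den in *. auto_derive.
  - split; [eexists; eassumption|]. split; [eexists; eassumption|]. split; [|easy].
    simpl in HN. lra.
  - replace (Derive (fun x => fa x) th) with (- al * sin th * fb th / Delta k th)
      by (symmetry; now apply is_derive_unique).
    replace (Derive (fun x => dmode x) th) with (- r ^ 2 * phi th / Delta k th)
      by (symmetry; now apply is_derive_unique).
    rewrite (cos_afun_bfun th). simpl in *. field. lra.
Qed.


(** Under the integral sign the two sides differ by the th-derivative of a multiple of b sin(r u) /
    den, which vanishes at 0 and, by [bfun_mode_PI2], at pi / 2. *)
Lemma odd_transform_derive s : - (PI / 2) < s < PI / 2 ->
  is_derive odd_transform s (even_transform s / (be * Delta comodulus s)).
Proof.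
  intros Hs. assert (HP := PI2_pos).
  assert (Hm := moment_integrand_continuous k fam hk m 0). assert (Hh := even_integrand_continuous).
  assert (Hbe := beta_01 k fam hk). assert (Hpa := imag_a_pos s). assert (Hpb := imag_b_pos s).
  assert (Hden : forall th, continuous (fun th => / den s th) th).
  { intros th. assert (H := den_pos s th Hs). unfold den in *. cont. lra. }
  set (G := fun th => momf 0 th * (2 * cos s * sin s * (1 - k ^ 2 * sin th ^ 2) * / den s th ^ 2)).
  assert (HG : forall th, continuous G th).
  { intros th. assert (H := den_pos s th Hs). unfold G, den in *. cont.
    apply Rgt_not_eq, pow_lt. lra. }
  assert (HJ := den_integral_derive (momf 0) s Hm Hs). fold G in HJ.
  assert (HS : is_derive (fun s => sin s * imag_a s) s
    (cos s * imag_a s - (1 - al) * sin s ^ 2 * cos s / imag_a s)).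
  { assert (Hp := imag_a_derive s). auto_derive; [eexists; eassumption|].
    replace (Derive (fun x => imag_a x) s) with (- (1 - al) * sin s * cos s / imag_a s)
      by (symmetry; now apply is_derive_unique).
    field. lra. }
  set (q := cos s * imag_a s - (1 - al) * sin s ^ 2 * cos s / imag_a s) in *.
  assert (HD := is_derive_mult _ _ _ _ _ HS HJ Rmult_comm).
  assert (E : q * RInt (fun th => momf 0 th * / den s th) 0 (PI / 2) +
    (sin s * imag_a s * RInt G 0 (PI / 2) +
     - (cos s / (be * imag_a s)) * RInt (fun th => even_integrand th * / den s th) 0 (PI / 2)) = 0).
  { rewrite <- !RInt_scal_cont by (lra || (intros; cont)).
    rewrite <- RInt_plus_cont by (lra || (intros; cont)).
    rewrite <- RInt_plus_cont by (lra || (intros; cont)).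
    apply (RInt_derive_eq_0 (fun th => - (cos s / (be * imag_a s)) * (fb th * phi th * / den s
      th))).
    - intros th _.
      replace (_ + _) with (- (cos s / (be * imag_a s)) *
       ((- be * sin th * fa th * phi th + fb th * dmode th) / Delta k th * / den s th -
        fb th ^ 2 * phi th * (2 * k ^ 2 * sin s ^ 2 * sin th * fa th / Delta k th) * / den s th ^
          2)).
      { apply (is_derive_scal (fun th => fb th * phi th * / den s th)).
        now apply bfun_mode_den_derive. }
      assert (Hd := den_pos s th Hs). assert (He := Delta_pos k th hk).
      (* After removal of the common factors a polynomial identity in sin^2 s and sin^2 th remains;
         it uses k^2 = alpha beta. *)
      assert (Key : be * ((imag_a s ^ 2 - (1 - al) * sin s ^ 2) * den s th +
          2 * sin s ^ 2 * imag_a s ^ 2 * (1 - k ^ 2 * sin th ^ 2)) =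
        be * den s th + 2 * k ^ 2 * sin s ^ 2 * fb th ^ 2).
      { rewrite imag_a_sqr, bfun_sqr by easy. unfold den. rewrite <- (alpha_beta k fam).
        assert (Hc : cos s ^ 2 = 1 - sin s ^ 2).
        { assert (H := sin2_cos2 s). unfold Rsqr in H. lra. }
        rewrite Hc. ring. }
      unfold q, G, moment_integrand, even_integrand. simpl (2 * 0 + 1)%nat. rewrite pow_1.
      apply Rminus_diag_uniq_sym.
      transitivity (cos s * sin th * fa th * phi th / (be * imag_a s * Delta k th * den s th ^ 2) *
        (be * ((imag_a s ^ 2 - (1 - al) * sin s ^ 2) * den s th +
          2 * sin s ^ 2 * imag_a s ^ 2 * (1 - k ^ 2 * sin th ^ 2)) -
        (be * den s th + 2 * k ^ 2 * sin s ^ 2 * fb th ^ 2))).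
      + field. lra.
      + rewrite Key. ring.
    - intros th _. cont.
    - rewrite mode_0. ring.
    - transitivity (- (cos s / (be * imag_a s)) * / den s (PI / 2) * (fb (PI / 2) * phi (PI / 2)));
        [ring|]. rewrite bfun_mode_PI2 by easy. ring. }
  unfold odd_transform. match type of HD with is_derive _ _ ?x =>
    replace (even_transform s / (be * Delta comodulus s)) with x; [exact HD|] end.
  set (J := RInt (fun th => momf 0 th * / den s th) 0 (PI / 2)) in *.
  set (J1 := RInt G 0 (PI / 2)) in *.
  change (q * J + sin s * imag_a s * J1 = even_transform s / (be * Delta comodulus s)).
  unfold even_transform. set (J2 := RInt (fun th => even_integrand th * / den s th) 0 (PI / 2)) in
    *.
  rewrite imag_a_b.
  replace (cos s * imag_b s * J2 / (be * (imag_a s * imag_b s))) with (cos s / (be * imag_a s) * J2)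
    by (field; lra).
  lra.
Qed.

(** As for the odd transform, with the exact derivative of t a times [dmode] over den. The factor
    r^2 comes from the second derivative of the mode, and the boundary term at pi / 2 vanishes by
    [afun_dmode_PI2]. *)
Lemma even_transform_derive s : - (PI / 2) < s < PI / 2 ->
  is_derive even_transform s (be * r ^ 2 * odd_transform s / Delta comodulus s).
Proof.
  intros Hs. assert (HP := PI2_pos).
  assert (Hm := moment_integrand_continuous k fam hk m 0). assert (Hh := even_integrand_continuous).
  assert (Hbe := beta_01 k fam hk). assert (Hpa := imag_a_pos s). assert (Hpb := imag_b_pos s).
  assert (Hden : forall th, continuous (fun th => / den s th) th).
  { intros th. assert (H := den_pos s th Hs). unfold den in *. cont. lra. }
  set (G := fun th => even_integrand th * (2 * cos s * sin s * (1 - k ^ 2 * sin th ^ 2) * / den s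
    th ^ 2)).
  assert (HG : forall th, continuous G th).
  { intros th. assert (H := den_pos s th Hs). unfold G, den in *. cont.
    apply Rgt_not_eq, pow_lt. lra. }
  assert (HJ := den_integral_derive even_integrand s Hh Hs). fold G in HJ.
  assert (HS : is_derive (fun s => cos s * imag_b s) s
    (- sin s * imag_b s - (1 - be) * sin s * cos s ^ 2 / imag_b s)).
  { assert (Hp := imag_b_derive s). auto_derive; [eexists; eassumption|].
    replace (Derive (fun x => imag_b x) s) with (- (1 - be) * sin s * cos s / imag_b s)
      by (symmetry; now apply is_derive_unique).
    field. lra. }
  set (q := - sin s * imag_b s - (1 - be) * sin s * cos s ^ 2 / imag_b s) in *.
  assert (HD := is_derive_mult _ _ _ _ _ HS HJ Rmult_comm).
  assert (E : q * RInt (fun th => even_integrand th * / den s th) 0 (PI / 2) +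
    (cos s * imag_b s * RInt G 0 (PI / 2) +
     - (be * r ^ 2 * sin s / imag_b s) * RInt (fun th => momf 0 th * / den s th) 0 (PI / 2)) = 0).
  { rewrite <- !RInt_scal_cont by (lra || (intros; cont)).
    rewrite <- RInt_plus_cont by (lra || (intros; cont)).
    rewrite <- RInt_plus_cont by (lra || (intros; cont)).
    apply (RInt_derive_eq_0 (fun th => be * sin s / imag_b s * (sin th * fa th * dmode th * / den
      s th))).
    - intros th _.
      replace (_ + _) with (be * sin s / imag_b s *
       (((fa th ^ 2 - al * sin th ^ 2) * fb th * dmode th - r ^ 2 * sin th * fa th * phi th)
          / Delta k th * / den s th -
        sin th ^ 2 * fa th ^ 2 * dmode th * (2 * k ^ 2 * sin s ^ 2 * fb th / Delta k th) *
          / den s th ^ 2)).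
      { apply (is_derive_scal (fun th => sin th * fa th * dmode th * / den s th)).
        now apply afun_dmode_den_derive. }
      assert (Hd := den_pos s th Hs). assert (He := Delta_pos k th hk).
      assert (Key : (- imag_b s ^ 2 - (1 - be) * cos s ^ 2) * den s th +
          2 * cos s ^ 2 * imag_b s ^ 2 * (1 - k ^ 2 * sin th ^ 2) =
        be * ((fa th ^ 2 - al * sin th ^ 2) * den s th -
          2 * k ^ 2 * sin s ^ 2 * sin th ^ 2 * fa th ^ 2)).
      { rewrite imag_b_sqr, afun_sqr by easy. unfold den. rewrite <- (alpha_beta k fam).
        assert (Hc : cos s ^ 2 = 1 - sin s ^ 2).
        { assert (H := sin2_cos2 s). unfold Rsqr in H. lra. }
        rewrite Hc. ring. }
      unfold q, G, moment_integrand, even_integrand. simpl (2 * 0 + 1)%nat. rewrite pow_1.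
      apply Rminus_diag_uniq_sym.
      transitivity (fb th * dmode th * sin s / (imag_b s * Delta k th * den s th ^ 2) *
        ((- imag_b s ^ 2 - (1 - be) * cos s ^ 2) * den s th +
          2 * cos s ^ 2 * imag_b s ^ 2 * (1 - k ^ 2 * sin th ^ 2) -
        be * ((fa th ^ 2 - al * sin th ^ 2) * den s th -
          2 * k ^ 2 * sin s ^ 2 * sin th ^ 2 * fa th ^ 2))).
      + field. lra.
      + rewrite Key. ring.
    - intros th _. cont.
    - rewrite sin_0. ring.
    - transitivity (be * sin s / imag_b s * (sin (PI / 2) * r * / den s (PI / 2)) *
        (fa (PI / 2) * cos (r * ellF k (PI / 2)))); [unfold dmode; ring|].
      rewrite afun_dmode_PI2 by easy. ring. }
  unfold even_transform. match type of HD with is_derive _ _ ?x =>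
    replace (be * r ^ 2 * odd_transform s / Delta comodulus s) with x; [exact HD|] end.
  set (J := RInt (fun th => even_integrand th * / den s th) 0 (PI / 2)) in *.
  set (J1 := RInt G 0 (PI / 2)) in *.
  change (q * J + cos s * imag_b s * J1 = be * r ^ 2 * odd_transform s / Delta comodulus s).
  unfold odd_transform. set (J2 := RInt (fun th => momf 0 th * / den s th) 0 (PI / 2)) in *.
  rewrite imag_a_b.
  replace (be * r ^ 2 * (sin s * imag_a s * J2) / (imag_a s * imag_b s)) with (be * r ^ 2 * sin s
    / imag_b s * J2)
    by (field; lra).
  lra.
Qed.

(** At s = 0 the denominator is 1, and integration by parts with b' = - beta t a in u gives the
    moment. *)
Lemma even_transform_0 : even_transform 0 = be * mom 0.
Proof.
  assert (HP := PI2_pos). assert (Hs : - (PI / 2) < 0 < PI / 2) by lra.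
  assert (Hm := moment_integrand_continuous k fam hk m 0). assert (Hh := even_integrand_continuous).
  assert (Hd0 : forall th, den 0 th = 1).
  { intros th. unfold den. rewrite sin_0, cos_0. ring. }
  assert (Hpb : imag_b 0 = 1).
  { assert (H := imag_b_sqr 0). rewrite sin_0 in H. assert (H1 := imag_b_pos 0). nra. }
  unfold even_transform. rewrite cos_0, Hpb, (RInt_ext_le _ even_integrand) by
    (lra || (intros; rewrite Hd0; req; field)).
  assert (E : - be * mom 0 + RInt even_integrand 0 (PI / 2) = 0).
  { unfold moment. rewrite <- RInt_scal_cont by (lra || (intros; cont)).
    rewrite <- RInt_plus_cont by (lra || (intros; cont)).
    apply (RInt_derive_eq_0 (fun th => fb th * phi th * / den 0 th)).
    - intros th _. assert (H := bfun_mode_den_derive 0 th Hs).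
      replace (_ + _) with ((- be * sin th * fa th * phi th + fb th * dmode th) / Delta k th *
        / den 0 th - fb th ^ 2 * phi th * (2 * k ^ 2 * sin 0 ^ 2 * sin th * fa th / Delta k th) *
        / den 0 th ^ 2); [exact H|].
      rewrite Hd0, sin_0. unfold moment_integrand, even_integrand. simpl (2 * 0 + 1)%nat. rewrite
        pow_1.
      assert (He := Delta_pos k th hk). field. lra.
    - intros th _. cont.
    - rewrite mode_0. ring.
    - rewrite bfun_mode_PI2 by easy. ring. }
  lra.
Qed.

(** In w = [ellF comodulus s] the odd and even transforms Y, Z satisfy Y' = Z / beta and Z' = beta
    r^2 Y. Hence (beta r Y - e Z) exp(e r w) is constant for e = 1 and e = -1; adding the two
    resulting equations solves for Y. *)
Lemma odd_transform_sinh s : 0 < s < PI / 2 -> r * odd_transform s = mom 0 * sinh (r * ellF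
  comodulus s).
Proof.
  intros Hs. assert (Hbe := beta_01 k fam hk).
  assert (HE : forall e, e = 1 \/ e = -1 -> forall t, 0 <= t <= s ->
    is_derive (fun t => (be * r * odd_transform t - e * even_transform t) * exp (e * r * ellF
      comodulus t)) t 0).
  { intros e He t Ht. assert (Ht' : - (PI / 2) < t < PI / 2) by lra.
    assert (HY := odd_transform_derive t Ht'). assert (HZ := even_transform_derive t Ht').
    assert (HF := ellF_derive comodulus t comodulus_01). assert (HD := Delta_pos comodulus t
      comodulus_01).
    auto_derive; [repeat split; eexists; eassumption|].
    replace (Derive (fun x => odd_transform x) t) with (even_transform t / (be * Delta comodulus t))
      by (symmetry; now apply is_derive_unique).
    replace (Derive (fun x => even_transform x) t) with (be * r ^ 2 * odd_transform t / Delta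
      comodulus t)
      by (symmetry; now apply is_derive_unique).
    replace (Derive (fun x => ellF comodulus x) t) with (/ Delta comodulus t)
      by (symmetry; now apply is_derive_unique).
    destruct He as [-> | ->]; field; lra. }
  assert (HC : forall e, e = 1 \/ e = -1 ->
    be * r * odd_transform s - e * even_transform s = - e * (be * mom 0) * exp (- (e * r * ellF
      comodulus s))).
  { intros e He.
    assert (H := eq_is_derive _ 0 s (HE e He) (proj1 Hs)).
    change ((be * r * odd_transform 0 - e * even_transform 0) * exp (e * r * ellF comodulus 0) =
      (be * r * odd_transform s - e * even_transform s) * exp (e * r * ellF comodulus s)) in H.
    rewrite ellF_0, Rmult_0_r, exp_0, even_transform_0 in H.
    replace (odd_transform 0) with 0 in H by (unfold odd_transform; rewrite sin_0; ring).
    rewrite exp_Ropp. assert (Hp := exp_pos (e * r * ellF comodulus s)).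
    apply Rmult_eq_reg_r with (exp (e * r * ellF comodulus s)); [|lra].
    rewrite <- H. field. lra. }
  assert (H1 := HC 1 (or_introl eq_refl)). assert (H2 := HC (-1) (or_intror eq_refl)).
  unfold sinh. set (w := ellF comodulus s) in *.
  replace (- (1 * r * w)) with (- (r * w)) in H1 by ring.
  replace (- (-1 * r * w)) with (r * w) in H2 by ring.
  apply Rmult_eq_reg_l with be; [|lra]. lra.
Qed.

(** By [density_transform] and [odd_transform_sinh], T(s) is c times the transform of the density at
    c = k^2 tan^2 s. It tends to 2 as s tends to pi / 2, and its formula is continuous there, with w
    = K'. *)
Lemma eigval_eq : eigval k fam m =
  2 * r * (if fam then k else 1) / (k ^ 2 * sinh (r * ellK comodulus)).
Proof.
  assert (HP := PI2_pos). assert (Hr := freq_pos k fam hk m).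
  assert (Hm0 := moment_0_neq_0 k fam hk m).
  set (T := fun s => eigval k fam m * k ^ 2 * sin s * sinh (r * ellF comodulus s) * / (r * imag_a
    s)).
  destruct (density_pker_limit k fam m hk) as [A HA].
  assert (HT : forall s, 0 < s < PI / 2 -> Rabs (T s - 2) <= A * cos s * / (k * sin s)).
  { intros s Hs. assert (Hsin : 0 < sin s) by (apply sin_gt_0; lra).
    assert (Hcos : 0 < cos s) by (apply cos_gt_0; lra). assert (Hpa := imag_a_pos s).
    set (c := (k * sin s / cos s) ^ 2).
    assert (Hq : 0 < k * sin s / cos s).
    { apply Rdiv_lt_0_compat; [apply Rmult_lt_0_compat; lra|easy]. }
    assert (Hc : 0 < c) by now apply pow_lt.
    specialize (HA c Hc). unfold c in HA at 3. rewrite sqrt_pow2 in HA by lra.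
    rewrite (density_transform k fam m hk c (Rlt_le _ _ Hc)) in HA.
    rewrite (RInt_ext_le _ (fun th => cos s ^ 2 * (momf 0 th * / den s th))) in HA; [|lra|].
    2:{ intros th _. assert (Hd := den_pos s th ltac:(lra)). unfold c, den in *. req. field.
        repeat split; lra. }
    rewrite RInt_scal_cont in HA; [|lra|].
    2:{ intros th _. assert (Hd := den_pos s th ltac:(lra)).
        assert (Hm := moment_integrand_continuous k fam hk m 0). unfold den in *. cont. lra. }
    assert (HY := odd_transform_sinh s Hs). unfold odd_transform in HY.
    set (J := RInt (fun th => momf 0 th * / den s th) 0 (PI / 2)) in *.
    replace (T s) with (c * (eigval k fam m / mom 0 * (cos s ^ 2 * J))).
    - eapply Rle_trans; [exact HA|]. right. field. repeat split; lra.
    - unfold T. replace (sinh (r * ellF comodulus s)) with (r * (sin s * imag_a s * J) / mom 0)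
        by (rewrite HY; field; easy).
      unfold c. field. repeat split; try easy; lra. }
  (* This function is at most 0 to the left of pi / 2 by [HT]. If T(pi / 2) differed from 2, it
     would be positive at pi / 2 and hence nearby. *)
  assert (Hcont : continuous (fun s => Rabs (T s - 2) - A * cos s * / (k * sin s)) (PI / 2)).
  { assert (H1 : continuous imag_a (PI / 2)).
    { apply (ex_derive_continuous imag_a). eexists. apply imag_a_derive. }
    assert (H2 : forall x, continuous (fun s => sinh (r * ellF comodulus s)) x).
    { intros x. apply (cont_comp (fun s => r * ellF comodulus s) sinh).
      - assert (H := fun x => ellF_continuous comodulus x comodulus_01). cont.
      - apply (ex_derive_continuous sinh). unfold sinh. auto_derive. easy. }
    unfold T. cont.
    - assert (H := imag_a_pos (PI / 2)). apply Rgt_not_eq, Rmult_lt_0_compat; easy.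
    - rewrite sin_PI2. lra. }
  assert (HT2 : T (PI / 2) = 2).
  { apply NNPP. intros Hne.
    destruct (continuous_pos_near _ _ Hcont) as [d Hd].
    { rewrite cos_PI2. assert (0 < Rabs (T (PI / 2) - 2)) by (apply Rabs_pos_lt; lra). lra. }
    assert (Hd0 := cond_pos d).
    set (s := PI / 2 - Rmin (d / 2) (PI / 4)).
    assert (Hm1 : 0 < Rmin (d / 2) (PI / 4)) by (apply Rmin_pos; lra).
    assert (Hm2 := Rmin_l (d / 2) (PI / 4)). assert (Hm3 := Rmin_r (d / 2) (PI / 4)).
    assert (Hs1 := Hd s ltac:(unfold s; apply Rabs_def1; lra)).
    assert (Hs2 := HT s ltac:(unfold s; lra)). lra. }
  assert (Hpa2 : imag_a (PI / 2) = if fam then k else 1).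
  { assert (H := imag_a_sqr (PI / 2)). assert (H1 := imag_a_pos (PI / 2)). rewrite sin_PI2 in H.
    unfold alpha in H. destruct fam; nra. }
  unfold T in HT2. rewrite sin_PI2, ellF_PI2, Hpa2 in HT2.
  assert (Hsh : 0 < sinh (r * ellK comodulus)).
  { rewrite <- sinh_0. apply sinh_lt. apply Rmult_lt_0_compat; [easy|apply ellK_pos,
    comodulus_01]. }
  assert (Hp : 0 < (if fam then k else 1)) by (destruct fam; lra).
  set (p := if fam then k else 1) in *.
  apply Rmult_eq_reg_r with (k ^ 2 * sinh (r * ellK comodulus) * / (r * p)).
  - transitivity 2; [rewrite <- HT2; ring|field; lra].
  - apply Rgt_not_eq. apply Rmult_lt_0_compat; [apply Rmult_lt_0_compat; [nra|easy]|].
    apply Rinv_0_lt_compat. now apply Rmult_lt_0_compat.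
Qed.

End Imaginary.

(** * Identification of the eigenvalues and eigenvectors *)

(** Convexity: the mean slope of sinh on [0, a] is smaller than on [a, b]. The slopes are cosh c1
    and cosh c2 with c1 < c2. *)
Lemma sinh_ratio_increasing (a b : R) : 0 < a < b -> b * sinh a < a * sinh b.
Proof.
  intros Hab.
  destruct (MVT_cor2 sinh cosh 0 a) as [c1 [E1 H1]];
    [lra|intros; apply derivable_pt_lim_sinh|].
  destruct (MVT_cor2 sinh cosh a b) as [c2 [E2 H2]];
    [lra|intros; apply derivable_pt_lim_sinh|].
  destruct (MVT_cor2 cosh sinh c1 c2) as [c3 [E3 H3]];
    [lra|intros; apply derivable_pt_lim_cosh|].
  assert (0 < sinh c3) by (rewrite <- sinh_0; apply sinh_lt; lra).
  rewrite sinh_0 in E1.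
  assert (0 < cosh c2 - cosh c1) by (rewrite E3; apply Rmult_lt_0_compat; lra).
  assert (0 < (a * (b - a)) * (cosh c2 - cosh c1)).
  { apply Rmult_lt_0_compat; [apply Rmult_lt_0_compat; lra|easy]. }
  replace (sinh b) with (sinh a + cosh c2 * (b - a)) by lra.
  replace (sinh a) with (cosh c1 * (a - 0)) by lra. nra.
Qed.

Lemma sinh_pos x : 0 < x -> 0 < sinh x.
Proof. intros H. rewrite <- sinh_0. now apply sinh_lt. Qed.

(** The shape of the stated eigenvalues: for x = r K', exp(-x) is the nome to the power m + 1/2 or m
    + 1. *)
Lemma sinh_inv x : 0 < x -> / sinh x = 2 * exp (- x) / (1 - exp (- x) ^ 2).
Proof.
  intros H. assert (Hs := sinh_pos x H). unfold sinh in *. rewrite exp_Ropp in *.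
  assert (He := exp_pos x). set (e := exp x) in *. clearbody e.
  assert (Hi : 0 < / e) by now apply Rinv_0_lt_compat.
  assert (1 < e).
  { assert (e * / e = 1) by (field; lra). nra. }
  field. repeat split; nra.
Qed.

Lemma freq_increasing k fam m : 0 < k < 1 -> freq k fam m < freq k fam (S m).
Proof.
  intros hk. unfold freq. rewrite S_INR. apply Rmult_lt_compat_l; [|lra].
  apply Rdiv_lt_0_compat; [apply PI_RGT_0|now apply ellK_pos].
Qed.

Lemma eigval_decreasing k fam m : 0 < k < 1 -> eigval k fam (S m) < eigval k fam m.
Proof.
  intros hk. rewrite !eigval_eq by easy. assert (Hk := comodulus_01 k hk).
  assert (H0 := freq_pos k fam hk m). assert (H1 := freq_increasing k fam m hk).
  assert (HK := ellK_pos _ Hk). set (K' := ellK (comodulus k)) in *.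
  set (r := freq k fam m) in *. set (r' := freq k fam (S m)) in *.
  assert (Ha : 0 < r * K') by now apply Rmult_lt_0_compat.
  assert (Hb : r * K' < r' * K') by now apply Rmult_lt_compat_r.
  assert (H := sinh_ratio_increasing _ _ (conj Ha Hb)).
  assert (S1 := sinh_pos _ Ha). assert (S2 := sinh_pos (r' * K') ltac:(lra)).
  assert (Hp : 0 < (if fam then k else 1)) by (destruct fam; lra).
  set (p := if fam then k else 1) in *.
  assert (E : r' * sinh (r * K') < r * sinh (r' * K')) by (apply Rmult_lt_reg_r with K'; lra).
  apply Rlt_0_minus.
  replace (_ - _) with (2 * p / (k ^ 2 * sinh (r * K') * sinh (r' * K')) *
    (r * sinh (r' * K') - r' * sinh (r * K'))) by (field; lra).
  apply Rmult_lt_0_compat; [|lra]. apply Rdiv_lt_0_compat; [lra|].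
  apply Rmult_lt_0_compat; [apply Rmult_lt_0_compat; [nra|easy]|easy].
Qed.

Lemma nome_exp k x : 0 < k < 1 ->
  exp (x * (- PI * ellK' k / ellK k)) = exp (- (PI / ellK k * x * ellK (comodulus k))).
Proof.
  intros hk. f_equal. unfold ellK'. fold (comodulus k). field. apply Rgt_not_eq, ellK_pos, hk.
Qed.

Lemma exp_pow (x : R) (n : nat) : exp x ^ n = exp (INR n * x).
Proof.
  induction n as [|n IH]; [simpl; now rewrite Rmult_0_l, exp_0|].
  rewrite S_INR. simpl. rewrite IH, <- exp_plus. f_equal. ring.
Qed.

Lemma nu_q'_eigval k m : 0 < k < 1 -> nu_q' k m = eigval k true m.
Proof.
  intros hk. rewrite eigval_eq by easy. assert (HK := ellK_pos k hk).
  assert (HK' := ellK_pos _ (comodulus_01 k hk)). assert (Hr := freq_pos k true hk m).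
  assert (Hy : 0 < freq k true m * ellK (comodulus k)) by now apply Rmult_lt_0_compat.
  assert (Hs := sinh_pos _ Hy).
  set (y := freq k true m * ellK (comodulus k)) in *.
  assert (E1 : Rpower (nome k) (INR m + 1 / 2) = exp (- y)).
  { unfold Rpower, nome. rewrite ln_exp. rewrite nome_exp by easy. easy. }
  assert (E2 : nome k ^ (2 * m + 1) = exp (- y) ^ 2).
  { unfold nome. rewrite !exp_pow.
    rewrite nome_exp by easy. f_equal. unfold y, freq.
    rewrite plus_INR, mult_INR. simpl (INR 1). simpl (INR 2). field. lra. }
  transitivity (2 * freq k true m / k * / sinh y); [|field; lra].
  unfold nu_q'. rewrite E1, E2, (sinh_inv y Hy).
  assert (He : 1 - exp (- y) ^ 2 <> 0).
  { assert (exp (- y) < 1) by (rewrite <- exp_0; apply exp_increasing; lra).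
    assert (Hp := exp_pos (- y)). nra. }
  unfold freq. field. repeat split; try easy; lra.
Qed.

Lemma nu_s'_eigval k m : 0 < k < 1 -> nu_s' k (S m) = eigval k false m.
Proof.
  intros hk. rewrite eigval_eq by easy. assert (HK := ellK_pos k hk).
  assert (HK' := ellK_pos _ (comodulus_01 k hk)). assert (Hr := freq_pos k false hk m).
  assert (Hy : 0 < freq k false m * ellK (comodulus k)) by now apply Rmult_lt_0_compat.
  assert (Hs := sinh_pos _ Hy).
  set (y := freq k false m * ellK (comodulus k)) in *.
  assert (E1 : nome k ^ S m = exp (- y)).
  { unfold nome. rewrite exp_pow, nome_exp, S_INR by easy. easy. }
  assert (E2 : nome k ^ (2 * S m) = exp (- y) ^ 2).
  { rewrite Nat.mul_comm, pow_mult, E1. easy. }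
  transitivity (2 * freq k false m / k ^ 2 * / sinh y); [|field; lra].
  unfold nu_s'. rewrite E1, E2, (sinh_inv y Hy).
  assert (He : 1 - exp (- y) ^ 2 <> 0).
  { assert (exp (- y) < 1) by (rewrite <- exp_0; apply exp_increasing; lra).
    assert (Hp := exp_pos (- y)). nra. }
  rewrite S_INR. unfold freq. field. repeat split; try easy; lra.
Qed.

(** The factor (-1)^n / (k^n (2n + 1)!) is the normalization that turns the monic recurrence into
    the symmetric one of [jacobi]. *)
Lemma SC_jacobi k fam x (P : nat -> R) : 0 < k < 1 -> P O = 1 ->
  (forall n, P (S n) = (x - jacobi_diag k fam n) * P n -
    k ^ 2 * (2 * INR n + 1) ^ 2 * (2 * INR n) ^ 2 * P (pred n)) ->
  jacobi k fam x (fun n => (-1) ^ n / (k ^ n * INR (Factorial.fact (2 * n + 1))) * P n).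
Proof.
  intros hk H0 H n. rewrite H.
  replace (2 * S n + 1)%nat with (S (S (2 * n + 1))) by lia.
  rewrite !fact_simpl, !mult_INR, !S_INR, plus_INR, mult_INR. simpl (INR 1). simpl (INR 2).
  assert (Hn := pos_INR n). assert (Hf := INR_fact_neq_0 (2 * n + 1)).
  assert (Hk : k ^ n <> 0) by (apply pow_nonzero; lra).
  destruct n as [|n].
  - simpl. field. lra.
  - simpl pred. replace (2 * S n + 1)%nat with (S (S (2 * n + 1))) in * by lia.
    rewrite !fact_simpl, !mult_INR, !S_INR, plus_INR, mult_INR in *. simpl (INR 1) in *.
    simpl (INR 2) in *.
    assert (Hn' := pos_INR n). assert (Hf' := INR_fact_neq_0 (2 * n + 1)).
    assert (Hk' : k ^ n <> 0) by (apply pow_nonzero; lra).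
    rewrite <- !tech_pow_Rmult.
    set (A := P (S n)). set (B := P n). set (f := INR (Factorial.fact (2 * n + 1))) in *.
    set (e := (-1) ^ n). set (p := k ^ n) in *.
    field. repeat split; try easy; lra.
Qed.

Lemma Psi_q_eigvec k m n : 0 < k < 1 -> Psi_q k m n = eigvec k true m n.
Proof.
  intros hk. assert (HK := ellK_pos k hk).
  assert (Ex : PI ^ 2 * (2 * INR m + 1) ^ 2 / (4 * ellK k ^ 2) = freq k true m ^ 2).
  { unfold freq. field. lra. }
  unfold Psi_q. rewrite Ex. set (x := freq k true m ^ 2).
  rewrite (eigvec_unique k true hk m (fun n => (-1) ^ n / (k ^ n * INR (Factorial.fact (2 * n +
    1))) * SC_q k n x)).
  - simpl. field.
  - fold x. apply SC_jacobi; [easy|easy|]. intros i. unfold jacobi_diag, alpha, beta.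
    destruct i as [|i]; cbn [SC_q pred]; change (INR 0) with 0; ring.
Qed.

Lemma Psi_s_eigvec k m n : 0 < k < 1 -> Psi_s k (S m) n = eigvec k false m n.
Proof.
  intros hk. assert (HK := ellK_pos k hk).
  assert (Ex : PI ^ 2 * INR (S m) ^ 2 / ellK k ^ 2 = freq k false m ^ 2).
  { rewrite S_INR. unfold freq. field. lra. }
  unfold Psi_s. rewrite Ex. set (x := freq k false m ^ 2).
  rewrite (eigvec_unique k false hk m (fun n => (-1) ^ n / (k ^ n * INR (Factorial.fact (2 * n +
    1))) * SC_s k n x)).
  - simpl. field.
  - fold x. apply SC_jacobi; [easy|easy|]. intros i. unfold jacobi_diag, alpha, beta.
    destruct i as [|i]; cbn [SC_s pred]; change (INR 0) with 0; ring.
Qed.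

Lemma Hq'_hankel_mx k m n : 0 < k < 1 -> Hq' k m n = hankel_mx (k ^ 2) (binom_weight k) m n.
Proof.
  intros hk. unfold hankel_mx. rewrite RInt_pow_weight, plus_INR.
  unfold Hq', binom_weight. rewrite pow_add. assert (Hm := pos_INR m). assert (Hn := pos_INR n).
  field. lra.
Qed.

Lemma Hs'_hankel_mx k m n : 0 < k < 1 -> Hs' k m n = hankel_mx 1 (binom_weight k) m n.
Proof.
  intros hk. unfold hankel_mx. rewrite RInt_pow_weight, plus_INR.
  unfold Hs', binom_weight. rewrite pow_add. assert (Hm := pos_INR m). assert (Hn := pos_INR n).
  field. lra.
Qed.

Lemma Chankel_op_spectrum k fam : 0 < k < 1 ->
  let T := Chankel_op (alpha k fam) (binom_weight k) in
  (forall H, (forall m n, H m n = hankel_mx (alpha k fam) (binom_weight k) m n) -> represents H T)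
    /\
  positive_operator T /\
  trace_class T /\
  (forall l, is_eigenvalue T l -> is_simple_eigenvalue T l) /\
  (forall l, is_eigenvalue T l <-> exists m, l = RtoC (eigval k fam m)) /\
  (forall m, is_eigenvector T (RtoC (eigval k fam m)) (fun n => RtoC (eigvec k fam m n))).
Proof.
  intros hk T. destruct (binom_weight_decay k hk) as [rho [M [Hrho Hd]]].
  assert (Hal := alpha_01 k fam hk). assert (Hal' : 0 <= alpha k fam <= 1) by lra.
  split; [|split; [|split]].
  - intros H. now apply Chankel_op_represents with rho M.
  - now apply Chankel_op_positive with rho M.
  - now apply Chankel_op_trace_class with rho M.
  - apply spectral_decomposition with rho M; try easy.
    + intros m. now apply eigvec_l2.
    + intros m n. now apply hankel_op_eigvec.
    + intros m. now apply eigvec_0.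
    + intros m. now apply eigval_decreasing.
    + intros v Hv H0. now apply (eigvec_complete k fam hk v Hv H0).
Qed.

Theorem theorem17 (k : R) (hk : 0 < k < 1) :
  (exists T : (nat -> C) -> nat -> C,
     represents (Hq' k) T /\
     positive_operator T /\
     trace_class T /\
     (forall l : C, is_eigenvalue T l -> is_simple_eigenvalue T l) /\
     (forall m : nat, nu_q' k (S m) < nu_q' k m) /\
     (forall l : C,
        is_eigenvalue T l <-> exists m : nat, l = RtoC (nu_q' k m)) /\
     (forall m : nat,
        is_eigenvector T (RtoC (nu_q' k m)) (fun n => RtoC (Psi_q k m n))))
  /\
  (exists T : (nat -> C) -> nat -> C,
     represents (Hs' k) T /\
     positive_operator T /\
     trace_class T /\
     (forall l : C, is_eigenvalue T l -> is_simple_eigenvalue T l) /\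
     (forall m : nat, (1 <= m)%nat -> nu_s' k (S m) < nu_s' k m) /\
     (forall l : C,
        is_eigenvalue T l <->
        exists m : nat, (1 <= m)%nat /\ l = RtoC (nu_s' k m)) /\
     (forall m : nat, (1 <= m)%nat ->
        is_eigenvector T (RtoC (nu_s' k m)) (fun n => RtoC (Psi_s k m n)))).
Proof.
  split.
  - destruct (Chankel_op_spectrum k true hk) as [H1 [H2 [H3 [H4 [H5 H6]]]]].
    exists (Chankel_op (alpha k true) (binom_weight k)).
    split; [apply H1; intros m n; now apply Hq'_hankel_mx|].
    do 3 (split; [easy|]).
    split; [intros m; rewrite !nu_q'_eigval by easy; now apply eigval_decreasing|].
    split.
    + intros l. rewrite H5. split; intros [m ->]; exists m; now rewrite nu_q'_eigval.
    + intros m. rewrite nu_q'_eigval by easy.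
      replace (fun n => RtoC (Psi_q k m n)) with (fun n => RtoC (eigvec k true m n)); [apply H6|].
      apply functional_extensionality. intros n. now rewrite Psi_q_eigvec.
  - destruct (Chankel_op_spectrum k false hk) as [H1 [H2 [H3 [H4 [H5 H6]]]]].
    exists (Chankel_op (alpha k false) (binom_weight k)).
    split; [apply H1; intros m n; now apply Hs'_hankel_mx|].
    do 3 (split; [easy|]).
    (* The stated index starts at 1 and that of [eigval] at 0, hence the shift by one here and
       below. *)
    split; [intros [|m] Hm; [lia|]; rewrite !nu_s'_eigval by easy; now apply eigval_decreasing|].
    split.
    + intros l. rewrite H5. split.
      * intros [m ->]. exists (S m). split; [lia|]. now rewrite nu_s'_eigval.
      * intros [[|m] [Hm ->]]; [lia|]. exists m. now rewrite nu_s'_eigval.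
    + intros [|m] Hm; [lia|]. rewrite nu_s'_eigval by easy.
      replace (fun n => RtoC (Psi_s k (S m) n)) with (fun n => RtoC (eigvec k false m n)); [apply
        H6|].
      apply functional_extensionality. intros n. now rewrite Psi_s_eigvec.
Qed.
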